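(* Let $G$ be the simple algebraic group of type $F_4$ over $\Bbbk$, let $T$ be a maximal torus of $G$, $W=N_G(T)/T$ its Weyl group, and $c\in W$ a Coxeter element (of order $12$). Then the connected components of $N_G(T)$ corresponding to the non-identity powers of $c$ are all periodic, and the orders of the elements in the components corresponding to $c,c^2,c^3,c^4,c^5,c^6$ are equal to $12,6,4,3,12,2$, respectively.
   Context: $\Bbbk$ is an algebraically closed field of characteristic zero. A connected component of an affine algebraic group is called periodic if all its elements have finite order. The connected components of $N_G(T)$ are the cosets $gT$, i.e. the elements of $W$. A Coxeter element of $W$ is a product of the reflections associated with the simple roots of a system of simple roots, taken in some order. *)

(* Defs.v *)
From mathcomp Require Import all_boot all_order all_algebra.
From mathcomp Require Import boolp classical_sets.
From mathcomp Require Import mpoly.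

Set Implicit Arguments.
Unset Strict Implicit.
Unset Printing Implicit Defensive.

Import GRing.Theory.
Local Open Scope classical_set_scope.
Local Open Scope ring_scope.

(* Affine algebraic groups are Zariski closed subgroups of GL_n(k), identified *)
(* with their sets of k-points; k is algebraically closed in all uses.         *)

(* A polynomial in n * n variables evaluated at the entries of a matrix. *)
Definition mxeval (k : fieldType) (n : nat) (p : {mpoly k[n * n]})
    (g : 'M[k]_n) : k :=
  p.@[fun i => mxvec g 0 i].

Definition zariski_closed (k : fieldType) (n : nat) (A : set 'M[k]_n) : Prop :=
  exists S : set {mpoly k[n * n]},
    A = [set g | g \in unitmx /\ forall p, S p -> mxeval p g = 0].

Definition zariski_connected (k : fieldType) (n : nat) (X : set 'M[k]_n) :
    Prop :=
  forall A B : set 'M[k]_n, zariski_closed A -> zariski_closed B ->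
    X `<=` A `|` B -> X `&` A `&` B = set0 ->
    X `&` A = set0 \/ X `&` B = set0.

Definition algebraic_group (k : fieldType) (n : nat) (G : set 'M[k]_n) : Prop :=
  [/\ zariski_closed G, G 1%:M,
      forall g h, G g -> G h -> G (g *m h) &
      forall g, G g -> G (invmx g)].

(* k[X] for X closed in GL_n: the coordinate ring of GL_n is generated by the *)
(* entries and 1/det.                                                         *)
Definition regular_on (k : fieldType) (n : nat) (X : set 'M[k]_n)
    (f : 'M[k]_n -> k) : Prop :=
  exists (p : {mpoly k[n * n]}) (m : nat),
    forall g, X g -> f g = mxeval p g / (\det g) ^+ m.

Definition algebraic_group_hom (k : fieldType) (n m : nat)
    (G : set 'M[k]_n) (H : set 'M[k]_m) (phi : 'M[k]_n -> 'M[k]_m) : Prop :=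
  [/\ forall g, G g -> H (phi g),
      forall g h, G g -> G h -> phi (g *m h) = phi g *m phi h &
      forall i j, regular_on G (fun g => phi g i j)].

Definition algebraic_group_isomorphic (k : fieldType) (n m : nat)
    (G : set 'M[k]_n) (H : set 'M[k]_m) : Prop :=
  exists (phi : 'M[k]_n -> 'M[k]_m) (psi : 'M[k]_m -> 'M[k]_n),
    [/\ algebraic_group_hom G H phi, algebraic_group_hom H G psi,
        forall g, G g -> psi (phi g) = g &
        forall h, H h -> phi (psi h) = h].

(* A closed connected normal subgroup is allowed to be only 1 or G; finite  *)
(* (central) normal subgroups are allowed, as usual for algebraic groups.   *)
Definition simple_algebraic_group (k : fieldType) (n : nat)
    (G : set 'M[k]_n) : Prop :=
  [/\ algebraic_group G, zariski_connected G,
      exists g h, [/\ G g, G h & g *m h <> h *m g] &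
      forall H : set 'M[k]_n, algebraic_group H -> zariski_connected H ->
        H `<=` G ->
        (forall g h, G g -> H h -> H (g *m h *m invmx g)) ->
        H = [set 1%:M] \/ H = G].

Definition diagonal_group (k : fieldType) (r : nat) : set 'M[k]_r :=
  [set g | g \in unitmx /\ is_diag_mx g].

Definition torus (k : fieldType) (n : nat) (T : set 'M[k]_n) : Prop :=
  algebraic_group T /\
  exists r : nat, algebraic_group_isomorphic T (@diagonal_group k r).

Definition maximal_torus (k : fieldType) (n : nat) (G T : set 'M[k]_n) : Prop :=
  [/\ torus T, T `<=` G &
      forall T' : set 'M[k]_n, torus T' -> T' `<=` G -> T `<=` T' -> T' = T].

(* The character group X(T): its elements are represented by functions on all *)
(* matrices, and two of them are the same character when they agree on T.     *)
(* The group law, written additively in X(T), is pointwise multiplication.    *)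
Definition character (k : fieldType) (n : nat) (T : set 'M[k]_n)
    (chi : 'M[k]_n -> k) : Prop :=
  [/\ regular_on T chi,
      forall t, T t -> chi t != 0 &
      forall s t, T s -> T t -> chi (s *m t) = chi s * chi t].

Definition eq_character (k : fieldType) (n : nat) (T : set 'M[k]_n)
    (chi psi : 'M[k]_n -> k) : Prop :=
  forall t, T t -> chi t = psi t.

(* Lie(G), the tangent space of G at the identity inside 'M_n: the common *)
(* kernel of the differentials at 1 of the polynomials vanishing on G.    *)
Definition lie_algebra (k : fieldType) (n : nat) (G : set 'M[k]_n) :
    set 'M[k]_n :=
  [set X | forall p : {mpoly k[n * n]}, (forall g, G g -> mxeval p g = 0) ->
     \sum_(i < n * n) mxeval p^`M(i) 1%:M * mxvec X 0 i = 0].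

(* Roots: nontrivial weights of T in Lie(G) under the adjoint action. *)
Definition group_root (k : fieldType) (n : nat) (G T : set 'M[k]_n)
    (alpha : 'M[k]_n -> k) : Prop :=
  [/\ character T alpha, ~ eq_character T alpha (fun=> 1) &
      exists2 X : 'M[k]_n, X <> 0 &
        lie_algebra G X /\
        forall t, T t -> t *m X *m invmx t = alpha t *: X].

(* The root system F_4 in Q^4: e_i being the standard basis, it consists of *)
(* +-e_i, +-e_i +- e_j (i != j) and (+-e_1 +- e_2 +- e_3 +- e_4)/2.         *)
Definition F4_root_system : set 'rV[rat]_4 :=
  [set v | exists (b : bool) (i : 'I_4), v = (-1) ^+ b *: delta_mx 0 i] `|`
  [set v | exists (b c : bool) (i j : 'I_4), i != j /\
     v = (-1) ^+ b *: delta_mx 0 i + (-1) ^+ c *: delta_mx 0 j] `|`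
  [set v | exists b : 'I_4 -> bool, v = \row_i ((-1) ^+ b i / 2)].

(* An injective homomorphism X(T) -> Q^4 carrying the roots onto F_4 is the   *)
(* same as a linear isomorphism from the space of X(T) tensor Q with its root *)
(* system onto Q^4 with F_4 (it is onto because F_4 spans Q^4).               *)
Definition has_type_F4 (k : fieldType) (n : nat) (G T : set 'M[k]_n) : Prop :=
  exists f : ('M[k]_n -> k) -> 'rV[rat]_4,
    [/\ forall chi psi, character T chi -> character T psi ->
          f (fun t => chi t * psi t) = f chi + f psi,
        forall chi psi, character T chi -> character T psi ->
          f chi = f psi <-> eq_character T chi psi &
        [set f alpha | alpha in group_root G T] = F4_root_system].

Definition normalizer (k : fieldType) (n : nat) (G T : set 'M[k]_n) :
    set 'M[k]_n :=
  [set g | G g /\ [set g *m t *m invmx g | t in T] = T].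

(* W = N_G(T)/T: its elements are the cosets gT, as sets of matrices. The  *)
(* product of cosets is the product of sets and T is the identity element. *)
Definition weyl_group (k : fieldType) (n : nat) (G T : set 'M[k]_n) :
    set (set 'M[k]_n) :=
  [set C | exists2 g, normalizer G T g & C = [set g *m t | t in T]].

Definition setmulmx (k : fieldType) (n : nat) (A B : set 'M[k]_n) :
    set 'M[k]_n :=
  [set a *m b | a in A & b in B].

Definition coset_exp (k : fieldType) (n : nat) (T C : set 'M[k]_n) (m : nat) :
    set 'M[k]_n :=
  iter m (setmulmx C) T.

(* The element w of W acting on X(T), by (w chi)(t) = chi(g^-1 t g) for g in   *)
(* the coset w, as the reflection chi |-> chi - <chi, alpha^v> alpha, where    *)
(* pairing chi is the integer <chi, alpha^v>.                                  *)
Definition root_reflection (k : fieldType) (n : nat) (G T : set 'M[k]_n)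
    (alpha : 'M[k]_n -> k) (w : set 'M[k]_n) : Prop :=
  weyl_group G T w /\
  exists pairing : ('M[k]_n -> k) -> int,
    pairing alpha = 2 /\
    forall chi, character T chi -> forall g t, w g -> T t ->
      chi (invmx g *m t *m g) = chi t * alpha t ^ (- pairing chi).

(* A system of simple roots, enumerated as alpha_0, ..., alpha_(r-1). *)
Definition simple_roots (k : fieldType) (n : nat) (G T : set 'M[k]_n)
    (r : nat) (alpha : 'I_r -> 'M[k]_n -> k) : Prop :=
  [/\ forall i, group_root G T (alpha i),
      forall z : 'I_r -> int,
        eq_character T (fun t => \prod_i alpha i t ^ z i) (fun=> 1) ->
        forall i, z i = 0 &
      forall beta, group_root G T beta ->
        exists m : 'I_r -> nat,
          eq_character T beta (fun t => \prod_i alpha i t ^+ m i) \/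
          eq_character T beta (fun t => \prod_i alpha i t ^- m i)].

(* The order of the factors is arbitrary because the enumeration of the system *)
(* of simple roots is.                                                         *)
Definition coxeter_element (k : fieldType) (n : nat) (G T : set 'M[k]_n)
    (c : set 'M[k]_n) : Prop :=
  exists (r : nat) (alpha : 'I_r -> 'M[k]_n -> k) (s : 'I_r -> set 'M[k]_n),
    [/\ simple_roots G T alpha,
        forall i, root_reflection G T (alpha i) (s i) &
        c = \big[@setmulmx k n/T]_(i < r) s i].

Definition has_coset_order (k : fieldType) (n : nat) (T C : set 'M[k]_n)
    (d : nat) : Prop :=
  [/\ (0 < d)%N, coset_exp T C d = T &
      forall m, (0 < m < d)%N -> coset_exp T C m <> T].

Definition has_order (k : fieldType) (n : nat) (g : 'M[k]_n) (d : nat) : Prop :=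
  [/\ (0 < d)%N, g ^+ d = 1%:M & forall m, (0 < m < d)%N -> g ^+ m <> 1%:M].

Definition periodic (k : fieldType) (n : nat) (C : set 'M[k]_n) : Prop :=
  forall g, C g -> exists d, has_order g d.

(* Main.v *)
Require Import Defs.
From Stdlib Require ZArith List Bool Lia Ring.

(** For g in the coset c and t in T put tau_i(t) = g^-i t g^i. On X(T) (x) Q the characteristic
    polynomial of a Coxeter element of F_4 is the cyclotomic polynomial X^4 - X^2 + 1, so
    tau_(i+4)(t) tau_i(t) = tau_(i+2)(t) and tau_(i+6)(t) = tau_i(t)^-1. Hence g^12 centralizes T,
    so that g^12 lies in T; being fixed by g, it satisfies u u = u, and g^12 = 1. The power
    (g^m t)^d is g^(md) times the product of the tau_(mi)(t) for i < d, whose factors cancel in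
    pairs tau_i, tau_(i+6) or in triples tau_i, tau_(i+4), tau_(i+8). Conversely a power g^j in T
    with 12 not dividing j would make c^4 or c^6 trivial and T a group of exponent 6.

    The relation for c is a finite computation: a reflection reverses root strings, which forces
    the pairings to be the Cartan integers, and the Gram matrices of systems of simple roots of
    F_4 can be enumerated.

    That T is its own centralizer in G is proved on the Lie algebra. The Jordan components of an
    element X of Lie(G) remain in Lie(G), and for each integer vector nu orthogonal to all the
    integer relations between the eigenvalues of X so does the corresponding diagonal replica. If
    X centralizes T, the replicas of its semisimple part commute with T, hence lie in Lie(T) by
    maximality. A nilpotent N centralizing T would lie in the radical of the trace form; the
    radical consists of nilpotent elements, their exponentials generate a dense subgroup of the
    simple group G, and every trace on G would be the trivial one. So the zero weight space is
    Lie(T), a polynomial vanishing on the big cell LTU vanishes on G, and the relations satisfied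
    by the diagonal blocks of LTU hold on G; on the centralizer of T they are those of T. *)

(** * Integral computations in F_4 *)

(** The hypotheses give an embedding of X(T) in Q^4 that matches the sets of roots and nothing more:
    neither an invariant inner product nor coroots come with it. The Cartan integers are therefore
    recovered from the sole fact that conjugation permutes the roots. The main obstacle is that the
    centralizer of T might a priori be disconnected. Its Lie algebra would not see a finite part,
    whereas g^12 is at first only known to centralize T. The big cell is brought in for this reason:
    density carries polynomial equations from the cell to every element of G, whatever its component
    in the centralizer. Simplicity is exploited through a single mechanism, the closure of a
    subgroup generated by exponentials being closed, connected and normal. The orders come from Phi
    = X^4 - X^2 + 1: it divides X^6 + 1 and X^8 + X^4 + 1, which are the cancellations in pairs and
    in triples, and Phi(1) = 1 is why g fixes only the identity of T. *)

Module F4Roots.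
Import ZArith List Bool Lia Ring.
Import ListNotations.
Local Open Scope Z_scope.

Definition vec : Type := (Z * Z * Z * Z)%type.
Definition vadd (x y : vec) : vec :=
  let '(x0, x1, x2, x3) := x in let '(y0, y1, y2, y3) := y in (x0 + y0, x1 + y1, x2 + y2, x3 + y3).
Definition vscale (c : Z) (x : vec) : vec :=
  let '(x0, x1, x2, x3) := x in (c * x0, c * x1, c * x2, c * x3).
Definition vsub (x y : vec) : vec := vadd x (vscale (-1) y).
Definition dot (x y : vec) : Z :=
  let '(x0, x1, x2, x3) := x in let '(y0, y1, y2, y3) := y in x0 * y0 + x1 * y1 + x2 * y2 + x3 * y3.
Definition veqb (x y : vec) : bool :=
  let '(x0, x1, x2, x3) := x in let '(y0, y1, y2, y3) := y in
  (x0 =? y0) && (x1 =? y1) && (x2 =? y2) && (x3 =? y3).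

Lemma veqbP x y : veqb x y = true <-> x = y.
Proof.
destruct x as [[[x0 x1] x2] x3], y as [[[y0 y1] y2] y3]; unfold veqb.
rewrite !andb_true_iff, !Z.eqb_eq; split.
- intros [[[-> ->] ->] ->]; reflexivity.
- intros E; injection E; intros; subst; auto.
Qed.

(* The vectors of F_4, doubled *)
Definition roots : list vec :=
  [(2,0,0,0); (-2,0,0,0); (0,2,0,0); (0,-2,0,0); (0,0,2,0); (0,0,-2,0); (0,0,0,2); (0,0,0,-2)] ++
  flat_map (fun s => flat_map (fun t =>
    [(s,t,0,0); (s,0,t,0); (s,0,0,t); (0,s,t,0); (0,s,0,t); (0,0,s,t)]) [2; -2]) [2; -2] ++
  flat_map (fun a => flat_map (fun b => flat_map (fun c => map (fun d => (a,b,c,d)) [1; -1])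
    [1; -1]) [1; -1]) [1; -1].

Definition isroot (x : vec) : bool := existsb (veqb x) roots.

Lemma isrootP x : isroot x = true <-> In x roots.
Proof.
unfold isroot; rewrite existsb_exists; split.
- intros [y [Hy E]]; apply veqbP in E; subst; exact Hy.
- intros H; exists x; split; [exact H | apply veqbP; reflexivity].
Qed.

(** One range serves for every bounded integer in the checks: products of two doubled roots, at most
    8 by Cauchy-Schwarz, and the p for which [y - p x] can still be a root. *)
Definition zrange : list Z := map (fun n => Z.of_nat n - 8) (seq 0 17).

Lemma in_zrange z : -8 <= z <= 8 -> In z zrange.
Proof.
intros H; unfold zrange; apply in_map_iff; exists (Z.to_nat (z + 8)); split; [lia|].
apply in_seq; lia.
Qed.

Lemma root_bound x : In x roots ->
  let '(x0, x1, x2, x3) := x in Z.abs x0 <= 2 /\ Z.abs x1 <= 2 /\ Z.abs x2 <= 2 /\ Z.abs x3 <= 2.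
Proof.
intros H; assert (E : forallb (fun x => let '(x0, x1, x2, x3) := x in
  (Z.abs x0 <=? 2) && (Z.abs x1 <=? 2) && (Z.abs x2 <=? 2) && (Z.abs x3 <=? 2)) roots = true)
  by (vm_compute; reflexivity).
rewrite forallb_forall in E; specialize (E x H); destruct x as [[[x0 x1] x2] x3].
rewrite !andb_true_iff, !Z.leb_le in E; tauto.
Qed.

Lemma root_nonzero x : In x roots -> x <> (0, 0, 0, 0).
Proof.
intros H ->; assert (E : isroot (0, 0, 0, 0) = false) by (vm_compute; reflexivity).
apply isrootP in H; congruence.
Qed.

Lemma coordinate_bound p a b : a <> 0 -> Z.abs b <= 2 -> Z.abs (b + -1 * (p * a)) <= 2 -> -8 <= p <= 8.
Proof.
intros Ha Hb Hp; assert (H : Z.abs (p * a) <= 4) by lia.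
rewrite Z.abs_mul in H; assert (Z.abs a >= 1) by lia.
assert (Z.abs p <= 4) by nia; lia.
Qed.

Lemma string_bound x y p : In x roots -> In y roots -> In (vsub y (vscale p x)) roots -> -8 <= p <= 8.
Proof.
intros Hx Hy Hp; pose proof (root_nonzero x Hx) as n0.
apply root_bound in Hy; apply root_bound in Hp.
destruct x as [[[x0 x1] x2] x3], y as [[[y0 y1] y2] y3]; simpl in Hy, Hp.
assert (H : x0 <> 0 \/ x1 <> 0 \/ x2 <> 0 \/ x3 <> 0).
{ destruct (Z.eq_dec x0 0), (Z.eq_dec x1 0), (Z.eq_dec x2 0), (Z.eq_dec x3 0); auto.
  exfalso; apply n0; congruence. }
destruct Hy as [A0 [A1 [A2 A3]]], Hp as [B0 [B1 [B2 B3]]].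
destruct H as [H|[H|[H|H]]]; eauto using coordinate_bound.
Qed.

Lemma existsb_Zeqb c l : existsb (Z.eqb c) l = true <-> In c l.
Proof.
rewrite existsb_exists; split; [intros [d [Hd E]]; apply Z.eqb_eq in E; subst; exact Hd|].
intros H; exists c; split; [exact H|apply Z.eqb_refl].
Qed.

(* The doubled F_4 lattice *)
Definition lattice (x : vec) : Prop :=
  let '(x0, x1, x2, x3) := x in (2 | x1 - x0) /\ (2 | x2 - x0) /\ (2 | x3 - x0).

Lemma lattice_comb z x y : lattice x -> lattice y -> lattice (vadd y (vscale z x)).
Proof.
destruct x as [[[x0 x1] x2] x3], y as [[[y0 y1] y2] y3].
intros [[a1 A1] [[a2 A2] [a3 A3]]] [[b1 B1] [[b2 B2] [b3 B3]]].
repeat split; [exists (b1 + z * a1)|exists (b2 + z * a2)|exists (b3 + z * a3)]; nia.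
Qed.

Definition root_norms : list Z := [4; 8].

Lemma root_lattice x : In x roots -> lattice x /\ In (dot x x) root_norms.
Proof.
intros H; assert (E : forallb (fun x => let '(x0, x1, x2, x3) := x in
    ((x1 - x0) mod 2 =? 0) && ((x2 - x0) mod 2 =? 0) && ((x3 - x0) mod 2 =? 0) &&
    existsb (Z.eqb (dot x x)) root_norms) roots = true) by (vm_compute; reflexivity).
rewrite forallb_forall in E; specialize (E x H); destruct x as [[[x0 x1] x2] x3].
rewrite !andb_true_iff, !Z.eqb_eq in E; destruct E as [[[E1 E2] E3] E4].
split; [repeat split; apply Z.mod_divide; lia|].
apply existsb_exists in E4; destruct E4 as [c [Hc E]]; apply Z.eqb_eq in E; rewrite E; exact Hc.
Qed.

Lemma square_le_8 c : c * c <= 8 -> -2 <= c <= 2.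
Proof. nia. Qed.

(** Norm at most 8 confines the coordinates to -2..2, and the remaining vectors are checked one by
    one. Together with [root_lattice] this makes being a root, for a lattice vector, a condition on
    its norm, so that later checks range over Gram data and not over pairs of roots. *)
Lemma lattice_root x : lattice x -> In (dot x x) root_norms -> In x roots.
Proof.
destruct x as [[[x0 x1] x2] x3]; intros [[a1 A1] [[a2 A2] [a3 A3]]] N.
assert (B : -2 <= x0 <= 2 /\ -2 <= x1 <= 2 /\ -2 <= x2 <= 2 /\ -2 <= x3 <= 2).
{ pose proof (Z.square_nonneg x0); pose proof (Z.square_nonneg x1).
  pose proof (Z.square_nonneg x2); pose proof (Z.square_nonneg x3).
  assert (x0 * x0 + x1 * x1 + x2 * x2 + x3 * x3 <= 8) by (destruct N as [N|[N|[]]]; unfold dot in N; lia).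
  assert (-2 <= x0 <= 2) by (apply square_le_8; lia); assert (-2 <= x1 <= 2) by (apply square_le_8; lia).
  assert (-2 <= x2 <= 2) by (apply square_le_8; lia); assert (-2 <= x3 <= 2) by (apply square_le_8; lia).
  tauto. }
pose (R := [-2; -1; 0; 1; 2]).
assert (inR : forall c, -2 <= c <= 2 -> In c R).
{ intros c Hc; unfold R; simpl; lia. }
assert (E : forallb (fun x0 => forallb (fun x1 => forallb (fun x2 => forallb (fun x3 =>
    let x := (x0, x1, x2, x3) in
    implb (((x1 - x0) mod 2 =? 0) && ((x2 - x0) mod 2 =? 0) && ((x3 - x0) mod 2 =? 0) &&
      existsb (Z.eqb (dot x x)) root_norms) (isroot x)) R) R) R) R = true) by (vm_compute; reflexivity).
destruct B as [B0 [B1 [B2 B3]]].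
rewrite forallb_forall in E; specialize (E _ (inR _ B0)).
rewrite forallb_forall in E; specialize (E _ (inR _ B1)).
rewrite forallb_forall in E; specialize (E _ (inR _ B2)).
rewrite forallb_forall in E; specialize (E _ (inR _ B3)).
cbv zeta in E; rewrite A1, A2, A3, !Z.mod_mul, !Z.eqb_refl in E by lia.
apply isrootP; apply (proj1 (implb_true_iff _ _) E).
apply existsb_Zeqb; exact N.
Qed.

(** The triple stands for (x.x, y.y, x.y); the last three conditions are the Cauchy-Schwarz
    inequality and the integrality of the two Cartan integers. *)
Definition gram_valid (t : Z * Z * Z) : bool :=
  let '(a, b, d) := t in
  existsb (Z.eqb a) root_norms && existsb (Z.eqb b) root_norms && existsb (Z.eqb d) zrange &&
  (d * d <=? a * b) && ((2 * d) mod a =? 0) && ((2 * d) mod b =? 0).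

Lemma root_gram_valid x y : In x roots -> In y roots -> gram_valid (dot x x, dot y y, dot x y) = true.
Proof.
intros Hx Hy; assert (E : forallb (fun x => forallb (fun y =>
  gram_valid (dot x x, dot y y, dot x y)) roots) roots = true) by (vm_compute; reflexivity).
rewrite forallb_forall in E; specialize (E x Hx).
rewrite forallb_forall in E; exact (E y Hy).
Qed.

Lemma gram_valid_forall (P : Z -> Z -> Z -> bool) :
  forallb (fun a => forallb (fun b => forallb (fun d => implb (gram_valid (a, b, d)) (P a b d))
    zrange) root_norms) root_norms = true ->
  forall x y, In x roots -> In y roots -> P (dot x x) (dot y y) (dot x y) = true.
Proof.
intros E x y Hx Hy; assert (V := root_gram_valid x y Hx Hy); assert (V' := V).
unfold gram_valid in V'; rewrite !andb_true_iff, !existsb_Zeqb in V'.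
destruct V' as [[[[[Ha Hb] Hd] _] _] _].
rewrite forallb_forall in E; specialize (E _ Ha).
rewrite forallb_forall in E; specialize (E _ Hb).
rewrite forallb_forall in E; specialize (E _ Hd).
rewrite V in E; exact E.
Qed.

Lemma dot_comb z x y : dot (vadd y (vscale z x)) (vadd y (vscale z x)) =
  dot y y + 2 * z * dot x y + z * z * dot x x.
Proof. destruct x as [[[? ?] ?] ?], y as [[[? ?] ?] ?]; unfold dot, vadd, vscale; ring. Qed.

Lemma vsub_scale p x y : vsub y (vscale p x) = vadd y (vscale (- p) x).
Proof.
destruct x as [[[? ?] ?] ?], y as [[[? ?] ?] ?]; unfold vsub, vadd, vscale; f_equal; [f_equal; [f_equal|]|]; ring.
Qed.

Lemma root_string z x y : In x roots -> In y roots ->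
  (In (vadd y (vscale z x)) roots <-> In (dot y y + 2 * z * dot x y + z * z * dot x x) root_norms).
Proof.
intros Hx Hy; rewrite <- dot_comb; split; intros H.
- apply root_lattice; exact H.
- apply lattice_root; [|exact H]; apply lattice_comb; apply root_lattice; assumption.
Qed.

(* A reflection b |-> b - p a of F_4 preserves every a-string, hence reverses it; this
   determines p. *)
Lemma reflection_pairing x y p : In x roots -> In y roots ->
  (forall z, In (vadd y (vscale z x)) roots -> In (vsub y (vscale (p + z) x)) roots) ->
  p * dot x x = 2 * dot x y.
Proof.
intros Hx Hy H.
pose (N := fun a b d z => existsb (Z.eqb (b + 2 * z * d + z * z * a)) root_norms).
assert (E := gram_valid_forall (fun a b d => forallb (fun p =>
    negb (forallb (fun z => implb (N a b d z) (N a b d (- (p + z)))) zrange)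
    || (p * a =? 2 * d)) zrange) ltac:(vm_compute; reflexivity) x y Hx Hy).
rewrite forallb_forall in E.
assert (Hp : -8 <= p <= 8).
{ apply (string_bound x y p Hx Hy).
  replace p with (p + 0) by lia; apply H.
  replace (vadd y (vscale 0 x)) with y; [exact Hy|].
  destruct x as [[[x0 x1] x2] x3], y as [[[y0 y1] y2] y3]; unfold vadd, vscale; f_equal; [f_equal; [f_equal|]|]; lia. }
specialize (E p (in_zrange p Hp)); apply orb_true_iff in E; destruct E as [E|E].
- apply negb_true_iff in E.
  assert (E' : forallb (fun z => implb (N (dot x x) (dot y y) (dot x y) z)
      (N (dot x x) (dot y y) (dot x y) (- (p + z)))) zrange = true).
  { apply forallb_forall; intros z _.
    destruct (N (dot x x) (dot y y) (dot x y) z) eqn:R; [|reflexivity]; simpl.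
    apply existsb_Zeqb, root_string in R; [|assumption|assumption].
    apply H in R; rewrite vsub_scale in R.
    apply existsb_Zeqb, root_string; assumption. }
  congruence.
- apply Z.eqb_eq; exact E.
Qed.

(** What the signs of coefficients tell about two distinct simple roots; that their product is not
    positive is a consequence, drawn in [obtuse_gram]. *)
Definition obtuse (x y : vec) : Prop :=
  (~ In (vsub x y) roots) /\ x <> y /\ vadd x y <> (0, 0, 0, 0).

(* the possible (x.x, y.y, x.y) for simple roots x, y *)
Definition gram_pairs : list (Z * Z * Z) :=
  [(4,4,-2); (4,8,0); (4,8,-4); (8,4,0); (8,4,-4); (8,8,0); (8,8,-4)].

Lemma dot_eq0 x : dot x x = 0 -> x = (0, 0, 0, 0).
Proof.
destruct x as [[[x0 x1] x2] x3]; unfold dot; intros H.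
pose proof (Z.square_nonneg x0); pose proof (Z.square_nonneg x1).
pose proof (Z.square_nonneg x2); pose proof (Z.square_nonneg x3).
f_equal; [f_equal; [f_equal|]|]; apply Z.eq_square_0; lia.
Qed.

Lemma dotC x y : dot x y = dot y x.
Proof. destruct x as [[[? ?] ?] ?], y as [[[? ?] ?] ?]; unfold dot; ring. Qed.

(** The norm of [x - y] is a - 2d + b. For d > 0 it is 0 or the norm of a root, both excluded, and a
    + 2d + b = 0 means y = -x. Two orthogonal short roots are excluded as well, since they differ by
    a long root: this is why (4,4,0) is missing from [gram_pairs]. *)
Lemma obtuse_gram x y : In x roots -> In y roots -> obtuse x y ->
  In (dot x x, dot y y, dot x y) gram_pairs.
Proof.
intros Hx Hy [H1 [H2 H3]].
assert (E := gram_valid_forall (fun a b d =>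
   existsb (Z.eqb (a - 2 * d + b)) (0 :: root_norms) || (a + 2 * d + b =? 0) ||
   existsb (fun t => let '(a', b', d') := t in (a =? a') && (b =? b') && (d =? d')) gram_pairs)
   ltac:(vm_compute; reflexivity) x y Hx Hy).
rewrite !orb_true_iff, existsb_Zeqb, Z.eqb_eq in E.
destruct E as [[E|E]|E].
- replace (dot x x - 2 * dot x y + dot y y) with (dot (vsub x y) (vsub x y)) in E
    by (rewrite (dotC x y); unfold vsub; rewrite dot_comb; ring).
  destruct E as [E|E].
  + exfalso; apply H2; symmetry in E; apply dot_eq0 in E; revert E.
    destruct x as [[[? ?] ?] ?], y as [[[? ?] ?] ?]; unfold vsub, vadd, vscale; intros E.
    pose proof (f_equal (fun v : vec => let '(a, _, _, _) := v in a) E) as E0.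
    pose proof (f_equal (fun v : vec => let '(_, a, _, _) := v in a) E) as E1.
    pose proof (f_equal (fun v : vec => let '(_, _, a, _) := v in a) E) as E2.
    pose proof (f_equal (fun v : vec => let '(_, _, _, a) := v in a) E) as E3.
    cbv beta iota in E0, E1, E2, E3; f_equal; [f_equal; [f_equal|]|]; lia.
  + exfalso; apply H1; unfold vsub in *; rewrite dot_comb in E; apply root_string; assumption.
- exfalso; apply H3, dot_eq0; rewrite <- E.
  destruct x as [[[? ?] ?] ?], y as [[[? ?] ?] ?]; unfold dot, vadd; ring.
- apply existsb_exists in E; destruct E as [[[a b] c] [I E]].
  rewrite !andb_true_iff, !Z.eqb_eq in E; destruct E as [[-> ->] ->]; exact I.
Qed.

Definition det3 (a b c d e f g h i : Z) : Z :=
  a * (e * i - f * h) - b * (d * i - f * g) + c * (d * h - e * g).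
Definition det4 (r0 r1 r2 r3 : vec) : Z :=
  let '(a0, a1, a2, a3) := r0 in let '(b0, b1, b2, b3) := r1 in
  let '(c0, c1, c2, c3) := r2 in let '(d0, d1, d2, d3) := r3 in
  a0 * det3 b1 b2 b3 c1 c2 c3 d1 d2 d3 - a1 * det3 b0 b2 b3 c0 c2 c3 d0 d2 d3
  + a2 * det3 b0 b1 b3 c0 c1 c3 d0 d1 d3 - a3 * det3 b0 b1 b2 c0 c1 c2 d0 d1 d2.

Definition comb (m r0 r1 r2 r3 : vec) : vec :=
  let '(m0, m1, m2, m3) := m in
  vadd (vscale m0 r0) (vadd (vscale m1 r1) (vadd (vscale m2 r2) (vscale m3 r3))).

Lemma det4_mul m0 m1 m2 m3 r0 r1 r2 r3 :
  det4 (comb m0 r0 r1 r2 r3) (comb m1 r0 r1 r2 r3) (comb m2 r0 r1 r2 r3) (comb m3 r0 r1 r2 r3) =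
  det4 m0 m1 m2 m3 * det4 r0 r1 r2 r3.
Proof.
destruct m0 as [[[? ?] ?] ?], m1 as [[[? ?] ?] ?], m2 as [[[? ?] ?] ?], m3 as [[[? ?] ?] ?].
destruct r0 as [[[? ?] ?] ?], r1 as [[[? ?] ?] ?], r2 as [[[? ?] ?] ?], r3 as [[[? ?] ?] ?].
unfold det4, det3, comb, vadd, vscale; ring.
Qed.

Lemma det4_gram r0 r1 r2 r3 :
  det4 (dot r0 r0, dot r0 r1, dot r0 r2, dot r0 r3) (dot r0 r1, dot r1 r1, dot r1 r2, dot r1 r3)
       (dot r0 r2, dot r1 r2, dot r2 r2, dot r2 r3) (dot r0 r3, dot r1 r3, dot r2 r3, dot r3 r3) =
  det4 r0 r1 r2 r3 * det4 r0 r1 r2 r3.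
Proof.
destruct r0 as [[[? ?] ?] ?], r1 as [[[? ?] ?] ?], r2 as [[[? ?] ?] ?], r3 as [[[? ?] ?] ?].
unfold det4, det3, dot; ring.
Qed.

(* the reflection in the i-th simple root, on coefficients over the simple roots; n i j is the
   Cartan integer <alpha_j, alpha_i^v> *)
Definition refl0 (n : vec) (c : vec) : vec := vsub c (vscale (dot n c) (1, 0, 0, 0)).
Definition refl1 (n : vec) (c : vec) : vec := vsub c (vscale (dot n c) (0, 1, 0, 0)).
Definition refl2 (n : vec) (c : vec) : vec := vsub c (vscale (dot n c) (0, 0, 1, 0)).
Definition refl3 (n : vec) (c : vec) : vec := vsub c (vscale (dot n c) (0, 0, 0, 1)).
Definition cox (n0 n1 n2 n3 c : vec) : vec := refl0 n0 (refl1 n1 (refl2 n2 (refl3 n3 c))).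

(* X^4 + 1 = X^2, from the 12th cyclotomic polynomial *)
Definition cox_relation (n0 n1 n2 n3 c : vec) : Prop :=
  let w := cox n0 n1 n2 n3 in vadd (w (w (w (w c)))) c = w (w c).

Definition gram_cartan (l : Z) (g : vec) : vec :=
  let '(g0, g1, g2, g3) := g in (2 * g0 / l, 2 * g1 / l, 2 * g2 / l, 2 * g3 / l).

Definition basis : list vec := [(1,0,0,0); (0,1,0,0); (0,0,1,0); (0,0,0,1)].

Definition pair_options (a b : Z) : list Z :=
  map (fun t => snd t) (filter (fun t => (fst (fst t) =? a) && (snd (fst t) =? b)) gram_pairs).

Lemma in_pair_options a b c : In (a, b, c) gram_pairs -> In c (pair_options a b).
Proof.
intros H; unfold pair_options; apply in_map_iff; exists (a, b, c); split; [reflexivity|].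
apply filter_In; split; [exact H|]; simpl; rewrite !Z.eqb_refl; reflexivity.
Qed.

(** All Gram matrices compatible with [gram_pairs] are tried, without identifying Dynkin diagrams.
    The condition that the determinant divide 64 holds for systems generating the whole lattice; it
    discards other independent systems such as B_4, of determinant 256, whose Coxeter elements
    violate the relation. *)
Lemma gram_check :
  forallb (fun a => forallb (fun b => forallb (fun c => forallb (fun d =>
  forallb (fun ab => forallb (fun ac => forallb (fun ad => forallb (fun bc => forallb (fun bd => forallb (fun cd =>
    let r0 := (a, ab, ac, ad) in let r1 := (ab, b, bc, bd) in
    let r2 := (ac, bc, c, cd) in let r3 := (ad, bd, cd, d) in
    let D := det4 r0 r1 r2 r3 in
    (D =? 0) || negb (64 mod D =? 0) ||
    forallb (fun e =>
      let w := cox (gram_cartan a r0) (gram_cartan b r1) (gram_cartan c r2) (gram_cartan d r3) in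
      let w2 := w (w e) in veqb (vadd (w (w w2)) e) w2) basis)
  (pair_options c d)) (pair_options b d)) (pair_options b c)) (pair_options a d)) (pair_options a c)) (pair_options a b))
  [4; 8]) [4; 8]) [4; 8]) [4; 8] = true.
Proof. vm_compute; reflexivity. Qed.

Lemma root_norm x : In x roots -> In (dot x x) [4; 8].
Proof.
intros H; assert (E : forallb (fun x => existsb (Z.eqb (dot x x)) [4; 8]) roots = true)
  by (vm_compute; reflexivity).
rewrite forallb_forall in E; specialize (E x H); apply existsb_exists in E.
destruct E as [y [Hy E]]; apply Z.eqb_eq in E; subst; exact Hy.
Qed.

Definition cartan (x y : vec) : Z := 2 * dot x y / dot x x.

Lemma cartan_dot x y : In x roots -> In y roots -> cartan x y * dot x x = 2 * dot x y.
Proof.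
intros Hx Hy; pose proof (root_gram_valid x y Hx Hy) as V; unfold gram_valid in V.
rewrite !andb_true_iff, !Z.eqb_eq in V; unfold cartan.
pose proof (Z.div_mod (2 * dot x y) (dot x x)); destruct (root_norm x Hx) as [N|[N|[]]]; lia.
Qed.

Lemma reflection_cartan x y p : In x roots -> In y roots ->
  (forall z, In (vadd y (vscale z x)) roots -> In (vsub y (vscale (p + z) x)) roots) ->
  p = cartan x y.
Proof.
intros Hx Hy H; pose proof (reflection_pairing x y p Hx Hy H) as E.
pose proof (cartan_dot x y Hx Hy); destruct (root_norm x Hx) as [N|[N|[]]]; lia.
Qed.

Ltac comb_ring c r0 r1 r2 r3 :=
  destruct c as [[[? ?] ?] ?], r0 as [[[? ?] ?] ?], r1 as [[[? ?] ?] ?], r2 as [[[? ?] ?] ?],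
    r3 as [[[? ?] ?] ?];
  unfold comb, refl0, refl1, refl2, refl3, vsub, vadd, vscale, dot;
  f_equal; [f_equal; [f_equal|]|]; ring.

(** Moves a reflection from the vectors to the coefficients; with its three analogues it turns the
    action of a product of reflections into [cox]. *)
Lemma comb_refl0 c r0 r1 r2 r3 n0 n1 n2 n3 :
  comb c (vsub r0 (vscale n0 r0)) (vsub r1 (vscale n1 r0)) (vsub r2 (vscale n2 r0)) (vsub r3 (vscale n3 r0)) =
  comb (refl0 (n0, n1, n2, n3) c) r0 r1 r2 r3.
Proof. comb_ring c r0 r1 r2 r3. Qed.

Lemma comb_refl1 c r0 r1 r2 r3 n0 n1 n2 n3 :
  comb c (vsub r0 (vscale n0 r1)) (vsub r1 (vscale n1 r1)) (vsub r2 (vscale n2 r1)) (vsub r3 (vscale n3 r1)) =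
  comb (refl1 (n0, n1, n2, n3) c) r0 r1 r2 r3.
Proof. comb_ring c r0 r1 r2 r3. Qed.

Lemma comb_refl2 c r0 r1 r2 r3 n0 n1 n2 n3 :
  comb c (vsub r0 (vscale n0 r2)) (vsub r1 (vscale n1 r2)) (vsub r2 (vscale n2 r2)) (vsub r3 (vscale n3 r2)) =
  comb (refl2 (n0, n1, n2, n3) c) r0 r1 r2 r3.
Proof. comb_ring c r0 r1 r2 r3. Qed.

Lemma comb_refl3 c r0 r1 r2 r3 n0 n1 n2 n3 :
  comb c (vsub r0 (vscale n0 r3)) (vsub r1 (vscale n1 r3)) (vsub r2 (vscale n2 r3)) (vsub r3 (vscale n3 r3)) =
  comb (refl3 (n0, n1, n2, n3) c) r0 r1 r2 r3.
Proof. comb_ring c r0 r1 r2 r3. Qed.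

Lemma comb_vadd c d r0 r1 r2 r3 :
  comb (vadd c d) r0 r1 r2 r3 = vadd (comb c r0 r1 r2 r3) (comb d r0 r1 r2 r3).
Proof.
destruct c as [[[? ?] ?] ?], d as [[[? ?] ?] ?], r0 as [[[? ?] ?] ?], r1 as [[[? ?] ?] ?],
  r2 as [[[? ?] ?] ?], r3 as [[[? ?] ?] ?]; unfold comb, vadd, vscale.
f_equal; [f_equal; [f_equal|]|]; ring.
Qed.

Lemma comb_basis r0 r1 r2 r3 : forall x, In x [r0; r1; r2; r3] ->
  exists e, In e basis /\ comb e r0 r1 r2 r3 = x.
Proof.
destruct r0 as [[[? ?] ?] ?], r1 as [[[? ?] ?] ?], r2 as [[[? ?] ?] ?], r3 as [[[? ?] ?] ?].
intros x [<-|[<-|[<-|[<-|[]]]]];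
  [exists (1, 0, 0, 0)|exists (0, 1, 0, 0)|exists (0, 0, 1, 0)|exists (0, 0, 0, 1)];
  (split; [simpl; tauto|]); unfold comb, vadd, vscale; f_equal; try (f_equal; try f_equal); ring.
Qed.

Theorem coxeter_relation (x0 x1 x2 x3 : vec) :
  In x0 roots -> In x1 roots -> In x2 roots -> In x3 roots ->
  obtuse x0 x1 -> obtuse x0 x2 -> obtuse x0 x3 -> obtuse x1 x2 -> obtuse x1 x3 -> obtuse x2 x3 ->
  (forall y, In y roots -> exists m, y = comb m x0 x1 x2 x3) ->
  forall e, In e basis ->
  cox_relation (cartan x0 x0, cartan x0 x1, cartan x0 x2, cartan x0 x3)
    (cartan x1 x0, cartan x1 x1, cartan x1 x2, cartan x1 x3)
    (cartan x2 x0, cartan x2 x1, cartan x2 x2, cartan x2 x3)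
    (cartan x3 x0, cartan x3 x1, cartan x3 x2, cartan x3 x3) e.
Proof.
intros R0 R1 R2 R3 O01 O02 O03 O12 O13 O23 gen e He; pose proof cartan_dot as Hn; set (n := cartan) in *.
assert (G01 := obtuse_gram _ _ R0 R1 O01); assert (G02 := obtuse_gram _ _ R0 R2 O02).
assert (G03 := obtuse_gram _ _ R0 R3 O03); assert (G12 := obtuse_gram _ _ R1 R2 O12).
assert (G13 := obtuse_gram _ _ R1 R3 O13); assert (G23 := obtuse_gram _ _ R2 R3 O23).
apply in_pair_options in G01, G02, G03, G12, G13, G23.
assert (E := gram_check).
rewrite forallb_forall in E; specialize (E _ (root_norm _ R0)).
rewrite forallb_forall in E; specialize (E _ (root_norm _ R1)).
rewrite forallb_forall in E; specialize (E _ (root_norm _ R2)).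
rewrite forallb_forall in E; specialize (E _ (root_norm _ R3)).
rewrite forallb_forall in E; specialize (E _ G01).
rewrite forallb_forall in E; specialize (E _ G02).
rewrite forallb_forall in E; specialize (E _ G03).
rewrite forallb_forall in E; specialize (E _ G12).
rewrite forallb_forall in E; specialize (E _ G13).
rewrite forallb_forall in E; specialize (E _ G23).
cbv beta zeta in E.
assert (ncart : forall x y, In x roots -> In y roots -> 2 * dot x y / dot x x = n x y).
{ intros x y Hx Hy; rewrite <- (Hn x y Hx Hy); apply Z.div_mul.
  destruct (root_norm x Hx) as [<-|[<-|[]]]; discriminate. }
assert (ncart' : forall x y, In x roots -> In y roots -> 2 * dot y x / dot x x = n x y).
{ intros x y Hx Hy; rewrite dotC; apply ncart; assumption. }
unfold gram_cartan in E; rewrite det4_gram in E.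
rewrite !ncart, !ncart' in E by assumption.
(* These four roots form a basis of the doubled lattice, of determinant 8. As integer combinations
   of the simple roots they show that the determinant d of the latter divides 8, so the Gram
   determinant d * d divides 64. *)
destruct (gen (2, 0, 0, 0)) as [m0 E0]; [apply isrootP; reflexivity|].
destruct (gen (0, 2, 0, 0)) as [m1 E1]; [apply isrootP; reflexivity|].
destruct (gen (0, 0, 2, 0)) as [m2 E2]; [apply isrootP; reflexivity|].
destruct (gen (1, 1, 1, 1)) as [m3 E3]; [apply isrootP; reflexivity|].
assert (D := det4_mul m0 m1 m2 m3 x0 x1 x2 x3); rewrite <- E0, <- E1, <- E2, <- E3 in D.
change (8 = det4 m0 m1 m2 m3 * det4 x0 x1 x2 x3) in D.
set (d := det4 x0 x1 x2 x3) in *; set (m := det4 m0 m1 m2 m3) in *.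
assert (d0 : d * d <> 0) by (intros K; assert (d = 0) by nia; subst d; lia).
assert (dd : 64 mod (d * d) = 0).
{ apply Z.mod_divide; [exact d0|]; exists (m * m); nia. }
rewrite dd in E; apply orb_true_iff in E; destruct E as [E|E].
{ apply orb_true_iff in E; destruct E as [E|E]; [apply Z.eqb_eq in E; contradiction|discriminate]. }
rewrite forallb_forall in E; specialize (E e He); apply veqbP in E; exact E.
Qed.

End F4Roots.

From HB Require Import structures.
From mathcomp Require Import all_boot all_order all_algebra.
From mathcomp Require Import boolp classical_sets.
From mathcomp Require Import mpoly.
From mathcomp Require Import ring lra zify ssrZ.

Set Implicit Arguments.
Unset Strict Implicit.
Unset Printing Implicit Defensive.

Import GRing.Theory Num.Theory Order.TTheory.
Local Open Scope classical_set_scope.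
Local Open Scope ring_scope.

(** * Derivations and unipotent subgroups *)

Section PolynomialFunctions.
Variables (k : fieldType) (n : nat).
Implicit Types (p q : {mpoly k[n * n]}) (g X Y : 'M[k]_n).

Definition mxvar (i j : 'I_n) : {mpoly k[n * n]} := 'X_(mxvec_index i j).

Lemma mpoly_alg_ind (P : {mpoly k[n * n]} -> Prop) :
  (forall c, P c%:MP) -> (forall i j, P (mxvar i j)) ->
  (forall p q, P p -> P q -> P (p + q)) ->
  (forall p q, P p -> P q -> P (p * q)) -> forall p, P p.
Proof.
move=> PC PX PD PM.
have P1 : P 1 by rewrite -mpolyC1; apply: PC.
have Pm m : P 'X_[m].
  rewrite mpolyXE_id; apply: (big_ind P) => // i _.
  elim: (m i) => [|e IH]; first by rewrite expr0.
  rewrite exprS; apply: PM => //; case/mxvec_indexP: i {IH} => i j; exact: PX.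
elim/mpolyind => [|c m p _ _ IH]; first by rewrite -mpolyC0; apply: PC.
by apply: PD => //; rewrite -mul_mpolyC; apply: PM.
Qed.

Lemma mxevalD p q g : mxeval (p + q) g = mxeval p g + mxeval q g.
Proof. exact: mevalD. Qed.
Lemma mxevalM p q g : mxeval (p * q) g = mxeval p g * mxeval q g.
Proof. exact: mevalM. Qed.
Lemma mxevalN p g : mxeval (- p) g = - mxeval p g.
Proof. exact: mevalN. Qed.
Lemma mxevalZ c p g : mxeval (c *: p) g = c * mxeval p g.
Proof. exact: mevalZ. Qed.
Lemma mxevalC c g : mxeval c%:MP g = c.
Proof. exact: mevalC. Qed.
Lemma mxeval0 g : mxeval 0 g = 0.
Proof. exact: meval0. Qed.
Lemma mxeval_var i j g : mxeval (mxvar i j) g = g i j.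
Proof. by rewrite /mxeval mevalXU mxvecE. Qed.
Lemma mxeval_sum (I : Type) (r : seq I) (P : pred I) (F : I -> {mpoly k[n * n]}) g :
  mxeval (\sum_(i <- r | P i) F i) g = \sum_(i <- r | P i) mxeval (F i) g.
Proof. exact: raddf_sum. Qed.
Lemma mxeval_prod (I : Type) (r : seq I) (P : pred I) (F : I -> {mpoly k[n * n]}) g :
  mxeval (\prod_(i <- r | P i) F i) g = \prod_(i <- r | P i) mxeval (F i) g.
Proof. exact: rmorph_prod. Qed.
Lemma mxevalX e p g : mxeval (p ^+ e) g = mxeval p g ^+ e.
Proof. exact: rmorphXn. Qed.

(* The derivation attached to X: the derivative at 0 of a |-> p (g (1 + a X)). *)
Definition mxder X p : {mpoly k[n * n]} :=
  \sum_(i < n * n) p^`M(i) *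
    mxvec (\matrix_(a, b) (\sum_c X c b *: mxvar a c)) 0 i.

Lemma mxder_linear X : linear (mxder X).
Proof.
move=> c p q; rewrite /mxder scaler_sumr -big_split; apply: eq_bigr => i _.
by rewrite mderivD mderivZ mulrDl scalerAl.
Qed.
HB.instance Definition _ X := GRing.isLinear.Build k _ _ *:%R (mxder X) (mxder_linear X).

Lemma mxderD X p q : mxder X (p + q) = mxder X p + mxder X q.
Proof. exact: linearD. Qed.
Lemma mxderZ X c p : mxder X (c *: p) = c *: mxder X p.
Proof. exact: linearZ. Qed.
Lemma mxder_sum X (I : Type) (r : seq I) (P : pred I) (F : I -> {mpoly k[n * n]}) :
  mxder X (\sum_(i <- r | P i) F i) = \sum_(i <- r | P i) mxder X (F i).
Proof. exact: linear_sum. Qed.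

Lemma mxderC X c : mxder X c%:MP = 0.
Proof. by apply: big1 => i _; rewrite mderivC mul0r. Qed.

Lemma mxderM X p q : mxder X (p * q) = mxder X p * q + p * mxder X q.
Proof.
rewrite /mxder mulr_suml mulr_sumr -big_split; apply: eq_bigr => i _ /=.
by rewrite mderivM; ring.
Qed.

Lemma mxder_var X i j : mxder X (mxvar i j) = \sum_c X c j *: mxvar i c.
Proof.
rewrite /mxder (bigD1 (mxvec_index i j)) //= big1 => [|l lij].
  rewrite mderivX mnmE eqxx scale1r addr0 mxvecE mxE.
  by rewrite (_ : (U_(_) - U_(_))%MM = 0%MM) ?mpolyX0 ?mul1r//; apply/mnmP => s; rewrite !mnmE subnn.
by rewrite mderivX mnmE eq_sym (negPf lij) scale0r mul0r.
Qed.

Lemma mxder_scaleD c X Y p : mxder (c *: X + Y) p = c *: mxder X p + mxder Y p.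
Proof.
elim/mpoly_alg_ind: p => [d|i j|p q IHp IHq|p q IHp IHq].
- by rewrite !mxderC scaler0 addr0.
- rewrite !mxder_var scaler_sumr -big_split; apply: eq_bigr => a _.
  by rewrite !mxE scalerDl scalerA.
- by rewrite !mxderD IHp IHq scalerDr addrACA.
- by rewrite !mxderM IHp IHq -!mul_mpolyC; ring.
Qed.

(** Both sides are derivations in p, so the matrix entries suffice. *)
Lemma mxder_lie X Y p :
  mxder (X *m Y - Y *m X) p = mxder X (mxder Y p) - mxder Y (mxder X p).
Proof.
elim/mpoly_alg_ind: p => [d|i j|p q IHp IHq|p q IHp IHq].
- by rewrite !mxderC subr0.
- rewrite !mxder_var !mxder_sum.
  under [X in _ = X - _]eq_bigr do rewrite mxderZ mxder_var scaler_sumr.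
  under [X in _ = _ - X]eq_bigr do rewrite mxderZ mxder_var scaler_sumr.
  rewrite exchange_big /= [X in _ = _ - X]exchange_big /= -sumrB.
  apply: eq_bigr => a _; rewrite !mxE scalerBl !scaler_suml.
  by congr (_ - _); apply: eq_bigr => b _; rewrite scalerA mulrC.
- by rewrite !mxderD IHp IHq; ring.
- by rewrite !mxderM IHp IHq !mxderD !mxderM; ring.
Qed.

Lemma lie_algebraE (G : set 'M[k]_n) X :
  lie_algebra G X <-> forall p, (forall g, G g -> mxeval p g = 0) -> mxeval (mxder X p) 1%:M = 0.
Proof.
suff E p : \sum_(i < n * n) mxeval p^`M(i) 1%:M * mxvec X 0 i = mxeval (mxder X p) 1%:M.
  by split=> H p /H; rewrite E.
rewrite mxeval_sum; apply: eq_bigr => l _; rewrite mxevalM; congr (_ * _).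
case/mxvec_indexP: l => i j; rewrite !mxvecE mxE mxeval_sum (bigD1 i) //= big1 => [|c ci].
  by rewrite mxevalZ mxeval_var mxE eqxx mulr1 addr0.
by rewrite mxevalZ mxeval_var mxE eq_sym (negPf ci) mulr0.
Qed.

Definition mxsubst (M : 'M[{mpoly k[n * n]}]_n) p : {mpoly k[n * n]} :=
  mmap (@mpolyC _ k) (fun i => mxvec M 0 i) p.

Lemma mxeval_subst M p g : mxeval (mxsubst M p) g = mxeval p (map_mx (fun q => mxeval q g) M).
Proof.
rewrite /mxsubst; elim/mpoly_alg_ind: p => [d|i j|p q IHp IHq|p q IHp IHq].
- by rewrite mmapC !mxevalC.
- by rewrite mmapX mmap1U mxvecE mxeval_var mxE.
- by rewrite mmapD !mxevalD IHp IHq.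
- by rewrite rmorphM !mxevalM IHp IHq.
Qed.

Definition mxtrans (A B : 'M[k]_n) p :=
  mxsubst (map_mx (@mpolyC _ k) A *m (\matrix_(i, j) mxvar i j) *m map_mx (@mpolyC _ k) B) p.

Lemma mxeval_trans A B p g : mxeval (mxtrans A B p) g = mxeval p (A *m g *m B).
Proof.
rewrite mxeval_subst; congr mxeval; apply/matrixP => i j; rewrite !mxE mxeval_sum.
apply: eq_bigr => a _; rewrite !mxE mxevalM mxeval_sum mxevalC; congr (_ * _).
by apply: eq_bigr => b _; rewrite !mxE mxevalM mxevalC mxeval_var.
Qed.

(** Left translations commute with these derivations and right translation by B conjugates them;
    writing the conjugation as [X *m B = B *m Y] avoids an inverse. *)
Lemma mxder_trans A B X Y p : X *m B = B *m Y ->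
  mxder X (mxtrans A B p) = mxtrans A B (mxder Y p).
Proof.
move=> XB; rewrite /mxtrans /mxsubst; set h := fun i => _.
have hE i j : h (mxvec_index i j) = \sum_a \sum_b (A i a * B b j) *: mxvar a b.
  rewrite /h mxvecE mxE exchange_big; apply: eq_bigr => b _; rewrite mxE mulr_suml.
  by apply: eq_bigr => a _; rewrite !mxE -mul_mpolyC mpolyCM; ring.
elim/mpoly_alg_ind: p => [d|i j|p q IHp IHq|p q IHp IHq].
- by rewrite mmapC !mxderC mmap0.
- rewrite mmapX mmap1U hE mxder_var !mxder_sum raddf_sum /=.
  under [RHS]eq_bigr do rewrite mmapZ mmapX mmap1U hE mul_mpolyC scaler_sumr.
  rewrite [RHS]exchange_big; apply: eq_bigr => a _ /=; rewrite mxder_sum.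
  under [LHS]eq_bigr do rewrite mxderZ mxder_var scaler_sumr.
  under [RHS]eq_bigr do rewrite scaler_sumr.
  rewrite exchange_big [RHS]exchange_big; apply: eq_bigr => c _ /=.
  under eq_bigr do rewrite scalerA; under [RHS]eq_bigr do rewrite scalerA.
  rewrite -!scaler_suml; congr (_ *: _).
  transitivity (A i a * (X *m B) c j); last rewrite XB.
    by rewrite mxE mulr_sumr; apply: eq_bigr => b _; ring.
  by rewrite mxE mulr_sumr; apply: eq_bigr => b _; ring.
- by rewrite mmapD !mxderD IHp IHq mmapD.
- by rewrite rmorphM !mxderM IHp IHq mmapD !rmorphM.
Qed.

(** Translating p by g moves the evaluation to the identity, where the definition of Lie(G)
    applies. *)
Lemma lie_algebra_mxder (G : set 'M[k]_n) X p :
  (forall g h, G g -> G h -> G (g *m h)) -> lie_algebra G X ->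
  (forall g, G g -> mxeval p g = 0) -> forall g, G g -> mxeval (mxder X p) g = 0.
Proof.
move=> GM /lie_algebraE LX Ip g Gg.
have := LX (mxtrans g 1%:M p); rewrite (mxder_trans _ (Y := X)) ?mulmx1 ?mul1mx// mxeval_trans !mulmx1.
by apply=> h Gh; rewrite mxeval_trans mulmx1 Ip//; apply: GM.
Qed.

Definition mxcurve (C : 'M[{poly k}]_n) p : {poly k} := mmap polyC (fun i => mxvec C 0 i) p.

Lemma horner_mxcurve C p a : (mxcurve C p).[a] = mxeval p (map_mx (horner^~ a) C).
Proof.
rewrite /mxcurve; elim/mpoly_alg_ind: p => [d|i j|p q IHp IHq|p q IHp IHq].
- by rewrite mmapC hornerC mxevalC.
- by rewrite mmapX mmap1U mxvecE mxeval_var mxE.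
- by rewrite mmapD hornerD mxevalD IHp IHq.
- by rewrite rmorphM hornerM mxevalM IHp IHq.
Qed.

Lemma deriv_mxcurve C X p : map_mx (@deriv k) C = C *m map_mx polyC X ->
  deriv (mxcurve C p) = mxcurve C (mxder X p).
Proof.
move=> CX; rewrite /mxcurve; elim/mpoly_alg_ind: p => [d|i j|p q IHp IHq|p q IHp IHq].
- by rewrite mmapC derivC mxderC mmap0.
- rewrite mmapX mmap1U mxvecE mxder_var raddf_sum /=.
  have /matrixP/(_ i j) := CX; rewrite !mxE => ->; apply: eq_bigr => c _.
  by rewrite mmapZ mmapX mmap1U mxvecE !mxE mulrC.
- by rewrite mmapD derivD mxderD mmapD IHp IHq.
- by rewrite rmorphM derivM mxderM mmapD !rmorphM IHp IHq.
Qed.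

(** First-order variant for curves such as the lines g (1 + a Y), whose tangent has the required
    form at 0 only. *)
Lemma deriv_mxcurve0 C X p : map_mx (horner^~ 0) (map_mx (@deriv k) C) = map_mx (horner^~ 0) C *m X ->
  (deriv (mxcurve C p)).[0] = mxeval (mxder X p) (map_mx (horner^~ 0) C).
Proof.
move=> CX; rewrite /mxcurve; elim/mpoly_alg_ind: p => [d|i j|p q IHp IHq|p q IHp IHq].
- by rewrite mmapC derivC mxderC mxeval0 horner0.
- rewrite mmapX mmap1U mxvecE mxder_var mxeval_sum.
  have /matrixP/(_ i j) := CX; rewrite !mxE => ->; apply: eq_bigr => c _.
  by rewrite mxevalZ mxeval_var !mxE mulrC.
- by rewrite mmapD derivD mxderD hornerD mxevalD IHp IHq.
- rewrite rmorphM derivM mxderM hornerD !hornerM mxevalD !mxevalM IHp IHq.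
  by rewrite -!horner_mxcurve.
Qed.

End PolynomialFunctions.

Lemma exists_nonroot (R : idomainType) (p : {poly R}) :
  [pchar R] =i pred0 -> p != 0 -> exists m : nat, p.[m.+1%:R] != 0.
Proof.
move=> /pcharf0P R0 pn0; apply: contrapT => H.
have /negP[] := pn0; apply/eqP.
apply: (@roots_geq_poly_eq0 _ _ [seq i.+1%:R | i <- iota 0 (size p)]).
- apply/allP => _ /mapP[i _ ->]; apply/rootP; apply: contrapT => /eqP h.
  by apply: H; exists i.
- rewrite map_inj_uniq ?iota_uniq// => i j ij; wlog le_ij : i j ij / (i <= j)%N.
    by move=> W; have [/W->|/ltnW/W->] := leqP i j.
  apply/eqP; rewrite eqn_leq le_ij /= -subn_eq0 -R0 natrB//.
  by move: ij; rewrite -[i.+1]addn1 -[j.+1]addn1 !natrD => /addIr ->; rewrite subrr.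
- by rewrite size_map size_iota.
Qed.

Lemma pchar_int : [pchar int] =i pred0.
Proof. exact: pchar_num. Qed.

(** For h = (1, x, x^2, ...) the product e h is the value at x of the polynomial with coefficients
    e, and some positive integer avoids the roots of finitely many non-zero polynomials. This
    provides a cocharacter that separates the weights of T. *)
Lemma exists_separating (r : nat) (E : seq 'rV[int]_r) : (forall e, e \in E -> e != 0) ->
  exists h : 'cV[int]_r, forall e, e \in E -> (e *m h) 0 0 != 0.
Proof.
move=> E0; pose pol (e : 'rV[int]_r) := rVpoly e.
have : \prod_(e <- E) pol e != 0.
  rewrite prodf_seq_neq0; apply/allP => e /E0 en0 /=.
  by apply: contra en0 => /eqP e0; rewrite -(rVpolyK e) [rVpoly e]e0 linear0.
move=> /(exists_nonroot pchar_int)[m]; rewrite horner_prod prodf_seq_neq0 => /allP Hm.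
exists (\col_i m.+1%:R ^+ i) => e /Hm /=.
rewrite (@horner_coef_wide _ r) ?size_poly// mxE; under [X in _ -> X != _]eq_bigr do rewrite mxE.
rewrite (eq_bigr (fun i : 'I_r => e 0 i * m.+1%:R ^+ i)) => [|i _]; last by rewrite coef_rVpoly_ord.
by [] .
Qed.

(** * Linear independence of Laurent monomials *)

Section Laurent.
Variables (k : fieldType) (k0 : [pchar k] =i pred0).

Lemma natf_eq0 m : (m%:R == 0 :> k) = (m == 0)%N.
Proof. by move/pcharf0P: k0. Qed.

Lemma intf_eq0 (m : int) : (m%:~R == 0 :> k) = (m == 0).
Proof.
by case: m => m; rewrite ?NegzE ?mulrNz ?oppr_eq0 -?pmulrn natf_eq0.
Qed.

Lemma poly_vanish_eq0 (p : {poly k}) : (forall a, a != 0 -> p.[a] = 0) -> p = 0.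
Proof.
move=> H; apply/eqP; apply: contrapT => /negP /(exists_nonroot k0)[m].
by rewrite H ?eqxx// natf_eq0.
Qed.

Lemma laurent1_indep (I : eqType) (s : seq I) (c : I -> k) (d : I -> int) :
  (forall a, a != 0 -> \sum_(i <- s) c i * a ^ d i = 0) ->
  forall d0, \sum_(i <- s | d i == d0) c i = 0.
Proof.
move=> H d0; pose N := (\sum_(i <- s) `|d i| + `|d0|)%N.
have dN i : i \in s -> (`|d i| <= N)%N.
  by move=> si; rewrite /N (big_rem i si) /= -!addnA leq_addr.
have E0 i : i \in s -> (absz (N%:Z + d i))%:Z = N%:Z + d i by move=> /dN; lia.
pose p : {poly k} := \sum_(i <- s) c i *: 'X^(absz (N%:Z + d i)).
have p0 : p = 0.
  apply: poly_vanish_eq0 => a an0.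
  transitivity (a ^+ N * \sum_(i <- s) c i * a ^ d i); last by rewrite H ?mulr0.
  rewrite horner_sum mulr_sumr big_seq [RHS]big_seq; apply: eq_bigr => i si.
  rewrite hornerZ hornerXn mulrCA; congr (_ * _).
  by rewrite [LHS]exprnP E0// expfzDr.
transitivity (p`_(absz (N%:Z + d0))); last by rewrite p0 coef0.
rewrite coef_sum big_mkcond /= big_seq [RHS]big_seq; apply: eq_bigr => i si; rewrite coefZ coefXn.
have -> : (absz (N%:Z + d0) == absz (N%:Z + d i)) = (d i == d0).
  have := dN _ si; have : (`|d0| <= N)%N by rewrite leq_addl.
  by case: eqP; case: eqP; lia.
by case: eqP; rewrite ?mulr1 ?mulr0.
Qed.

Section Multi.
Variable r : nat.
Implicit Types (z w : 'I_r -> k) (e : 'rV[int]_r).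

Definition nonvanishing z := forall i, z i != 0.
Definition monz z e : k := \prod_i z i ^ e 0 i.

Lemma monzD z e e' : nonvanishing z -> monz z (e + e') = monz z e * monz z e'.
Proof. by move=> zn; rewrite -big_split; apply: eq_bigr => i _; rewrite mxE expfzDr. Qed.

Lemma monz0 z : monz z 0 = 1.
Proof. by apply: big1 => i _; rewrite mxE expr0z. Qed.

Lemma monz_neq0 z e : nonvanishing z -> monz z e != 0.
Proof. by move=> zn; apply/prodf_neq0 => i _; apply: expfz_neq0. Qed.

Lemma monzM z w e : monz (fun i => z i * w i) e = monz z e * monz w e.
Proof. by rewrite -big_split; apply: eq_bigr => i _; rewrite expfzMl. Qed.

Lemma monz_exp (a : k) (h : 'cV[int]_r) e : a != 0 ->
  monz (fun i => a ^ h i 0) e = a ^ (e *m h) 0 0.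
Proof.
move=> an0; rewrite mxE /monz; apply: (big_ind2 (fun x y => x = a ^ y)) => [|u x v y -> ->|i _].
- by rewrite expr0z.
- by rewrite expfzDr.
- by rewrite exprz_exp mulrC.
Qed.

(** Restriction to the curve z_i = a^(h_i) reduces to one variable, h being chosen so that no other
    exponent of the list takes the same value as e0. Exponents may repeat, hence the grouped
    coefficients. *)
Lemma laurent_indep (I : eqType) (s : seq I) (c : I -> k) (e : I -> 'rV[int]_r) :
  (forall z, nonvanishing z -> \sum_(i <- s) c i * monz z (e i) = 0) ->
  forall e0, \sum_(i <- s | e i == e0) c i = 0.
Proof.
move=> H e0.
have [h Hh] := @exists_separating r [seq x <- [seq e i - e0 | i <- s] | x != 0]
  (fun x => fun xs => proj1 (andP (etrans (esym (mem_filter _ _ _)) xs))).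
have -> : \sum_(i <- s | e i == e0) c i = \sum_(i <- s | (e i *m h) 0 0 == (e0 *m h) 0 0) c i.
  rewrite big_seq_cond [RHS]big_seq_cond; apply: eq_bigl => i; case si : (i \in s) => //=.
  apply/eqP/eqP => [->//|E]; apply/eqP; rewrite -subr_eq0; apply/negP => /negP n0.
  have /Hh : e i - e0 \in [seq x <- [seq e i - e0 | i <- s] | x != 0].
    by rewrite mem_filter n0; apply/mapP; exists i.
  by rewrite mulmxBl mxE [X in _ + X]mxE E subrr eqxx.
apply: laurent1_indep => a an0.
rewrite -[RHS](H (fun i => a ^ h i 0)); last by move=> i; apply: expfz_neq0.
by apply: eq_bigr => i _; rewrite monz_exp.
Qed.

End Multi.
End Laurent.

Definition nilpotent_mx (k : fieldType) n (X : 'M[k]_n) : Prop := exists M, X ^+ M = 0.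

(** It is the exponential when [X ^+ M = 0]. For M = 0 the sum is empty, but then [X ^+ 0 = 0]
    forces size 0, which [mxexp_expr0] settles. *)
Definition mxexp (k : fieldType) n M (X : 'M[k]_n) : 'M[k]_n :=
  \sum_(i < M) (i`!%:R)^-1 *: X ^+ i.

(** * Jordan decomposition *)

Section JordanChevalley.
Variable k : closedFieldType.

Lemma poly_interpolation (N : nat) (rs : seq k) : uniq rs ->
  exists q : {poly k}, forall r, r \in rs -> ('X - r%:P) ^+ N %| q - r%:P.
Proof.
elim: rs => [|r rs IH] /=; first by exists 0.
case/andP => rrs /IH[q Hq].
pose m := \prod_(s <- rs) ('X - s%:P) ^+ N.
have /Bezout_eq1_coprimepP[[u v] /= uv] : coprimep m (('X - r%:P) ^+ N).
  rewrite coprimep_expr// coprimep_sym /m big_seq.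
  apply: (big_ind (coprimep _)) => [|a b ha hb|s srs].
  - exact: coprimep1.
  - by rewrite coprimepMr ha.
  - rewrite coprimep_expr// coprimep_XsubC2// subr_eq0.
    by apply: contraNneq rrs => <-.
exists (q + u * m * (r%:P - q)) => s; rewrite inE => /predU1P[->|srs].
  have -> : q + u * m * (r%:P - q) - r%:P = (q - r%:P) * (1 - u * m) by ring.
  by rewrite -uv [u * m + _]addrC addrK mulrA dvdp_mull.
rewrite addrAC dvdp_add ?Hq// dvdp_mulr// dvdp_mull// /m (big_rem s srs) /= dvdp_mulr//.
Qed.

(** S is q(X) with q congruent to r modulo (X - r)^N for each eigenvalue r, N being the degree of
    the characteristic polynomial. The latter divides both the product of the q - r over distinct r
    and (X - q)^N, so Cayley-Hamilton gives diagonalizability and nilpotency; commutation holds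
    because S is a polynomial in X. *)
Lemma jordan_chevalley n (X : 'M[k]_n) :
  exists S : 'M[k]_n, [/\ diagonalizable S, nilpotent_mx (X - S) &
    forall Y, comm_mx X Y -> comm_mx S Y].
Proof.
case: n X => [|n] X.
  exists 0; split=> [||Y _]; first exact: diagonalizable0.
    by exists 0%N; rewrite [LHS]thinmx0 [RHS]thinmx0.
  by rewrite [Y]thinmx0; exact: comm_mx_refl.
have [rts cX] := closed_field_poly_normal (char_poly X).
rewrite (monicP (char_poly_monic X)) scale1r in cX.
have [q Hq] := poly_interpolation (size rts) (undup_uniq rts).
have kill p : char_poly X %| p -> horner_mx X p = 0.
  by case/dvdpP => w ->; rewrite rmorphM /= Cayley_Hamilton mulr0.
have cXexp (F : k -> {poly k}) : (forall r, r \in rts -> ('X - r%:P) ^+ size rts %| F r) ->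
    char_poly X %| \prod_(r <- undup rts) F r.
  move=> HF; rewrite cX -prodr_undup_exp_count big_seq [\prod_(_ <- _) F _]big_seq.
  apply: (big_ind2 (fun a b => a %| b)) => [|a b c d ab cd|r]; first exact: dvdpp.
    exact: dvdp_mul.
  rewrite mem_undup => /HF; apply: dvdp_trans; apply: dvdp_exp2l; exact: count_size.
exists (horner_mx X q); split.
- apply/diagonalizableP; exists (undup rts); first exact: undup_uniq.
  apply: mxminpoly_min; rewrite rmorph_prod /=.
  rewrite (eq_bigr (fun r => horner_mx X (q - r%:P))) => [|r _].
    rewrite -rmorph_prod; apply: kill; apply: cXexp => r rr.
    by apply: Hq; rewrite mem_undup.
  by rewrite !rmorphB /= horner_mx_X !horner_mx_C.
- exists (size rts); rewrite -{1}(horner_mx_X X) -rmorphB -rmorphXn /=; apply: kill.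
  apply: (@dvdp_trans _ (\prod_(r <- undup rts) ('X - r%:P) ^+ size rts)).
    exact: cXexp.
  case: (posnP (size rts)) => [->|s0].
    by rewrite expr0 big1 ?dvd1p// => r _; rewrite expr0.
  rewrite prodrXl dvdp_exp2r//; apply: uniq_roots_dvdp; last first.
    by rewrite uniq_rootsE undup_uniq.
  apply/allP => r rr; rewrite -dvdp_XsubCl.
  have -> : 'X - q = ('X - r%:P) - (q - r%:P) by ring.
  rewrite dvdp_sub//; apply: dvdp_trans (Hq _ _); last exact: rr.
  by rewrite -{1}['X - _]expr1 dvdp_exp2l.
- by move=> Y XY; apply: comm_horner_mx.
Qed.

End JordanChevalley.

(** * Exponentials of nilpotent matrices *)

Section Exponential.
Variables (k : fieldType) (k0 : [pchar k] =i pred0) (n : nat).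

Lemma exprZmx (a : k) (X : 'M[k]_n) i : (a *: X) ^+ i = a ^+ i *: X ^+ i.
Proof.
elim: i => [|i IH]; first by rewrite !expr0 scale1r.
by rewrite !exprS IH; exact: etrans (esym (scalemxAl _ _ _)) (etrans (congr1 _ (esym (scalemxAr _ _ _))) (scalerA _ _ _)).
Qed.

Lemma fact_neq0 m : m`!%:R != 0 :> k.
Proof. by rewrite natf_eq0// -lt0n fact_gt0. Qed.

Definition expcurve M (X : 'M[k]_n) : 'M[{poly k}]_n :=
  \sum_(i < M) ((i`!%:R)^-1 *: 'X^i) *: map_mx polyC (X ^+ i).

Lemma horner_expcurve M X b : map_mx (horner^~ b) (expcurve M X) = mxexp M (b *: X).
Proof.
apply/matrixP => i j; rewrite mxE !summxE horner_sum; apply: eq_bigr => l _.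
by rewrite exprZmx !mxE hornerM hornerZ hornerXn hornerC mulrA.
Qed.

Lemma deriv_expcurve M (X : 'M[k]_n) : X ^+ M = 0 ->
  map_mx (@deriv k) (expcurve M X) = expcurve M X *m map_mx polyC X.
Proof.
case: M => [|M] XM.
  by apply/matrixP => i j; rewrite /expcurve big_ord0 mul0mx !mxE linear0.
rewrite /expcurve mulmx_suml [RHS]big_ord_recr /= -scalemxAl -map_mxM -[X ^+ M *m X]exprSr XM.
rewrite map_mx0 scaler0 addr0; apply/matrixP => i j.
rewrite mxE summxE linear_sum big_ord_recl [RHS]summxE /= [X in X + _](_ : _ = 0); last first.
  by rewrite !mxE derivM !derivC derivZ (derivC 1) scaler0 mul0r mulr0 addr0.
rewrite add0r.
apply: eq_bigr => l _; rewrite -scalemxAl -map_mxM -[X ^+ l *m X]/(X ^+ l * X) -exprSr.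
rewrite !mxE derivM derivC mulr0 addr0 derivZ derivXn /bump /= add1n; congr (_ * _).
rewrite -scaler_nat scalerA; congr (_ *: _).
by rewrite factS natrM invfM mulrAC mulVf ?mul1r// natf_eq0.
Qed.

Lemma mxexp0 M : mxexp M (0 : 'M[k]_n) = if M == 0%N then 0 else 1%:M.
Proof.
case: M => [|M]; rewrite /mxexp ?big_ord0// big_ord_recl /= expr0.
by rewrite fact0 invr1 scale1r big1 ?addr0// => i _; rewrite expr0n scaler0.
Qed.

Lemma mxexp_expr0 (X : 'M[k]_n) : X ^+ 0 = 0 -> forall A B : 'M[k]_n, A = B.
Proof.
move=> X0; suff H (A : 'M[k]_n) : A = 0 by move=> A B; rewrite (H A) (H B).
by rewrite -[LHS]mulmx1 -[1%:M]/(X ^+ 0) X0 mulmx0.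
Qed.

(** The polynomial curve exp(aX) exp(-aX) has derivative zero, so in characteristic zero it is
    constant, with value 1 at a = 0. *)
Lemma mxexpN M (X : 'M[k]_n) : X ^+ M = 0 -> mxexp M X *m mxexp M (- X) = 1%:M.
Proof.
case: M => [|M] XM; first exact: (mxexp_expr0 XM).
have XM' : (- X) ^+ M.+1 = 0 by rewrite -scaleN1r exprZmx XM scaler0.
pose F := expcurve M.+1 X *m expcurve M.+1 (- X).
have dF : map_mx (@deriv k) F = 0.
  have -> : map_mx (@deriv k) F = map_mx (@deriv k) (expcurve M.+1 X) *m expcurve M.+1 (- X) +
      expcurve M.+1 X *m map_mx (@deriv k) (expcurve M.+1 (- X)).
    apply/matrixP => i j; rewrite !mxE linear_sum -big_split; apply: eq_bigr => a _ /=.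
    by rewrite derivM !mxE.
  rewrite !deriv_expcurve// -!mulmxA -mulmxDr map_mxN mulmxN.
  suff -> : map_mx polyC X *m expcurve M.+1 (- X) = expcurve M.+1 (- X) *m map_mx polyC X.
    by rewrite subrr mulmx0.
  rewrite mulmx_sumr mulmx_suml; apply: eq_bigr => i _.
  rewrite -scalemxAl -scalemxAr -!map_mxM; congr (_ *: map_mx _ _).
  by rewrite -scaleN1r exprZmx -scalemxAl -scalemxAr -[_ *m _]exprS -[X ^+ i *m X]exprSr.
have Fc b : map_mx (horner^~ b) F = mxexp M.+1 (b *: X) *m mxexp M.+1 (b *: - X).
  rewrite -!horner_expcurve; apply/matrixP => i j; rewrite !mxE horner_sum.
  by apply: eq_bigr => a _; rewrite hornerM !mxE.
rewrite -[X in mxexp _ X *m _]scale1r -[X in _ *m mxexp _ X]scale1r -Fc.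
have <- : map_mx (horner^~ 0) F = 1%:M by rewrite Fc !scale0r !mxexp0 mulmx1.
apply/matrixP => i j; rewrite [LHS]mxE [RHS]mxE.
have /size1_polyC -> : (size (F i j) <= 1)%N; last by rewrite !hornerC.
apply/leq_sizeP => m m1; have /matrixP/(_ i j) := dF; rewrite !mxE => /polyP/(_ m.-1) /eqP.
rewrite coef_deriv coef0 prednK// -mulr_natr mulf_eq0 (natf_eq0 k0).
by rewrite (gtn_eqF m1) orbF => /eqP.
Qed.

(** Taylor expansion: p (g exp(aX)) is a polynomial in a whose m-th derivative at 0 is the value at
    g of the m-th iterate of [mxder X] on p, which is zero because I is stable. *)
Lemma mxexp_vanish (I : {mpoly k[n * n]} -> Prop) (X g : 'M[k]_n) M :
  (forall p, I p -> I (mxder X p)) -> (forall p, I p -> mxeval p g = 0) ->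
  X ^+ M = 0 -> forall p, I p -> forall a, mxeval p (g *m mxexp M (a *: X)) = 0.
Proof.
move=> IX Ig XM p Ip a.
pose C := map_mx polyC g *m expcurve M X.
have Ca b : map_mx (horner^~ b) C = g *m mxexp M (b *: X).
  apply/matrixP => i j; rewrite -horner_expcurve !mxE horner_sum; apply: eq_bigr => l _.
  by rewrite hornerM !mxE hornerC.
have dC : map_mx (@deriv k) C = C *m map_mx polyC X.
  rewrite -mulmxA -deriv_expcurve//; apply/matrixP => i j; rewrite !mxE linear_sum; apply: eq_bigr => l _.
  by rewrite /= derivM !mxE derivC mul0r add0r.
have dn m : forall q, I q -> (derivn m (mxcurve C q)).[0] = 0.
  elim: m => [|m IH] q Iq.
    rewrite derivn0 horner_mxcurve Ca scale0r.
    rewrite mxexp0; case: (M =P 0%N) XM => [-> X0|_ _]; last by rewrite mulmx1 Ig.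
    by rewrite (mxexp_expr0 X0 (g *m _) g) Ig.
  by rewrite derivSn (deriv_mxcurve _ dC) IH//; exact: IX.
rewrite -Ca -horner_mxcurve.
suff -> : mxcurve C p = 0 by rewrite horner0.
apply/polyP => m; rewrite coef0; have := dn m p Ip.
rewrite horner_coef0 coef_derivn addn0 ffactnn => /eqP.
by rewrite -mulr_natr mulf_eq0 (negPf (fact_neq0 m)) orbF => /eqP.
Qed.

End Exponential.

(** * Generalized eigencomponents in a stable subspace *)

Section GeneralizedEigen.
Variables (k : fieldType) (V : lmodType k) (L : {linear V -> V}) (I : V -> Prop).
Hypothesis I_lin : forall c u v, I u -> I v -> I (c *: u + v).
Hypothesis I_L : forall v, I v -> I (L v).

Definition eigdev (mu : k) (v : V) : V := L v - mu *: v.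
Definition geneig (mu : k) (v : V) := exists N, iter N (eigdev mu) v = 0.

Lemma eigdev_linear mu : linear (eigdev mu).
Proof.
move=> c u v; rewrite /eigdev linearP /= scalerDr scalerBr !scalerA [mu * c]mulrC.
by rewrite opprD addrACA.
Qed.
HB.instance Definition _ mu := GRing.isLinear.Build k V V *:%R (eigdev mu) (eigdev_linear mu).

Lemma eigdevC mu nu v : eigdev mu (eigdev nu v) = eigdev nu (eigdev mu v).
Proof.
have LB u w : L (u - w) = L u - L w by exact: raddfB.
have LZ c w : L (c *: w) = c *: L w by exact: linearZ.
rewrite /eigdev !LB !LZ !scalerBr !scalerA [mu * nu]mulrC !opprB !addrA.
rewrite -!addrA; congr (_ + _); rewrite addrCA [RHS]addrCA; congr (_ + _).
exact: addrC.
Qed.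

Lemma iter_eigdevC N mu nu v : iter N (eigdev mu) (eigdev nu v) = eigdev nu (iter N (eigdev mu) v).
Proof. by elim: N => //= N ->; rewrite eigdevC. Qed.

Lemma iter_eigdevCC N M mu nu v :
  iter N (eigdev mu) (iter M (eigdev nu) v) = iter M (eigdev nu) (iter N (eigdev mu) v).
Proof. by elim: M => //= M IH; rewrite iter_eigdevC IH. Qed.

Lemma iter_eigdev_linear N mu : linear (iter N (eigdev mu)).
Proof. by move=> c u v; elim: N => //= N ->; rewrite linearP. Qed.
HB.instance Definition _ N mu :=
  GRing.isLinear.Build k V V *:%R (iter N (eigdev mu)) (iter_eigdev_linear N mu).

Lemma geneig_iter M nu mu v : geneig mu v -> geneig mu (iter M (eigdev nu) v).
Proof. by case=> N vN; exists N; rewrite iter_eigdevCC vN linear0. Qed.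

Lemma geneig0 mu : geneig mu 0.
Proof. by exists 0. Qed.

Lemma geneigD mu u v : geneig mu u -> geneig mu v -> geneig mu (u + v).
Proof.
move=> [M uM] [N vN]; exists (M + N)%N; rewrite linearD /= {1}addnC !iterD uM vN !linear0.
by rewrite addr0.
Qed.

Let I_0 v : I v -> I 0.
Proof. by move=> Iv; have := I_lin (-1) Iv Iv; rewrite scaleN1r addNr. Qed.
Let I_Z c v : I v -> I (c *: v).
Proof. by move=> Iv; have := I_lin c Iv (I_0 Iv); rewrite addr0. Qed.
Let I_B u v : I u -> I v -> I (u - v).
Proof. by move=> Iu Iv; have := I_lin (-1) Iv Iu; rewrite scaleN1r addrC. Qed.
Let I_dev nu v : I v -> I (eigdev nu v).
Proof. by move=> Iv; apply: I_B; [exact: I_L|exact: I_Z]. Qed.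

(** Up to the factor 1/(mu - nu), u is the difference of [eigdev nu u] and [eigdev mu u]; the second
    has a smaller nilpotency order, so induction puts it in I. *)
Lemma geneig_cancel1 mu nu u : mu != nu -> geneig mu u -> I (eigdev nu u) -> I u.
Proof.
move=> mn [N]; elim: N u => [|N IH] u /=.
  by move=> -> /I_0.
rewrite -iterS iterSr => uN Iu.
have Iu' : I (eigdev mu u) by apply: IH => //; rewrite eigdevC; apply: I_dev.
have -> : u = (mu - nu)^-1 *: (eigdev nu u - eigdev mu u).
  rewrite /eigdev opprB [X in _ *: X]addrC addrA subrK -scalerBl scalerA mulVf ?scale1r//.
  by rewrite subr_eq0.
by apply/I_Z/I_B.
Qed.

Lemma geneig_cancel mu nu u M : mu != nu -> geneig mu u -> I (iter M (eigdev nu) u) -> I u.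
Proof.
move=> mn; elim: M u => //= M IH u gu Iu; apply: IH => //.
by apply: (geneig_cancel1 mn) Iu; exact: geneig_iter.
Qed.

(** The summands are removed one at a time: a power of [eigdev (m j)] kills v_j, preserves the
    hypotheses on the others, and is undone on u by [geneig_cancel] because m_j differs from mu. The
    argument thus applies to the infinite-dimensional space of polynomials. *)
Lemma geneig_component1 (J : eqType) (s : seq J) mu (m : J -> k) u (v : J -> V) :
  geneig mu u -> (forall j, j \in s -> m j != mu /\ geneig (m j) (v j)) ->
  I (u + \sum_(j <- s) v j) -> I u.
Proof.
elim: s u v => [|j s IH] u v gu Hs; first by rewrite big_nil addr0.
have [numu [M vM]] := Hs _ (mem_head _ _).
rewrite big_cons => Iuv; apply: (@geneig_cancel mu (m j) u M) => //; first by rewrite eq_sym.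
have IM w : I w -> I (iter M (eigdev (m j)) w) by move=> Iw; elim: (M) => //= N; exact: I_dev.
apply: (IH _ (fun i => iter M (eigdev (m j)) (v i))).
- exact: geneig_iter.
- move=> i si; have [|h1 h2] := Hs i; first by rewrite inE si orbT.
  by split=> //; exact: geneig_iter.
- by have := IM _ Iuv; rewrite !linearD /= vM add0r linear_sum.
Qed.

Lemma geneig_component (J : eqType) (s : seq J) (m : J -> k) (v : J -> V) :
  (forall j, j \in s -> geneig (m j) (v j)) -> I (\sum_(j <- s) v j) ->
  forall mu, I (\sum_(j <- s | m j == mu) v j).
Proof.
move=> Hs; rewrite -[X in I X]addr0 => Is mu.
pose s' := [seq j <- s | m j != mu].
apply: (@geneig_component1 _ s' mu m _ v).
- rewrite big_seq_cond; apply: (big_ind (geneig mu)) => [||j /andP[js /eqP <-]].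
  + exact: geneig0.
  + exact: geneigD.
  + exact: Hs.
- by move=> j; rewrite mem_filter => /andP[h js]; split=> //; apply: Hs.
- by move: Is; rewrite addr0 (bigID (fun j => m j == mu)) /= big_filter.
Qed.

End GeneralizedEigen.

Lemma sum_by_value (k : fieldType) (I J : eqType) (s : seq I) (f : I -> J) (c : I -> k) (th : J -> k) :
  (forall y, \sum_(i <- s | f i == y) c i = 0) -> \sum_(i <- s) th (f i) * c i = 0.
Proof.
move=> H; rewrite big_seq.
transitivity (\sum_(i <- s | i \in s)
    \sum_(y <- undup (map f s)) if f i == y then th y * c i else 0).
  apply: eq_bigr => i si; rewrite (bigD1_seq (f i)) ?undup_uniq ?mem_undup ?map_f//= eqxx.
  by rewrite big1 ?addr0// => y; rewrite eq_sym => /negPf ->.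
rewrite exchange_big; apply: big1 => y _ /=; rewrite -big_mkcondr -big_seq_cond /=.
by rewrite -mulr_sumr H mulr0.
Qed.

(** * Weights of polynomials under a diagonal torus *)

Section TorusWeights.
Variables (k : fieldType) (n : nat) (P : 'M[k]_n) (Pu : P \in unitmx).
Implicit Types (X g : 'M[k]_n) (z : 'I_n -> k) (p q : {mpoly k[n * n]}) (d : 'rV[int]_n).

Definition diagconj z : 'M[k]_n := invmx P *m diag_mx (\row_i z i) *m P.
Definition pairz (l : 'I_n -> k) d : k := \sum_c l c * (d 0 c)%:~R.

Lemma pairzD l d d' : pairz l (d + d') = pairz l d + pairz l d'.
Proof. by rewrite -big_split; apply: eq_bigr => c _; rewrite mxE rmorphD mulrDr. Qed.

(* p is a weight vector of weight d for the right translations by the diagonal torus *)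
Definition torus_weight X (l : 'I_n -> k) d p :=
  [/\ forall g z, nonvanishing z -> mxeval p (g *m diagconj z) = monz z d * mxeval p g,
      forall m, mxder (diagconj m) p = pairz m d *: p &
      geneig (mxder X) (pairz l d) p].

Lemma eigdev_mxderM X mu nu p q :
  eigdev (mxder X) (mu + nu) (p * q) = eigdev (mxder X) mu p * q + p * eigdev (mxder X) nu q.
Proof. by rewrite /eigdev /= mxderM -!mul_mpolyC mpolyCD; ring. Qed.

(** By the Leibniz rule, applying [eigdev] to a product lowers one of the two nilpotency orders in
    each term, so M + N applications suffice. *)
Lemma geneig_mxderM X mu nu p q : geneig (mxder X) mu p -> geneig (mxder X) nu q ->
  geneig (mxder X) (mu + nu) (p * q).
Proof.
move=> [M pM] [N qN].
suff H w : forall p q M N, (M + N <= w)%N -> iter M (eigdev (mxder X) mu) p = 0 ->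
    iter N (eigdev (mxder X) nu) q = 0 -> iter w (eigdev (mxder X) (mu + nu)) (p * q) = 0.
  by exists (M + N)%N; apply: H pM qN.
elim: w {p q M N pM qN} => [|w IH] p q M N.
  by rewrite leqn0 addn_eq0 => /andP[/eqP -> _] /= ->; rewrite mul0r.
case: M => [|M] MN pM qN; first by rewrite [p]pM mul0r linear0.
case: N MN qN => [|N] MN qN; first by rewrite [q]qN mulr0 linear0.
rewrite iterSr eigdev_mxderM linearD /=.
have pM' := pM; have qN' := qN; rewrite iterSr in pM'; rewrite iterSr in qN'.
rewrite (IH _ _ M N.+1) ?(IH _ _ M.+1 N) ?addr0 //; lia.
Qed.

Lemma torus_weightM X l d d' p q : torus_weight X l d p -> torus_weight X l d' q ->
  torus_weight X l (d + d') (p * q).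
Proof.
move=> [p1 p2 p3] [q1 q2 q3]; split.
- by move=> g z zn; rewrite !mxevalM p1// q1// monzD//; ring.
- by move=> m; rewrite mxderM p2 q2 pairzD -!mul_mpolyC mpolyCD; ring.
- by rewrite pairzD; exact: geneig_mxderM.
Qed.

Definition linform (i : 'I_n) (v : 'cV[k]_n) : {mpoly k[n * n]} := \sum_b v b 0 *: mxvar k i b.

Lemma mxeval_linform i v g : mxeval (linform i v) g = (g *m v) i 0.
Proof.
by rewrite mxeval_sum mxE; apply: eq_bigr => b _; rewrite mxevalZ mxeval_var mulrC.
Qed.

Lemma mxder_linform i v X : mxder X (linform i v) = linform i (X *m v).
Proof.
rewrite mxder_sum; under eq_bigr do rewrite mxderZ mxder_var scaler_sumr.
rewrite exchange_big; apply: eq_bigr => a _; rewrite mxE scaler_suml.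
by apply: eq_bigr => b _; rewrite scalerA mulrC.
Qed.

Lemma linformZ i c v : linform i (c *: v) = c *: linform i v.
Proof. by rewrite scaler_sumr; apply: eq_bigr => b _; rewrite mxE scalerA. Qed.

Lemma linformB i u v : linform i (u - v) = linform i u - linform i v.
Proof. by rewrite -sumrB; apply: eq_bigr => b _; rewrite !mxE scalerBl. Qed.

Lemma diagconj_col z c : diagconj z *m col c (invmx P) = z c *: col c (invmx P).
Proof.
rewrite !colE !mulmxA mulmxK// -mulmxA scalemxAr; congr (_ *m _).
rewrite mul_diag_mx; apply/matrixP => a b; rewrite !mxE.
by case: (a =P c) => [->|]; rewrite //= !mulr0.
Qed.

Variables (X : 'M[k]_n) (l : 'I_n -> k).
Hypothesis Xl : forall c, exists N, (X - (l c)%:M) ^+ N *m col c (invmx P) = 0.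

Lemma torus_weight_linform i c : torus_weight X l (delta_mx 0 c) (linform i (col c (invmx P))).
Proof.
have pc m : pairz m (delta_mx 0 c) = m c.
  rewrite /pairz (bigD1 c) //= big1 => [|e ec]; first by rewrite mxE !eqxx mulr1 addr0.
  by rewrite mxE (negPf ec) andbF mulr0.
split.
- move=> g z zn; rewrite !mxeval_linform -mulmxA diagconj_col -scalemxAr mxE; congr (_ * _).
  rewrite /monz (bigD1 c) //= big1 => [|e ec]; first by rewrite mxE !eqxx expr1z mulr1.
  by rewrite mxE (negPf ec) andbF expr0z.
- by move=> m; rewrite mxder_linform diagconj_col linformZ pc.
- have [N XN] := Xl c; exists N; rewrite pc.
  suff -> : iter N (eigdev (mxder X) (l c)) (linform i (col c (invmx P))) =
      linform i ((X - (l c)%:M) ^+ N *m col c (invmx P)).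
    by rewrite XN; apply: big1 => b _; rewrite mxE scale0r.
  elim: N {XN} => [|N IH] /=; first by rewrite expr0 mul1mx.
  rewrite IH /eigdev /= mxder_linform -linformZ -linformB exprS.
  by rewrite -[_ * _]/(_ *m _) -mulmxA mulmxBl mul_scalar_mx.
Qed.

Lemma torus_weight_const c : torus_weight X l 0 c%:MP.
Proof.
have p0 m : pairz m 0 = 0 by apply: big1 => i _; rewrite mxE mulr0.
split=> [g z _|m|]; first by rewrite !mxevalC monz0 mul1r.
  by rewrite mxderC p0 scale0r.
by exists 1%N; rewrite /= /eigdev /= p0 mxderC scale0r subr0.
Qed.

(** The entries of g P^-1 are weight vectors whose weights are unit vectors, the entries of g are
    linear combinations of them, and weights add up under multiplication. *)
Lemma torus_weight_decomposition p : exists s : seq ('rV[int]_n * {mpoly k[n * n]}),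
  (forall x, x \in s -> torus_weight X l x.1 x.2) /\ p = \sum_(x <- s) x.2.
Proof.
elim/mpoly_alg_ind: p => [c|i j|p q [s [Hs ->]] [t [Ht ->]]|p q [s [Hs ->]] [t [Ht ->]]].
- exists [:: (0, c%:MP)]; rewrite big_seq1; split=> // x.
  by rewrite inE => /eqP ->; exact: torus_weight_const.
- exists [seq (delta_mx 0 c, (P c j)%:MP * linform i (col c (invmx P))) | c <- index_enum 'I_n].
  split.
    move=> _ /mapP[c _ ->] /=; rewrite -[delta_mx _ _]add0r.
    by apply: torus_weightM; [exact: torus_weight_const|exact: torus_weight_linform].
  rewrite big_map /=; under eq_bigr do rewrite mul_mpolyC scaler_sumr.
  rewrite exchange_big /= (bigD1 j) //= [X in _ + X]big1 ?addr0.
    under eq_bigr do rewrite scalerA.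
    rewrite -scaler_suml (_ : \sum_c _ = (invmx P *m P) j j).
      by rewrite mulVmx// mxE eqxx scale1r.
    by rewrite mxE; apply: eq_bigr => c _; rewrite mxE mulrC.
  move=> b bj; under eq_bigr do rewrite scalerA.
  rewrite -scaler_suml (_ : \sum_c _ = (invmx P *m P) b j).
    by rewrite mulVmx// mxE (negPf bj) scale0r.
  by rewrite mxE; apply: eq_bigr => c _; rewrite mxE mulrC.
- exists (s ++ t); rewrite big_cat; split=> // x.
  by rewrite mem_cat => /orP[/Hs|/Ht].
- exists [seq (x.1 + y.1, x.2 * y.2) | x <- s, y <- t]; split.
    by move=> _ /allpairsP[[x y] [/= xs yt ->]] /=; apply: torus_weightM; [exact: Hs|exact: Ht].
  by rewrite big_allpairs_dep /= mulr_suml; apply: eq_bigr => x _; rewrite mulr_sumr.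
Qed.

Variable I : {mpoly k[n * n]} -> Prop.
Hypothesis I_lin : forall c p q, I p -> I q -> I (c *: p + q).
Hypothesis I_X : forall p, I p -> I (mxder X p).

(* Every polynomial of I is a sum of weight vectors whose parts with a given eigenvalue
   of X lie in I. *)
Lemma weight_parts_vanish g (s : seq ('rV[int]_n * {mpoly k[n * n]})) :
  (forall q, I q -> mxeval q g = 0) ->
  (forall x, x \in s -> torus_weight X l x.1 x.2) -> I (\sum_(x <- s) x.2) ->
  forall mu, \sum_(x <- s | pairz l x.1 == mu) mxeval x.2 g = 0.
Proof.
move=> Ig Hs Is mu.
rewrite -mxeval_sum; apply: Ig.
apply: (geneig_component I_lin I_X (m := fun x => pairz l x.1) (v := snd)) => // x xs.
by case: (Hs x xs).
Qed.

End TorusWeights.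

Section PolynomialMaps.
Variables (k : fieldType) (n : nat).
Implicit Types (F : 'M[k]_n -> k) (g : 'M[k]_n).

Definition polyfun F := exists p, forall g, F g = mxeval p g.

Lemma polyfun_const c : polyfun (fun=> c).
Proof. by exists c%:MP => g; rewrite mxevalC. Qed.
Lemma polyfun_entry i j : polyfun (fun g => g i j).
Proof. by exists (mxvar k i j) => g; rewrite mxeval_var. Qed.
Lemma polyfunD F F' : polyfun F -> polyfun F' -> polyfun (fun g => F g + F' g).
Proof. by move=> [p pE] [q qE]; exists (p + q) => g; rewrite mxevalD pE qE. Qed.
Lemma polyfunM F F' : polyfun F -> polyfun F' -> polyfun (fun g => F g * F' g).
Proof. by move=> [p pE] [q qE]; exists (p * q) => g; rewrite mxevalM pE qE. Qed.
Lemma polyfunN F : polyfun F -> polyfun (fun g => - F g).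
Proof. by move=> [p pE]; exists (- p) => g; rewrite mxevalN pE. Qed.
Lemma polyfunX e F : polyfun F -> polyfun (fun g => F g ^+ e).
Proof. by move=> [p pE]; exists (p ^+ e) => g; rewrite mxevalX pE. Qed.
Lemma polyfun_sum (I : Type) (r : seq I) (P : pred I) (F : I -> 'M[k]_n -> k) :
  (forall i, polyfun (F i)) -> polyfun (fun g => \sum_(i <- r | P i) F i g).
Proof.
move=> /choice[p pE]; exists (\sum_(i <- r | P i) p i) => g; rewrite mxeval_sum.
by apply: eq_bigr => i _.
Qed.
Lemma polyfun_prod (I : Type) (r : seq I) (P : pred I) (F : I -> 'M[k]_n -> k) :
  (forall i, polyfun (F i)) -> polyfun (fun g => \prod_(i <- r | P i) F i g).
Proof.
move=> /choice[p pE]; exists (\prod_(i <- r | P i) p i) => g; rewrite mxeval_prod.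
by apply: eq_bigr => i _.
Qed.
Lemma eq_polyfun F F' : F =1 F' -> polyfun F -> polyfun F'.
Proof. by move=> FF' [p pE]; exists p => g; rewrite -FF'. Qed.

Lemma polyfun_det m (A : 'M[k]_n -> 'M[k]_m) :
  (forall i j, polyfun (fun g => A g i j)) -> polyfun (fun g => \det (A g)).
Proof.
move=> HA; apply: polyfun_sum => s; apply: polyfunM; first exact: polyfun_const.
by apply: polyfun_prod => i; exact: HA.
Qed.

Lemma polyfun_adj m (A : 'M[k]_n -> 'M[k]_m) :
  (forall i j, polyfun (fun g => A g i j)) -> forall i j, polyfun (fun g => (\adj (A g)) i j).
Proof.
move=> HA i j; apply: (@eq_polyfun (fun g => cofactor (A g) j i)) => [g|].
  by rewrite mxE.
apply: polyfunM; first exact: polyfun_const.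
by apply: polyfun_det => a b; apply: eq_polyfun (HA (lift j a) (lift i b)) => g; rewrite !mxE.
Qed.

Lemma polyfun_mulmx m1 m2 m3 (A : 'M[k]_n -> 'M[k]_(m1, m2)) (B : 'M[k]_n -> 'M[k]_(m2, m3)) :
  (forall i j, polyfun (fun g => A g i j)) -> (forall i j, polyfun (fun g => B g i j)) ->
  forall i j, polyfun (fun g => (A g *m B g) i j).
Proof.
move=> HA HB i j; apply: (@eq_polyfun (fun g => \sum_l A g i l * B g l j)) => [g|].
  by rewrite mxE.
by apply: polyfun_sum => l; apply: polyfunM.
Qed.

Lemma polyfun_comp (A : 'M[k]_n -> 'M[k]_n) F :
  (forall i j, polyfun (fun g => A g i j)) -> polyfun F -> polyfun (fun g => F (A g)).
Proof.
move=> HA [p pE]; apply: (@eq_polyfun (fun g => mxeval p (A g))) => // {pE}.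
elim/mpoly_alg_ind: p => [c|i j|p q IHp IHq|p q IHp IHq].
- by apply: eq_polyfun (polyfun_const c) => g; rewrite mxevalC.
- by apply: eq_polyfun (HA i j) => g; rewrite mxeval_var.
- by apply: eq_polyfun (polyfunD IHp IHq) => g; rewrite mxevalD.
- by apply: eq_polyfun (polyfunM IHp IHq) => g; rewrite mxevalM.
Qed.

Lemma mxeval_invmx (p : {mpoly k[n * n]}) : exists q N, forall g, g \in unitmx ->
  mxeval q g = \det g ^+ N * mxeval p (invmx g).
Proof.
have [d dE] := polyfun_det polyfun_entry.
have [a aE] : exists a, forall x, forall g, (\adj g) x.1 x.2 = mxeval (a x) g.
  have/choice[a aE] : forall x : 'I_n * 'I_n, polyfun (fun g => (\adj g) x.1 x.2).
    by move=> x; apply: polyfun_adj => i j; exact: polyfun_entry.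
  by exists a.
elim/mpoly_alg_ind: p => [c|i j|p q [p' [M pE]] [q' [N qE]]|p q [p' [M pE]] [q' [N qE]]].
- by exists c%:MP, 0%N => g _; rewrite !mxevalC mul1r.
- exists (a (i, j)), 1%N => g gu; rewrite mxeval_var -aE /invmx gu expr1 [X in _ = _ * X]mxE mulrA mulfV ?mul1r//.
  by rewrite -unitfE -unitmxE.
- exists (d ^+ N * p' + d ^+ M * q'), (M + N)%N => g gu.
  by rewrite !(mxevalD, mxevalM, mxevalX) -dE pE// qE// exprD; ring.
- exists (p' * q'), (M + N)%N => g gu; rewrite !mxevalM pE// qE// exprD; ring.
Qed.

End PolynomialMaps.

(** * The Lie algebra and subgroups generated by exponentials *)

Section AlgebraicGroup.
Variables (k : fieldType) (k0 : [pchar k] =i pred0) (n : nat) (G : set 'M[k]_n).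
Hypothesis GG : algebraic_group G.
Implicit Types (g h X Y : 'M[k]_n) (p q : {mpoly k[n * n]}).

Definition vanishing (A : set 'M[k]_n) p := forall g, A g -> mxeval p g = 0.

Lemma group_unit g : G g -> g \in unitmx.
Proof. by case: GG => [[S ->] _ _ _] []. Qed.

Lemma group_mul g h : G g -> G h -> G (g *m h).
Proof. by case: GG => _ _ + _; apply. Qed.

Lemma group_1 : G 1%:M.
Proof. by case: GG. Qed.

Lemma group_inv g : G g -> G (invmx g).
Proof. by case: GG => _ _ _; apply. Qed.

Lemma mem_zariski_closure g : g \in unitmx -> (forall p, vanishing G p -> mxeval p g = 0) -> G g.
Proof.
move=> gu H; case: GG => [[S GS] _ _ _]; rewrite GS; split=> // p Sp; apply: H => h.
by rewrite GS => -[_]; apply.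
Qed.

Lemma vanishing_lin c p q : vanishing G p -> vanishing G q -> vanishing G (c *: p + q).
Proof. by move=> Ip Iq g Gg; rewrite mxevalD mxevalZ Ip// Iq// mulr0 addr0. Qed.

Lemma vanishing_mxder X p : lie_algebra G X -> vanishing G p -> vanishing G (mxder X p).
Proof. by move=> LX Ip g Gg; apply: lie_algebra_mxder LX Ip _ Gg; exact: group_mul. Qed.

Lemma lie_lin c X Y : lie_algebra G X -> lie_algebra G Y -> lie_algebra G (c *: X + Y).
Proof.
move=> /lie_algebraE LX /lie_algebraE LY; apply/lie_algebraE => p Ip.
by rewrite mxder_scaleD mxevalD mxevalZ LX// LY// mulr0 addr0.
Qed.

Lemma lie_0 : lie_algebra G 0.
Proof.
apply/lie_algebraE => p Ip.
by have := mxder_scaleD 1 0 0 p; rewrite !scale1r addr0 -{1}[mxder 0 p]addr0 => /addrI <-; rewrite mxeval0.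
Qed.

Lemma lie_Z c X : lie_algebra G X -> lie_algebra G (c *: X).
Proof. by move=> LX; have := lie_lin c LX lie_0; rewrite addr0. Qed.

Lemma lie_bracket X Y : lie_algebra G X -> lie_algebra G Y -> lie_algebra G (X *m Y - Y *m X).
Proof.
move=> LX LY; apply/lie_algebraE => p Ip; rewrite mxder_lie mxevalD mxevalN.
by rewrite !vanishing_mxder ?subr0//; try exact: vanishing_mxder; exact: group_1.
Qed.

Lemma lie_conj g X : G g -> lie_algebra G X -> lie_algebra G (g *m X *m invmx g).
Proof.
move=> Gg LX; have gu := group_unit Gg; apply/lie_algebraE => p Ip.
have : mxeval (mxder X (mxtrans g (invmx g) p)) 1%:M = 0.
  apply: vanishing_mxder group_1 => // h Gh; rewrite mxeval_trans Ip//.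
  by apply: group_mul (group_inv Gg); exact: group_mul.
by rewrite (mxder_trans _ (Y := g *m X *m invmx g)) ?mulmxA ?mulVmx ?mul1mx// mxeval_trans mulmx1 mulmxV.
Qed.

Lemma lie_exp X M a : lie_algebra G X -> X ^+ M = 0 -> G (mxexp M (a *: X)).
Proof.
move=> LX XM; have XaM : (a *: X) ^+ M = 0 by rewrite exprZmx XM scaler0.
apply: mem_zariski_closure => [|p Ip].
  by have /mulmx1_unit[] := mxexpN k0 XaM.
rewrite -[mxexp _ _]mul1mx; apply: (mxexp_vanish k0 (I := vanishing G)) => //.
- by move=> q Iq; exact: vanishing_mxder.
- by move=> q Iq; exact/Iq/group_1.
Qed.

Inductive expgen (A : set 'M[k]_n) : 'M[k]_n -> Prop :=
| expgen1 : expgen A 1%:M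
| expgenM g X M : expgen A g -> A X -> X ^+ M = 0 -> expgen A (g *m mxexp M X).

Lemma mxexp_eq1 X M : X ^+ M = 0 -> (forall a, mxexp M (a *: X) = 1%:M) -> X = 0.
Proof.
move=> XM E.
have dE : map_mx (@deriv k) (expcurve M X) = 0.
  apply/matrixP => i j; rewrite !mxE (_ : expcurve M X i j = ((1%:M : 'M[k]_n) i j)%:P) ?derivC//.
  apply/eqP; rewrite -subr_eq0; apply/eqP; apply: (poly_vanish_eq0 k0) => a _.
  by rewrite hornerD hornerN hornerC -(E a) -horner_expcurve mxE subrr.
have := congr1 (map_mx (horner^~ 0)) (deriv_expcurve k0 XM); rewrite dE.
have -> : map_mx (horner^~ 0) (expcurve M X *m map_mx polyC X) = X.
  transitivity (1%:M *m X); last exact: mul1mx.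
  rewrite -(E 0) -horner_expcurve; apply/matrixP => i j; rewrite !mxE horner_sum.
  by apply: eq_bigr => l _; rewrite hornerM !mxE hornerC.
by move=> <-; apply/matrixP => i j; rewrite !mxE horner0.
Qed.

Section Normal.
Variable A : set 'M[k]_n.
Hypothesis AG : A `<=` lie_algebra G.
Hypothesis A_Z : forall c X, A X -> A (c *: X).
Hypothesis A_conj : forall g X, G g -> A X -> A (g *m X *m invmx g).

Let A_N X : A X -> A (- X).
Proof. by rewrite -scaleN1r; exact: A_Z. Qed.

Lemma expgen_group g : expgen A g -> G g.
Proof.
elim=> [|h X M _ Gh AX XM]; first exact: group_1.
by apply: group_mul => //; rewrite -[X]scale1r; apply: lie_exp => //; exact: AG.
Qed.

Lemma expgen_mul g h : expgen A g -> expgen A h -> expgen A (g *m h).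
Proof.
move=> Eg; elim=> [|h' X M _ IH AX XM]; first by rewrite mulmx1.
by rewrite mulmxA; exact: expgenM.
Qed.

Lemma mxexp_expgen X M : A X -> X ^+ M = 0 -> expgen A (mxexp M X).
Proof. by move=> AX XM; rewrite -[mxexp _ _]mul1mx; apply: expgenM => //; exact: expgen1. Qed.

Lemma exprNmx X M : X ^+ M = 0 -> (- X) ^+ M = 0.
Proof. by move=> XM; rewrite -scaleN1r exprZmx XM scaler0. Qed.

Lemma expgen_inv g : expgen A g -> expgen A (invmx g).
Proof.
elim=> [|h X M Eh IH AX XM]; first by rewrite invmx1; exact: expgen1.
have E1 := mxexpN k0 XM; have [eu _] := mulmx1_unit E1.
have hu := group_unit (expgen_group Eh).
have -> : invmx (h *m mxexp M X) = mxexp M (- X) *m invmx h.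
  have E2 : h *m mxexp M X *m (mxexp M (- X) *m invmx h) = 1%:M.
    by rewrite -mulmxA [mxexp M X *m _]mulmxA E1 mul1mx mulmxV.
  have [u1 _] := mulmx1_unit E2.
  by rewrite -[RHS]mul1mx -(mulVmx u1) -mulmxA E2 mulmx1.
by apply: expgen_mul => //; apply: mxexp_expgen; [exact: A_N|exact: exprNmx].
Qed.

Lemma conjmx_expr g X i : g \in unitmx -> (g *m X *m invmx g) ^+ i = g *m X ^+ i *m invmx g.
Proof.
move=> gu; elim: i => [|i IH]; first by rewrite !expr0 mulmx1 mulmxV.
by rewrite !exprS IH -[LHS]/(_ *m _) -[X * _]/(_ *m _) !mulmxA mulmxKV.
Qed.

Lemma conjmx_mxexp g X M : g \in unitmx ->
  g *m mxexp M X *m invmx g = mxexp M (g *m X *m invmx g).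
Proof.
move=> gu; rewrite mulmx_sumr mulmx_suml; apply: eq_bigr => i _.
by rewrite conjmx_expr// -scalemxAr -scalemxAl.
Qed.

Lemma expgen_conj g h : G g -> expgen A h -> expgen A (g *m h *m invmx g).
Proof.
move=> Gg; have gu := group_unit Gg.
elim=> [|h' X M _ IH AX XM]; first by rewrite mulmx1 mulmxV//; exact: expgen1.
have -> : g *m (h' *m mxexp M X) *m invmx g =
    (g *m h' *m invmx g) *m mxexp M (g *m X *m invmx g).
  by rewrite -conjmx_mxexp// !mulmxA mulmxKV.
apply: expgenM => //; first exact: A_conj.
by rewrite conjmx_expr// XM mulmx0 mul0mx.
Qed.

Definition expclosure : set 'M[k]_n :=
  [set h | h \in unitmx /\ forall p, vanishing (expgen A) p -> mxeval p h = 0].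

Lemma expgen_closure g : expgen A g -> expclosure g.
Proof. by move=> Eg; split; [exact/group_unit/expgen_group|move=> p; apply]. Qed.

(** Density is used in one factor at a time: for y in the generated subgroup, z -> p (y z) vanishes
    on that subgroup, hence at h; then y -> p (y h) vanishes on it, hence at g. *)
Lemma expclosure_mul g h : expclosure g -> expclosure h -> expclosure (g *m h).
Proof.
move=> [gu Hg] [hu Hh]; split; first by rewrite unitmx_mul gu.
move=> p Ip; rewrite -[g]mul1mx -mxeval_trans; apply: Hg => y Ey.
rewrite mxeval_trans mul1mx -[_ *m h]mulmx1 -mxeval_trans; apply: Hh => z Ez.
by rewrite mxeval_trans mulmx1; apply: Ip; exact: expgen_mul.
Qed.

Lemma expclosure_algebraic : algebraic_group expclosure.
Proof.
split.
- by exists (vanishing (expgen A)).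
- exact/expgen_closure/expgen1.
- exact: expclosure_mul.
- move=> h [hu Hh]; split; first by rewrite unitmx_inv.
  move=> p Ip; have [q [N qE]] := mxeval_invmx p.
  have : mxeval q h = 0.
    apply: Hh => g Eg; rewrite qE; last exact/group_unit/expgen_group.
    by rewrite Ip ?mulr0//; exact: expgen_inv.
  move/eqP; rewrite qE// mulf_eq0 expf_eq0 (negPf (_ : \det h != 0)) ?andbF; first by move/eqP.
  by rewrite -unitfE -unitmxE.
Qed.

Lemma expclosure_sub : expclosure `<=` G.
Proof.
move=> h [hu Hh]; apply: mem_zariski_closure => // p Ip; apply: Hh => g Eg.
exact/Ip/expgen_group.
Qed.

Lemma expclosure_normal g h : G g -> expclosure h -> expclosure (g *m h *m invmx g).
Proof.
move=> Gg [hu Hh]; have gu := group_unit Gg; split; first by rewrite !unitmx_mul unitmx_inv gu hu.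
move=> p Ip; rewrite -mxeval_trans; apply: Hh => y Ey; rewrite mxeval_trans.
by apply: Ip; exact: expgen_conj.
Qed.

(** The curve a -> g exp(aX) joins g to g exp(X). If g lies in B, some equation p of C is non-zero
    there; for each equation q of B the product p q vanishes along the curve, so q does. Hence B
    contains all products of exponentials, and then their closure. *)
Lemma expclosure_connected : zariski_connected expclosure.
Proof.
suff W (B C : set 'M[k]_n) : zariski_closed B -> zariski_closed C ->
    expclosure `<=` B `|` C -> expclosure `&` B `&` C = set0 -> B 1%:M -> expclosure `&` C = set0.
  move=> B C cB cC BC BC0.
  have [B1|C1] : B 1%:M \/ C 1%:M by apply: BC; exact/expgen_closure/expgen1.
    by right; exact: W BC BC0 B1.
  by left; apply: (W C B) => //; [rewrite setUC|rewrite setIAC].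
move=> [S SB] [S' SC] BC BC0 B1.
have EB g : expgen A g -> B g.
  elim=> {g} [//|g X M Eg Bg AX XM].
  have Ea a : expclosure (g *m mxexp M (a *: X)).
    apply/expgen_closure/expgenM => //; first exact: A_Z.
    by rewrite exprZmx XM scaler0.
  have BN h : expclosure h -> B h -> ~ C h.
    by move=> Hh Bh Ch; have : (expclosure `&` B `&` C) h by []; rewrite BC0.
  have CN h : expclosure h -> ~ C h -> exists2 p, S' p & mxeval p h != 0.
    move=> Hh; rewrite SC /= => Ch; apply: contrapT => H; apply: Ch; split; first by case: Hh.
    by move=> p Sp; apply: contrapT => /eqP h0; apply: H; exists p.
  have [p Sp pg] := CN _ (expgen_closure Eg) (BN _ (expgen_closure Eg) Bg).
  have M0 : (M == 0%N) = false \/ forall (D E : 'M[k]_n), D = E.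
    by case: (M) XM => [/mxexp_expr0|m _]; [right|left].
  pose curve := map_mx polyC g *m expcurve M X.
  have curveE q a : (mxcurve curve q).[a] = mxeval q (g *m mxexp M (a *: X)).
    rewrite horner_mxcurve; congr mxeval; rewrite -horner_expcurve.
    apply/matrixP => i j; rewrite !mxE horner_sum; apply: eq_bigr => l _.
    by rewrite hornerM !mxE hornerC.
  case: M0 => [M0|triv]; last by rewrite (triv (_ *m _) g).
  have pn0 : mxcurve curve p != 0.
    apply: contra pg => /eqP p0; have := curveE p 0.
    by rewrite p0 horner0 scale0r mxexp0 M0 mulmx1 => <-.
  have Bq q : S q -> mxcurve curve q = 0.
    move=> Sq; have : mxcurve curve q * mxcurve curve p = 0.
      apply: (poly_vanish_eq0 k0) => a _; rewrite hornerM !curveE.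
      case: (BC _ (Ea a)); rewrite ?SB ?SC => -[_ H]; first by rewrite H ?mul0r.
      by rewrite [X in _ * X]H ?mulr0.
    by move/eqP; rewrite mulf_eq0 (negPf pn0) orbF => /eqP.
  rewrite SB; split; first by case: (Ea 1); rewrite scale1r.
  by move=> q Sq; rewrite -[X]scale1r -curveE Bq ?horner0.
have HB h : expclosure h -> B h.
  move=> [hu Hh]; rewrite SB; split=> // q Sq; apply: Hh => g /EB.
  by rewrite SB => -[_]; apply.
by rewrite -subset0 => h [Hh Ch]; rewrite -BC0; split=> //; split=> //; exact: HB.
Qed.

End Normal.

(** The closure is a closed connected normal subgroup of G; the trivial one is ruled out by the
    exponentials of a non-zero nilpotent element. *)
Lemma expgen_dense (A : set 'M[k]_n) : simple_algebraic_group G -> A `<=` lie_algebra G ->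
  (forall c X, A X -> A (c *: X)) -> (forall g X, G g -> A X -> A (g *m X *m invmx g)) ->
  (exists X, [/\ A X, nilpotent_mx X & X <> 0]) ->
  forall p, vanishing (expgen A) p -> vanishing G p.
Proof.
move=> [_ _ _ simple] AG A_Z A_conj [X [AX [M XM] Xn0]] p Ip.
have [H1|HG] := simple (expclosure A) (expclosure_algebraic AG A_Z) (expclosure_connected AG A_Z)
    (@expclosure_sub A AG) (expclosure_normal A_conj).
  2: by move=> g Gg; have [_] : expclosure A g by [rewrite HG]; apply.
case: Xn0; apply: (mxexp_eq1 XM) => a.
have : expclosure A (mxexp M (a *: X)).
  by apply: (expgen_closure AG); apply: mxexp_expgen; [exact: A_Z|rewrite exprZmx XM scaler0].
by rewrite H1.
Qed.

End AlgebraicGroup.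

(** * Tori *)

Section LaurentMatrices.
Variables (k : fieldType) (k0 : [pchar k] =i pred0) (r : nat).
Implicit Types (z w : 'I_r -> k) (F : ('I_r -> k) -> k).

Definition laurent F := exists s : seq ('rV[int]_r * k), forall z, nonvanishing z ->
  F z = \sum_(x <- s) x.2 * monz z x.1.

Lemma laurentD F F' : laurent F -> laurent F' -> laurent (fun z => F z + F' z).
Proof. by move=> [s sE] [t tE]; exists (s ++ t) => z zn; rewrite big_cat /= sE// tE. Qed.

Lemma laurentM F F' : laurent F -> laurent F' -> laurent (fun z => F z * F' z).
Proof.
move=> [s sE] [t tE]; exists [seq (x.1 + y.1, x.2 * y.2) | x <- s, y <- t] => z zn.
rewrite big_allpairs_dep /= sE// tE// mulr_suml; apply: eq_bigr => x _.
by rewrite mulr_sumr; apply: eq_bigr => y _ /=; rewrite monzD//; ring.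
Qed.

Lemma laurent_monz e : laurent (fun z => monz z e).
Proof. by exists [:: (e, 1)] => z _; rewrite big_seq1 mul1r. Qed.

Lemma laurent_const c : laurent (fun=> c).
Proof. by exists [:: (0, c)] => z _; rewrite big_seq1 monz0 mulr1. Qed.

Lemma eq_laurent F F' : (forall z, nonvanishing z -> F z = F' z) -> laurent F -> laurent F'.
Proof. by move=> FF' [s sE]; exists s => z zn; rewrite -FF'// sE. Qed.

Definition diagz z : 'M[k]_r := diag_mx (\row_i z i).

Lemma diagzE z i j : diagz z i j = if i == j then z i else 0.
Proof. by rewrite !mxE; case: eqP => [->|]. Qed.

Lemma diagzM z w : diagz z *m diagz w = diagz (fun i => z i * w i).
Proof. by rewrite mulmx_diag; congr diag_mx; apply/rowP => i; rewrite !mxE. Qed.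

Lemma det_diagz z : \det (diagz z) = \prod_i z i.
Proof. by rewrite det_diag; apply: eq_bigr => i _; rewrite mxE. Qed.

Lemma diagz_unit z : (diagz z \in unitmx) <-> nonvanishing z.
Proof.
rewrite unitmxE det_diagz unitfE; split=> [/prodf_neq0 H i|H]; first exact: H.
by apply/prodf_neq0 => i _.
Qed.

Lemma diagonal_group_diagz z : nonvanishing z -> diagonal_group (diagz z).
Proof. by move=> /diagz_unit zn; split=> //; exact: diag_mx_is_diag. Qed.

Lemma diagonal_groupP g : @diagonal_group k r g -> exists2 z, nonvanishing z & g = diagz z.
Proof.
move=> [gu /is_diag_mxP gd].
have gE : g = diagz (fun i => g i i).
  apply/matrixP => i j; rewrite diagzE; case: eqP => [->//|/eqP ij]; exact: gd.
by exists (fun i => g i i) => //; apply/diagz_unit; rewrite -gE.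
Qed.

Lemma monz_delta z i : monz z (delta_mx 0 i) = z i.
Proof.
rewrite /monz (bigD1 i) //= big1 => [|j ji]; first by rewrite mxE !eqxx expr1z mulr1.
by rewrite mxE (negPf ji) andbF expr0z.
Qed.

Lemma monz_constN z (m : nat) : nonvanishing z -> monz z (const_mx (- m%:Z)) = (\prod_i z i ^+ m)^-1.
Proof.
by move=> zn; rewrite -prodfV; apply: eq_bigr => i _; rewrite mxE -invr_expz -exprnP.
Qed.

Lemma regular_laurent f : regular_on (@diagonal_group k r) f -> laurent (fun z => f (diagz z)).
Proof.
move=> [p [m fE]].
apply: (@eq_laurent (fun z => mxeval p (diagz z) * monz z (const_mx (- m%:Z)))) => [z zn|].
  rewrite fE; last exact: diagonal_group_diagz.
  by rewrite monz_constN// det_diagz prodrXl.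
apply: laurentM; last exact: laurent_monz.
elim/mpoly_alg_ind: p {fE} => [c|i j|p q IHp IHq|p q IHp IHq].
- by apply: eq_laurent (laurent_const c) => z _; rewrite mxevalC.
- case: (i =P j) => [<-|ij].
    by apply: eq_laurent (laurent_monz (delta_mx 0 i)) => z _; rewrite mxeval_var diagzE eqxx monz_delta.
  by apply: eq_laurent (laurent_const 0) => z _; rewrite mxeval_var diagzE (introF eqP ij).
- by apply: eq_laurent (laurentD IHp IHq) => z _; rewrite mxevalD.
- by apply: eq_laurent (laurentM IHp IHq) => z _; rewrite mxevalM.
Qed.

Variable n : nat.

Lemma laurent_mx (F : ('I_r -> k) -> 'M[k]_n) : (forall i j, laurent (fun z => F z i j)) ->
  exists (E : seq 'rV[int]_r) (A : 'rV[int]_r -> 'M[k]_n), uniq E /\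
    forall z, nonvanishing z -> F z = \sum_(e <- E) monz z e *: A e.
Proof.
move=> HF; have /choice[s sE] : forall x : 'I_n * 'I_n, exists s : seq ('rV[int]_r * k),
    forall z, nonvanishing z -> F z x.1 x.2 = \sum_(x <- s) x.2 * monz z x.1.
  by move=> x; exact: HF.
exists (undup [seq y.1 | x <- index_enum ('I_n * 'I_n)%type, y <- s x]).
exists (fun e => \matrix_(i, j) \sum_(y <- s (i, j) | y.1 == e) y.2).
split=> [|z zn]; first exact: undup_uniq.
apply/matrixP => i j; rewrite (sE (i, j))// summxE /=.
under [RHS]eq_bigr do rewrite !mxE big_mkcond mulr_sumr.
rewrite exchange_big /= big_seq [RHS]big_seq; apply: eq_bigr => y ys.
rewrite (bigD1_seq y.1) ?undup_uniq//=.
  rewrite eqxx big1 ?addr0 1?mulrC// => e; rewrite eq_sym => /negPf ->; exact: mulr0.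
rewrite mem_undup; apply/allpairsPdep; exists (i, j), y; split=> //; exact: mem_index_enum.
Qed.

Lemma laurent_mx_indep (E : seq 'rV[int]_r) (A : 'rV[int]_r -> 'M[k]_n) : uniq E ->
  (forall z, nonvanishing z -> \sum_(e <- E) monz z e *: A e = 0) -> forall e, e \in E -> A e = 0.
Proof.
move=> uE H e eE; apply/matrixP => i j; rewrite mxE.
have := @laurent_indep _ k0 _ _ E (fun e => A e i j) id _ e.
rewrite (big_rem e eE) /= eqxx big_seq_cond big1 ?addr0.
  apply=> z zn; have /matrixP/(_ i j) := H z zn; rewrite summxE mxE => E0; rewrite -[RHS]E0.
  by apply: eq_bigr => x _; rewrite mxE mulrC.
by move=> x /andP[xE /eqP xe]; move: xE; rewrite xe mem_rem_uniqF.
Qed.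

End LaurentMatrices.

(* A torus is an algebra of Laurent monomials with coefficients in a complete family of
   orthogonal idempotents, the projectors onto its weight spaces. *)
Definition torus_frame (k : fieldType) n r (T : set 'M[k]_n) (E : seq 'rV[int]_r)
    (A : 'rV[int]_r -> 'M[k]_n) : Prop :=
  [/\ uniq E, T = [set \sum_(e <- E) monz z e *: A e | z in @nonvanishing k r],
      forall e f, e \in E -> f \in E -> A e *m A f = if e == f then A e else 0 &
      \sum_(e <- E) A e = 1%:M].

Section TorusFrame.
Variables (k : closedFieldType) (k0 : [pchar k] =i pred0) (n : nat).

(** The A_e are the coefficients of the parametrization [psi] in Laurent monomials. Comparing
    coefficients in psi(z w) = psi(z) psi(w), first in z and then in w, gives the orthogonality; the
    value at 1 gives the sum. *)
Lemma torus_frame_exists (T : set 'M[k]_n) : torus T ->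
  exists r (E : seq 'rV[int]_r) A, torus_frame T E A.
Proof.
move=> [TG [r [phi [psi [[phiD phiM phiR] [psiT psiM psiR] psiK phiK]]]]].
have [i j|E [A [uE psiE]]] := @laurent_mx _ r n (fun z => psi (diagz z)).
  exact: (regular_laurent (psiR i j)).
have one : nonvanishing (fun _ : 'I_r => 1 : k) by move=> i; exact: oner_neq0.
exists r, E, A; split=> //.
- apply/seteqP; split=> [t Tt|_ [z zn <-]].
    have [z zn dz] := diagonal_groupP (phiD _ Tt).
    by exists z => //; rewrite -psiE// -dz psiK.
  by rewrite -psiE//; apply/psiT/diagonal_group_diagz.
- move=> e f eE fE.
  have H z w : nonvanishing z -> nonvanishing w ->
      \sum_(e <- E) monz z e *: (\sum_(f <- E) monz w f *: (A e *m A f - if e == f then A e else 0)) = 0.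
    move=> zn wn.
    have zwn : nonvanishing (fun i => z i * w i) by move=> i; rewrite mulf_neq0.
    have := psiM _ _ (diagonal_group_diagz zn) (diagonal_group_diagz wn).
    rewrite diagzM !psiE// => /eqP; rewrite eq_sym -subr_eq0 => /eqP E0; rewrite -[RHS]E0.
    rewrite mulmx_suml -sumrB big_seq [RHS]big_seq; apply: eq_bigr => x xE.
    rewrite -scalemxAl mulmx_sumr monzM -scalerA -scalerBr; congr (_ *: _).
    transitivity (\sum_(y <- E) (monz w y *: (A x *m A y) - (if x == y then monz w y *: A x else 0))).
      apply: eq_bigr => y _; rewrite scalerBr; congr (_ - _).
      by case: eqP; rewrite ?scaler0.
    rewrite sumrB -big_mkcond /=; congr (_ - _).
      by apply: eq_bigr => y _; rewrite scalemxAr.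
    rewrite (eq_bigl (fun y => y == x)) => [|y]; last by rewrite eq_sym.
    rewrite -big_filter filter_pred1_uniq// big_seq1//.
  have H1 w : nonvanishing w -> \sum_(f <- E) monz w f *: (A e *m A f - if e == f then A e else 0) = 0.
    move=> wn; apply: (laurent_mx_indep k0 uE (A := fun e => \sum_(f <- E)
      monz w f *: (A e *m A f - if e == f then A e else 0))) => // z zn; exact: H.
  have := laurent_mx_indep k0 uE (A := fun f => A e *m A f - if e == f then A e else 0) H1 fE; move/eqP; rewrite subr_eq0 => /eqP //.
- have p1 : psi 1%:M = 1%:M.
    have D1 : @diagonal_group k r 1%:M by split; [exact: unitmx1|exact: scalar_mx_is_diag].
    have pu : psi 1%:M \in unitmx by exact: (group_unit TG (psiT _ D1)).
    have := psiM _ _ D1 D1; rewrite mulmx1 => E1.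
    by rewrite -[LHS](mulKmx pu) -E1 mulVmx.
  have := psiE _ one; rewrite (_ : diagz _ = 1%:M) ?p1; last first.
    by apply/matrixP => i j; rewrite diagzE mxE; case: eqP.
  move=> ->; apply: eq_bigr => e _; rewrite (_ : monz _ e = 1) ?scale1r//.
  by apply: big1 => i _; rewrite exp1rz.
Qed.

Lemma torus_frame_comm (T : set 'M[k]_n) r (E : seq 'rV[int]_r) A X : torus_frame T E A ->
  (forall t, T t -> comm_mx X t) -> forall e, e \in E -> comm_mx X (A e).
Proof.
move=> [uE TE _ _] HX e eE; apply/eqP; rewrite -subr_eq0; apply/eqP.
apply: (laurent_mx_indep k0 uE (A := fun e => X *m A e - A e *m X)) => // z zn.
have : comm_mx X (\sum_(e <- E) monz z e *: A e) by apply: HX; rewrite TE; exists z.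
move/eqP; rewrite -subr_eq0 => /eqP E0; rewrite -[RHS]E0 mulmx_sumr mulmx_suml -sumrB.
by apply: eq_bigr => f _; rewrite scalerBr scalemxAr scalemxAl.
Qed.

(** S and the idempotents are diagonalized together. At each coordinate the eigenvalues of the A_e
    are orthogonal idempotents of k with sum 1, so exactly one of them is 1: its index is the weight
    [w i]. *)
Lemma torus_codiagonalization (T : set 'M[k]_n) r (E : seq 'rV[int]_r) A S : torus_frame T E A ->
  diagonalizable S -> (forall e, e \in E -> comm_mx S (A e)) ->
  exists (P : 'M[k]_n) (l : 'I_n -> k) (w : 'I_n -> 'rV[int]_r),
    [/\ P \in unitmx, S = diagconj P l, forall i, w i \in E &
        forall e, e \in E -> A e = diagconj P (fun i => (w i == e)%:R)].
Proof.
move=> [uE TE AA A1] dS cS.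
have [P Pu HP] : codiagonalizable (S :: [seq A e | e <- E]).
  apply/codiagonalizableP; split.
    have cA e B : e \in E -> B \in S :: [seq A e | e <- E] -> comm_mx (A e) B.
      move=> eE; rewrite inE => /predU1P[->|/mapP[f fE ->]]; first by apply: comm_mx_sym; exact: cS.
      by rewrite /comm_mx !AA// eq_sym; case: eqP => [->|].
    move=> B C; rewrite inE => /predU1P[->|/mapP[e eE ->]]; last exact: cA.
    by rewrite inE => /predU1P[->|/mapP[f fE ->]]; [exact: comm_mx_refl|exact: cS].
  move=> B; rewrite inE => /predU1P[->//|/mapP[e eE ->]].
  have Ae : A e *m A e = A e by rewrite AA// eqxx.
  case: (n) (A e) Ae => [|m] B' BB.
    by rewrite [B']thinmx0; exact: diagonalizable0.
  apply/diagonalizableP; exists [:: 0; 1]; first by rewrite /= inE eq_sym oner_eq0.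
  apply: mxminpoly_min; rewrite !big_cons big_nil mulr1 rmorphM !rmorphB /= horner_mx_X !horner_mx_C.
  by rewrite mulrBr -[_ * B']/(_ *m _) raddf0 subr0 BB mulr1 subrr.
have dP B : B \in S :: [seq A e | e <- E] -> exists l : 'I_n -> k, B = diagconj P l.
  move=> BS; have /allP/(_ _ BS)/= /diagonalizable_forPex[d /simmxP] := HP.
  move=> /(_ Pu) PB; exists (fun i => d 0 i).
  rewrite /diagconj (_ : \row_i d 0 i = d); last by apply/rowP => i; rewrite mxE.
  by rewrite -mulmxA -PB mulKmx.
have [l Sl] := dP _ (mem_head _ _).
have /choice[a aE] : forall e, exists a : 'I_n -> k, e \in E -> A e = diagconj P a.
  move=> e; case eE : (e \in E); last by exists (fun=> 0).
  by have [|a ->] := dP (A e); [rewrite inE map_f ?orbT|exists a].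
have conjE z : P *m diagconj P z *m invmx P = diag_mx (\row_i z i).
  by rewrite /diagconj !mulmxA mulmxV// mul1mx mulmxK.
have aa e f i : e \in E -> f \in E -> a e i * a f i = if e == f then a e i else 0.
  move=> eE fE; have := AA e f eE fE; rewrite (aE e eE) (aE f fE).
  move/(congr1 (fun M => (P *m M *m invmx P) i i)).
  have -> : P *m (diagconj P (a e) *m diagconj P (a f)) *m invmx P =
      (P *m diagconj P (a e) *m invmx P) *m (P *m diagconj P (a f) *m invmx P).
    by rewrite !mulmxA mulmxKV.
  rewrite !conjE mulmx_diag; case: eqP => [ef|_].
    by rewrite conjE !mxE eqxx.
  by rewrite mulmx0 mul0mx !mxE eqxx.
have a1 i : \sum_(e <- E) a e i = 1.
  have := congr1 (fun M => (P *m M *m invmx P) i i) A1.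
  rewrite mulmx1 mulmxV// mulmx_sumr mulmx_suml summxE [RHS]mxE eqxx => E1; rewrite -[RHS]E1.
  by rewrite big_seq [RHS]big_seq; apply: eq_bigr => e eE; rewrite (aE e eE) conjE !mxE eqxx.
have /choice[w Hw] : forall i, exists e, e \in E /\ a e i != 0.
  move=> i; apply: contrapT => H; have := a1 i; rewrite big_seq big1.
    by move=> /esym/eqP; rewrite oner_eq0.
  by move=> e eE; apply: contrapT => /eqP ae; apply: H; exists e.
exists P, l, w; split=> // [i|e eE]; first by case: (Hw i).
rewrite (aE e eE); congr (_ *m diag_mx _ *m _); apply/rowP => i; rewrite !mxE.
have [wE wn] := Hw i; case: eqP => [<-|/eqP we].
  by apply: (mulfI wn); rewrite aa// eqxx mulr1.
by apply/eqP; have := aa _ _ i wE eE; rewrite (negPf we) => /eqP; rewrite mulf_eq0 (negPf wn).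
Qed.

End TorusFrame.

Section RegularFunctions.
Variables (k : fieldType) (n : nat) (X : set 'M[k]_n) (Xu : forall g, X g -> g \in unitmx).
Implicit Types f : 'M[k]_n -> k.

Let det_neq0 g : X g -> \det g != 0.
Proof. by move=> /Xu; rewrite unitmxE unitfE. Qed.

Lemma eq_regular f f' : (forall g, X g -> f g = f' g) -> regular_on X f -> regular_on X f'.
Proof. by move=> ff' [p [m pE]]; exists p, m => g Xg; rewrite -ff'// pE. Qed.

Lemma regular_const c : regular_on X (fun=> c).
Proof. by exists c%:MP, 0%N => g _; rewrite mxevalC divr1. Qed.

Lemma regular_entry i j : regular_on X (fun g => g i j).
Proof. by exists (mxvar k i j), 0%N => g _; rewrite mxeval_var divr1. Qed.

Lemma regular_inv_entry i j : regular_on X (fun g => invmx g i j).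
Proof.
have [q [N qE]] := mxeval_invmx (mxvar k i j); exists q, N => g Xg.
by rewrite qE ?Xu// mxeval_var mulrAC mulfV ?mul1r// expf_neq0// det_neq0.
Qed.

Lemma regularD f f' : regular_on X f -> regular_on X f' -> regular_on X (fun g => f g + f' g).
Proof.
have [d dE] := polyfun_det (@polyfun_entry k n).
move=> [p [m pE]] [q [m' qE]]; exists (p * d ^+ m' + q * d ^+ m), (m + m')%N => g Xg.
rewrite pE// qE// mxevalD !mxevalM !mxevalX -dE exprD addf_div ?expf_neq0 ?det_neq0//.
Qed.

Lemma regularM f f' : regular_on X f -> regular_on X f' -> regular_on X (fun g => f g * f' g).
Proof.
move=> [p [m pE]] [q [m' qE]]; exists (p * q), (m + m')%N => g Xg.
by rewrite pE// qE// mxevalM exprD mulf_div.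
Qed.

Lemma regular_sum (I : Type) (r : seq I) (F : I -> 'M[k]_n -> k) :
  (forall i, regular_on X (F i)) -> regular_on X (fun g => \sum_(i <- r) F i g).
Proof.
move=> HF; elim: r => [|i r IH].
  by apply: eq_regular (regular_const 0) => g _; rewrite big_nil.
by apply: eq_regular (regularD (HF i) IH) => g _; rewrite big_cons.
Qed.

Lemma regular_prod (I : Type) (r : seq I) (F : I -> 'M[k]_n -> k) :
  (forall i, regular_on X (F i)) -> regular_on X (fun g => \prod_(i <- r) F i g).
Proof.
move=> HF; elim: r => [|i r IH].
  by apply: eq_regular (regular_const 1) => g _; rewrite big_nil.
by apply: eq_regular (regularM (HF i) IH) => g _; rewrite big_cons.
Qed.

Lemma regular_cond_prod (I : Type) (r : seq I) (Q : pred I) (F : I -> 'M[k]_n -> k) :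
  (forall i, regular_on X (F i)) -> regular_on X (fun g => \prod_(i <- r | Q i) F i g).
Proof.
move=> HF; apply: (@eq_regular (fun g => \prod_(i <- r) if Q i then F i g else 1)) => [g _|].
  by rewrite -big_mkcond.
by apply: regular_prod => i; case: (Q i) => //; exact: regular_const.
Qed.

Lemma regular_exprz f f' (m : int) : (forall g, X g -> f' g = (f g)^-1) ->
  regular_on X f -> regular_on X f' -> regular_on X (fun g => f g ^ m).
Proof.
move=> ff' Rf Rf'; have RX h j : regular_on X h -> regular_on X (fun g => h g ^+ j).
  move=> Rh; elim: j => [|j IH]; first by apply: eq_regular (regular_const 1).
  by apply: eq_regular (regularM Rh IH) => g _; rewrite exprS.
case: m => m; first exact: RX.
by apply: eq_regular (RX _ m.+1 Rf') => g Xg; rewrite ff'// NegzE -exprnN exprVn.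
Qed.

Lemma regular_mulmx m1 m2 m3 (A : 'M[k]_n -> 'M[k]_(m1, m2)) (B : 'M[k]_n -> 'M[k]_(m2, m3)) :
  (forall i j, regular_on X (fun g => A g i j)) -> (forall i j, regular_on X (fun g => B g i j)) ->
  forall i j, regular_on X (fun g => (A g *m B g) i j).
Proof.
move=> HA HB i j; apply: (@eq_regular (fun g => \sum_l A g i l * B g l j)) => [g _|].
  by rewrite mxE.
by apply: regular_sum => l; apply: regularM.
Qed.

End RegularFunctions.

Section IntegerPowerMaps.
Variables (k : fieldType).

(** The homomorphism of split tori with exponent matrix B. *)
Definition mact m n (B : 'M[int]_(m, n)) (u : 'I_n -> k) (i : 'I_m) : k := monz u (row i B).

Lemma mact_nonvanishing m n (B : 'M[int]_(m, n)) u : nonvanishing u -> nonvanishing (mact B u).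
Proof. by move=> un i; exact: monz_neq0. Qed.

Lemma prod_exprz (I : Type) (r : seq I) (F : I -> k) (m : int) :
  (\prod_(i <- r) F i) ^ m = \prod_(i <- r) F i ^ m.
Proof.
by apply: (big_morph (fun x : k => x ^ m)) => [x y|]; rewrite ?exp1rz// expfzMl.
Qed.

Lemma exprz_sum (I : Type) (r : seq I) (F : I -> int) (x : k) : x != 0 ->
  x ^ (\sum_(i <- r) F i) = \prod_(i <- r) x ^ F i.
Proof.
by move=> xn; apply: (big_morph (fun m : int => x ^ m)) => [a b|]; rewrite ?expr0z// expfzDr.
Qed.

Lemma mact_mulmx m n p (B : 'M[int]_(m, n)) (C : 'M[int]_(n, p)) u : nonvanishing u ->
  mact (B *m C) u = mact B (mact C u).
Proof.
move=> un; apply/funext => i; rewrite /mact /monz.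
under eq_bigr => l _ do rewrite !mxE exprz_sum//.
rewrite exchange_big; apply: eq_bigr => j _ /=; rewrite prod_exprz.
by apply: eq_bigr => l _; rewrite !mxE exprz_exp mulrC.
Qed.

Lemma mactM m n (B : 'M[int]_(m, n)) u v :
  mact B (fun i => u i * v i) = fun i => mact B u i * mact B v i.
Proof. by apply/funext => i; rewrite /mact monzM. Qed.

Lemma mactV m n (B : 'M[int]_(m, n)) u :
  mact B (fun i => (u i)^-1) = fun i => (mact B u i)^-1.
Proof.
apply/funext => i; rewrite /mact /monz -prodfV; apply: eq_bigr => j _.
by rewrite mxE exprz_inv invr_expz.
Qed.

Lemma mact1 n (u : 'I_n -> k) : mact 1%:M u = u.
Proof. by apply/funext => i; rewrite /mact -[RHS]monz_delta row1. Qed.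

Lemma mact_eq1 m n (B : 'M[int]_(m, n)) u i : row i B = 0 -> mact B u i = 1.
Proof. by rewrite /mact => ->; rewrite monz0. Qed.

End IntegerPowerMaps.

Section DiagonalConjugates.
Variables (k : fieldType) (n : nat) (P : 'M[k]_n) (Pu : P \in unitmx).
Implicit Types z w : 'I_n -> k.

Lemma diagconjE z : diagconj P z = invmx P *m diagz z *m P.
Proof. by []. Qed.

Lemma diagconjK z : P *m diagconj P z *m invmx P = diagz z.
Proof. by rewrite /diagconj !mulmxA mulmxV// mul1mx mulmxK. Qed.

Lemma conj_diagconj (g : 'M[k]_n) z : P *m g *m invmx P = diagz z -> g = diagconj P z.
Proof. by move=> gE; rewrite diagconjE -gE !mulmxA mulVmx// mul1mx mulmxKV. Qed.

Lemma diagconjM z w : diagconj P z *m diagconj P w = diagconj P (fun i => z i * w i).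
Proof.
apply: conj_diagconj; rewrite -diagzM -!diagconjK !mulmxA mulmxKV//.
Qed.

Lemma diagconj1 : diagconj P (fun=> 1) = 1%:M.
Proof.
symmetry; apply: conj_diagconj; rewrite mulmx1 mulmxV//.
by apply/matrixP => i j; rewrite diagzE mxE; case: eqP.
Qed.

Lemma diagconj_unit z : nonvanishing z -> diagconj P z \in unitmx.
Proof. by move=> zn; rewrite !unitmx_mul unitmx_inv Pu andbT; exact/diagz_unit. Qed.

Lemma diagconj_inj z w : diagconj P z = diagconj P w -> z = w.
Proof.
move=> E; apply/funext => i; have := diagconjK z; rewrite E diagconjK => /matrixP/(_ i i).
by rewrite !diagzE eqxx.
Qed.

Lemma diagconjV z : nonvanishing z -> invmx (diagconj P z) = diagconj P (fun i => (z i)^-1).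
Proof.
move=> zn; have H : diagconj P z *m diagconj P (fun i => (z i)^-1) = 1%:M.
  by rewrite diagconjM -diagconj1; congr diagconj; apply/funext => i; rewrite mulfV.
by rewrite -[LHS]mulmx1 -H mulKmx// diagconj_unit.
Qed.

End DiagonalConjugates.

Lemma exists_rootz (k : closedFieldType) (y : k) (m : int) : y != 0 -> m != 0 ->
  exists2 x : k, x != 0 & x ^ m = y.
Proof.
have root_nat (a : k) (j : nat) : a != 0 -> exists2 x : k, x != 0 & x ^+ j.+1 = a.
  move=> an; have [x xE] := @solve_monicpoly k j.+1 (fun i => if i == 0%N then a else 0) isT.
  have xa : x ^+ j.+1 = a.
    rewrite xE (bigD1 ord0) //= big1 => [|i i0]; first by rewrite expr0 mulr1 addr0.
    by rewrite -val_eqE /= in i0; rewrite (negPf i0) mul0r.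
  by exists x => //; apply: contraNneq an => x0; rewrite -xa x0 exprS mul0r.
move=> yn; case: m => m mn; first by case: m mn => // m _; exact: root_nat.
have [|x xn xE] := root_nat y^-1 m; first by rewrite invr_eq0.
by exists x => //; rewrite NegzE -exprnN xE invrK.
Qed.

Definition pos_part (m : int) : nat := absz (Num.max m 0).
Definition neg_part (m : int) : nat := absz (Num.max (- m) 0).

Lemma pos_neg_part (m : int) : (pos_part m)%:Z - (neg_part m)%:Z = m.
Proof.
rewrite /pos_part /neg_part; have [h|/ltW h] := leP 0 m.
  by rewrite (max_r (_ : - m <= 0)) ?oppr_le0// absz0 subr0; lia.
by rewrite (max_l (_ : 0 <= - m)) ?oppr_ge0// absz0; lia.
Qed.

(** Clearing the negative exponents turns a monomial relation into a polynomial one, as required for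
    Zariski closures. *)
Lemma monz_eq1 (k : fieldType) n (x : 'I_n -> k) (m : 'rV[int]_n) : nonvanishing x ->
  monz x m = 1 <-> \prod_i x i ^+ pos_part (m 0 i) = \prod_i x i ^+ neg_part (m 0 i).
Proof.
move=> xn.
have -> : monz x m = (\prod_i x i ^+ pos_part (m 0 i)) / (\prod_i x i ^+ neg_part (m 0 i)).
  rewrite -prodf_div; apply: eq_bigr => i _.
  by rewrite !exprnP invr_expz -expfzDr// pos_neg_part.
have bn : \prod_i x i ^+ neg_part (m 0 i) != 0 by apply/prodf_neq0 => i _; rewrite expf_neq0.
split=> [/(congr1 ( *%R^~ (\prod_i x i ^+ neg_part (m 0 i))))|->]; last by rewrite mulfV.
by rewrite mul1r mulfVK.
Qed.

Section ExponentTorus.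
Variables (k : closedFieldType) (n q : nat) (P : 'M[k]_n) (Pu : P \in unitmx).
Variable N : 'M[int]_(n, q).

Definition exponent_torus : set 'M[k]_n := [set diagconj P (mact N u) | u in @nonvanishing k q].

(** Through the Smith form N = L D R the image of a homomorphism of tori becomes explicit: R only
    reparametrizes, L is an automorphism of the diagonal group, and the powers prescribed by D are
    surjective on the coordinates of its non-zero rows, k being algebraically closed. The other
    coordinates equal 1, which also gives the equations of the image. *)
Lemma exponent_torus_torus : torus exponent_torus.
Proof.
have [L Lu [R Ru [d _ NE]]] := int_Smith_normal_form N.
set D := \matrix_(i, j) _ in NE.
pose L' := invmx L; have L'L : L' *m L = 1%:M by exact: mulVmx.
have LL' : L *m L' = 1%:M by exact: mulmxV.
have NDR : L' *m N = D *m R by rewrite NE !mulmxA L'L mul1mx.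
have TU g : exponent_torus g -> g \in unitmx.
  by move=> [u un <-]; apply: diagconj_unit => //; exact: mact_nonvanishing.
have TM g h : exponent_torus g -> exponent_torus h -> exponent_torus (g *m h).
  move=> [u un <-] [v vn <-]; exists (fun i => u i * v i); first by move=> i; rewrite mulf_neq0.
  by rewrite diagconjM// mactM.
have TV g : exponent_torus g -> exponent_torus (invmx g).
  move=> [u un <-]; exists (fun i => (u i)^-1); first by move=> i; rewrite invr_eq0.
  by rewrite diagconjV ?mactV//; exact: mact_nonvanishing.
have T1 : exponent_torus 1%:M.
  exists (fun=> 1) => [i|]; first exact: oner_neq0.
  rewrite -(diagconj1 Pu); congr diagconj; apply/funext => i.
  by apply: big1 => j _; rewrite exp1rz.
(* the torus consists of the diagconj P (mact L y) with y = 1 outside the nonzero rows of D *)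
have rootD y : nonvanishing y -> (forall i, row i D = 0 -> y i = 1) ->
    exponent_torus (diagconj P (mact L y)).
  move=> yn y1.
  have /choice[v Hv] : forall j : 'I_q, exists x : k, x != 0 /\
      forall i : 'I_n, i = j :> nat -> x ^ D i j = y i.
    move=> j; case: (ltnP j n) => [jn|nj]; last first.
      exists 1; split=> [|i ij]; first exact: oner_neq0.
      by have := ltn_ord i; rewrite ij ltnNge nj.
    pose i := Ordinal jn; have [D0|Dn0] := eqVneq (D i j) 0.
      exists 1; split=> [|i' ij]; first exact: oner_neq0.
      have -> : i' = i by apply: val_inj.
      rewrite exp1rz y1//; apply/rowP => j'; rewrite !mxE; case: eqP => // ij'.
      by move: D0; rewrite mxE eqxx.
    have [x xn xE] := exists_rootz (yn i) Dn0; exists x; split=> // i' ij.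
    by have -> : i' = i by apply: val_inj.
  have vn : nonvanishing v by move=> j; case: (Hv j).
  have Dv : mact D v = y.
    apply/funext => i; have [iq|qi] := ltnP i q; last first.
      have r0 : row i D = 0.
        by apply/rowP => j; rewrite !mxE; case: eqP => // ij; have := ltn_ord j; rewrite -ij ltnNge qi.
      by rewrite mact_eq1// y1.
    rewrite /mact /monz (bigD1 (Ordinal iq)) //= big1 ?mulr1 => [|j ji].
      by rewrite mxE; case: (Hv (Ordinal iq)) => _; apply.
    rewrite !mxE; case: eqP => // ij; case/negP: ji; apply/eqP; exact: val_inj.
  exists (mact (invmx R) v); first exact: mact_nonvanishing.
  have un : nonvanishing (mact (invmx R) v) by exact: mact_nonvanishing.
  rewrite NE mact_mulmx// mact_mulmx; last exact: mact_nonvanishing.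
  by rewrite -(mact_mulmx R)// mulmxV// mact1 Dv.
pose w (g : 'M[k]_n) i := (P *m g *m invmx P) i i.
have wE z : w (diagconj P z) = z.
  by apply/funext => i; rewrite /w diagconjK// diagzE eqxx.
have wn g : exponent_torus g -> nonvanishing (w g).
  by move=> [u un <-]; rewrite wE; exact: mact_nonvanishing.
have Tw g : exponent_torus g -> g = diagconj P (w g) by move=> [u un <-]; rewrite wE.
have w1 g i : exponent_torus g -> row i D = 0 -> mact L' (w g) i = 1.
  move=> [u un <-] Di; rewrite wE -mact_mulmx// NDR mact_eq1//.
  by rewrite row_mul Di mul0mx.
have polw i j : polyfun (fun g : 'M[k]_n => (P *m g *m invmx P) i j).
  apply: polyfun_mulmx => [a b|a b]; last exact: polyfun_const.
  by apply: polyfun_mulmx => c d'; [exact: polyfun_const|exact: polyfun_entry].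
have TG : algebraic_group exponent_torus.
  split=> //; exists (vanishing exponent_torus); apply/seteqP; split=> [g Tg|g [gu Hg]].
    by split=> [|p]; [exact: TU|apply].
  have gd i j : i != j -> (P *m g *m invmx P) i j = 0.
    move=> ij; have [p pE] := polw i j; rewrite pE; apply: Hg => h Th.
    by rewrite -pE (Tw h)// diagconjK// diagzE (negPf ij).
  have gE : P *m g *m invmx P = diagz (w g).
    by apply/matrixP => i j; rewrite diagzE; case: eqP => [->|/eqP/gd].
  have gn : nonvanishing (w g).
    by apply/diagz_unit; rewrite -gE !unitmx_mul unitmx_inv Pu gu.
  rewrite (conj_diagconj Pu gE) -(mact1 (w g)) -LL' mact_mulmx//; apply: rootD.
    exact: mact_nonvanishing.
  move=> i Di.
  have [p pE] : polyfun (fun g => \prod_j w g j ^+ pos_part (row i L' 0 j) -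
       \prod_j w g j ^+ neg_part (row i L' 0 j)).
    by apply: polyfunD; [|apply: polyfunN]; apply: polyfun_prod => j; apply: polyfunX; exact: polw.
  have mE g' : nonvanishing (w g') -> (mact L' (w g') i = 1 <-> mxeval p g' = 0).
    move=> gn'; rewrite -pE; apply: (iff_trans (monz_eq1 _ gn')).
    by split=> [->|/subr0_eq]; rewrite ?subrr.
  apply/mE => //; apply: Hg => h Th; apply/mE; first exact: wn.
  exact: w1.
(* The coordinates in B, those of the non-zero rows of D, parametrize the torus; [ext] completes
   them by 1. *)
split=> //; pose B := [pred i | row i D != 0]; pose iota l : 'I_n := enum_val (A := B) l.
have iotaB l : row (iota l) D != 0 by exact: (enum_valP l).
pose ext (h : 'M[k]_#|B|) i := \prod_(l | iota l == i) h l l.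
have ext_iota h l : ext h (iota l) = h l l.
  by rewrite /ext (big_pred1 l) // => j; rewrite /= (inj_eq enum_val_inj).
have ext_out h i : row i D = 0 -> ext h i = 1.
  by move=> Di; apply: big1 => l /eqP li; have := iotaB l; rewrite li Di eqxx.
have extn h : @diagonal_group k _ h -> nonvanishing (ext h).
  move=> /diagonal_groupP[z zn ->] i; apply/prodf_neq0 => l _.
  by rewrite diagzE eqxx.
have ext_psi h : diagonal_group h -> exponent_torus (diagconj P (mact L (ext h))).
  by move=> Dh; apply: rootD; [exact: extn|exact: ext_out].
have wM g h : exponent_torus g -> exponent_torus h -> w (g *m h) = fun i => w g i * w h i.
  by move=> [u un <-] [v vn <-]; rewrite diagconjM// !wE.
have wV g : exponent_torus g -> w (invmx g) = fun i => (w g i)^-1.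
  by move=> [u un <-]; rewrite diagconjV ?wE//; exact: mact_nonvanishing.
exists #|B|, (fun g => diagz (fun l => mact L' (w g) (iota l))), (fun h => diagconj P (mact L (ext h))).
split.
- split=> [g Tg|g h Tg Th|a b].
  + apply: diagonal_group_diagz => l; apply: mact_nonvanishing; exact: wn.
  + by rewrite diagzM wM// mactM.
  + apply: (@eq_regular _ _ _ (fun g => (a == b)%:R * mact L' (w g) (iota a))) => [g _|].
      by rewrite diagzE; case: eqP; rewrite ?mul1r ?mul0r.
    apply: regularM; first exact: regular_const.
    apply: regular_prod => j; apply: (regular_exprz (f' := fun g => w (invmx g) j)) => [g Tg||].
    * by rewrite wV.
    * apply: regular_mulmx => // [c e|c e]; last exact: regular_const.
      by apply: regular_mulmx => // [c' e'|c' e']; [exact: regular_const|exact: regular_entry].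
    * apply: regular_mulmx => // [c e|c e]; last exact: regular_const.
      by apply: regular_mulmx => // [c' e'|c' e']; [exact: regular_const|exact: regular_inv_entry].
- split=> [h Dh|g h Dg Dh|a b]; first exact: ext_psi.
  + rewrite diagconjM// -mactM; congr (diagconj _ (mact _ _)); apply/funext => i.
    have [z zn ->] := diagonal_groupP Dg; have [z' zn' ->] := diagonal_groupP Dh.
    rewrite diagzM /ext -big_split; apply: eq_bigr => l _ /=.
    by rewrite !diagzE !eqxx.
  + have Du h : @diagonal_group k #|B| h -> h \in unitmx by case.
    have Rdiag i j : regular_on (@diagonal_group k #|B|) (fun h => diagz (mact L (ext h)) i j).
      apply: (@eq_regular _ _ _ (fun h => (i == j)%:R * mact L (ext h) i)) => [h _|].
        by rewrite diagzE; case: eqP; rewrite ?mul1r ?mul0r.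
      apply: regularM; first exact: regular_const.
      apply: regular_prod => l; apply: (regular_exprz (f' := fun h => ext (invmx h) l)) => // [h Dh||].
      * have [z zn ->] := diagonal_groupP Dh; rewrite /ext -prodfV; apply: eq_bigr => o _.
        have -> : invmx (diagz z) = diagz (fun i => (z i)^-1).
          have H : diagz z *m diagz (fun i => (z i)^-1) = 1%:M.
            rewrite diagzM; apply/matrixP => c e; rewrite diagzE mxE mulfV//.
            by case: eqP.
          by rewrite -[LHS]mulmx1 -H mulKmx//; apply/diagz_unit.
        by rewrite !diagzE eqxx.
      * by apply: regular_cond_prod => o; exact: regular_entry.
      * by apply: regular_cond_prod => o; exact: regular_inv_entry.
    apply: regular_mulmx => // [c e|c e]; last exact: regular_const.
    by apply: regular_mulmx => // c' e'; exact: regular_const.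
- move=> g Tg; rewrite [RHS]Tw// -[in RHS](mact1 (w g)) -LL' mact_mulmx; last exact: wn.
  congr (diagconj _ (mact _ _)); apply/funext => i.
  have [Di|Di] := eqVneq (row i D) 0; first by rewrite w1// ext_out.
  have [l ->] : exists l, i = iota l by exists (enum_rank_in (A := B) Di i); rewrite /iota enum_rankK_in.
  by rewrite ext_iota diagzE eqxx.
- move=> h Dh; rewrite wE -mact_mulmx; last exact: extn.
  rewrite L'L mact1; have [z zn ->] := diagonal_groupP Dh; congr diag_mx.
  by apply/rowP => l; rewrite !mxE ext_iota diagzE eqxx.
Qed.

End ExponentTorus.

(** * The trace form and the Lie algebra of a maximal torus *)

Lemma mxtrace_nilpotent (k : closedFieldType) n (X : 'M[k]_n) : nilpotent_mx X -> \tr X = 0.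
Proof.
case: n X => [|n] X [M XM]; first by rewrite [X]thinmx0 linear0.
have [rts cX] := closed_field_poly_normal (char_poly X).
rewrite (monicP (char_poly_monic X)) scale1r in cX.
have r0 a : a \in rts -> a = 0.
  move=> ar; have : root (char_poly X) a by rewrite cX root_prod_XsubC.
  rewrite -eigenvalue_root_char => /eigenvalueP[v vX vn0].
  have vXi i : v *m X ^+ i = a ^+ i *: v.
    elim: i => [|i IH]; first by rewrite !expr0 mulmx1 scale1r.
    by rewrite !exprSr -[X ^+ i * X]/(X ^+ i *m X) mulmxA IH -scalemxAl vX scalerA.
  have := vXi M; rewrite XM mulmx0 => /esym/eqP.
  by rewrite scaler_eq0 (negPf vn0) orbF expf_eq0 => /andP[_ /eqP].
have cE : char_poly X = 'X^(size rts).
  rewrite cX big_seq (eq_bigr (fun=> 'X)) => [|a /r0 ->]; last by rewrite polyC0 subr0.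
  by rewrite -big_seq big_const_seq count_predT -Monoid.iteropE.
have := char_poly_trace X (ltn0Sn n); rewrite cE coefXn.
have := size_char_poly X; rewrite cE size_polyXn => -[->].
by rewrite /= ltn_eqF// => /esym/eqP; rewrite oppr_eq0 => /eqP.
Qed.

Lemma nilpotentM_comm (k : fieldType) n (X Y : 'M[k]_n) :
  comm_mx X Y -> nilpotent_mx X -> nilpotent_mx (X *m Y).
Proof.
move=> XY [M XM]; exists M.
suff -> : (X *m Y) ^+ M = X ^+ M *m Y ^+ M by rewrite XM mul0mx.
exact: (exprMn_comm M XY).
Qed.

Lemma nilpotent0 (k : fieldType) n : nilpotent_mx (0 : 'M[k]_n).
Proof. by exists 1%N; rewrite expr1. Qed.

Lemma diagonalizable_diagconj (k : fieldType) n (S : 'M[k]_n) : diagonalizable S ->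
  exists (P : 'M[k]_n) l, P \in unitmx /\ S = diagconj P l.
Proof.
move=> [P Pu /diagonalizable_forPex[d /simmxP]] /(_ Pu) PS.
exists P, (fun i => d 0 i); split=> //.
rewrite /diagconj (_ : \row_i d 0 i = d); last by apply/rowP => i; rewrite mxE.
by rewrite -mulmxA -PS mulKmx.
Qed.

Lemma sum_by_value_gen (k : fieldType) (I J : eqType) (s : seq I) (f : I -> J) (c g : I -> k) :
  (forall i j, f i = f j -> g i = g j) ->
  (forall y, \sum_(i <- s | f i == y) c i = 0) -> \sum_(i <- s) g i * c i = 0.
Proof.
move=> fg H.
have /choice[th Hth] : forall y, exists a, forall i, f i = y -> g i = a.
  move=> y; have [[i <-]|no] := pselect (exists i, f i = y).
    by exists (g i) => j; exact: fg.
  by exists 0 => i fi; case: no; exists i.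
rewrite -[RHS](sum_by_value th H); apply: eq_bigr => i _; congr (_ * _).
exact: Hth.
Qed.

Section RationalFunctional.
Variables (k : fieldType) (k0 : [pchar k] =i pred0) (n : nat) (l : 'I_n -> k).

(** The rational span of the integer relations between the l_i. *)
Let K (v : 'rV[rat]_n) := exists (c : int) (d : 'rV[int]_n),
  [/\ c != 0, c%:~R *: v = map_mx intr d & pairz l d = 0].

Lemma pairzZ c d : pairz l (c *: d) = c%:~R * pairz l d.
Proof. by rewrite mulr_sumr; apply: eq_bigr => i _; rewrite mxE rmorphM /=; ring. Qed.

Let K_0 : K 0.
Proof.
exists 1, 0; split=> //; first by rewrite scaler0 map_mx0.
by apply: big1 => i _; rewrite mxE mulr0.
Qed.

Let K_D u v : K u -> K v -> K (u + v).
Proof.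
move=> [c [d [cn cd ld]]] [c' [d' [cn' cd' ld']]].
exists (c * c'), (c' *: d + c *: d'); split; first by rewrite mulf_neq0.
  rewrite map_mxD !map_mxZ -cd -cd' scalerDr !scalerA rmorphM /=.
  by rewrite [c'%:~R * _]mulrC.
by rewrite pairzD !pairzZ ld ld' !mulr0 addr0.
Qed.

Let K_Z (q : rat) v : K v -> K (q *: v).
Proof.
move=> [c [d [cn cd ld]]]; exists (denq q * c), (numq q *: d); split.
- by rewrite mulf_neq0// denq_neq0.
- rewrite map_mxZ -cd !scalerA; congr (_ *: _).
  by rewrite rmorphM /= -{2}[q]divq_num_den; field; rewrite intr_eq0 denq_neq0.
- by rewrite pairzZ ld mulr0.
Qed.

Let K_mul (u : 'rV[rat]_n) m (B : 'M[rat]_(m, n)) (v : 'rV[rat]_m) :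
  (forall i, K (row i B)) -> K (v *m B).
Proof.
move=> KB; rewrite mulmx_sum_row; apply: (big_ind K) => // i _; exact/K_Z/KB.
Qed.

(** In characteristic zero no non-zero multiple of m0 is a relation, so m0 lies outside K. A linear
    form that is zero on K but not at m0, cleared of denominators, is the functional. *)
Lemma exists_integer_functional (m0 : 'rV[int]_n) : pairz l m0 != 0 ->
  exists nu : 'cV[int]_n, (forall d, pairz l d = 0 -> (d *m nu) 0 0 = 0) /\ (m0 *m nu) 0 0 != 0.
Proof.
(* K is only a predicate: a matrix of the largest possible rank with rows in K turns it into a row
   space, and a column of the cokernel of that matrix is the wanted form. *)
move=> lm0; pose Q (j : nat) := `[< exists B : 'M[rat]_n, (forall i, K (row i B)) /\ \rank B = j >].
have Q0 : exists j, Q j.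
  exists 0%N; apply/asboolP; exists 0; split; last exact: mxrank0.
  by move=> i; rewrite row0.
have Qn j : Q j -> (j <= n)%N by move=> /asboolP[B [_ <-]]; exact: rank_leq_row.
have [j /asboolP[B [KB rB]] jmax] := ex_maxnP Q0 Qn.
have subB v : K v -> (v <= B)%MS.
  move=> Kv; have BS : (B <= B + v)%MS by exact: addsmxSl.
  have rS : (\rank (B + v)%MS <= \rank B)%N.
    rewrite rB; apply: jmax; apply/asboolP; exists (B + v)%MS; split=> // i.
    have /sub_addsmxP[[a b] ->] : (row i (B + v)%MS <= B + v)%MS by exact: row_sub.
    apply: K_D; first exact: K_mul.
    by apply: K_mul => // i'; rewrite row_id.
  have : (B + v <= B)%MS by rewrite -(geq_leqif (mxrank_leqif_sup BS)).
  by apply: submx_trans; exact: addsmxSr.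
have nm0 : ~~ ((map_mx intr m0 : 'rV[rat]_n) <= B)%MS.
  apply/negP => /submxP[v vE].
  have [c [d [cn cd ld]]] : K (map_mx intr m0) by rewrite vE; exact: K_mul.
  have cd' : d = c *: m0.
    apply/rowP => i; have /rowP/(_ i) := cd; rewrite !mxE -rmorphM /= => /intr_inj ->.
    by [].
  by move: ld; rewrite cd' pairzZ => /eqP; rewrite mulf_eq0 (negPf lm0) orbF (intf_eq0 k0) (negPf cn).
have : map_mx intr m0 *m cokermx B != 0 by rewrite -submxE.
move=> /rV0Pn[j' Hj'].
pose q : 'cV[rat]_n := col j' (cokermx B).
pose N : int := \prod_i denq (q i 0).
have Nn0 : N != 0 by apply/prodf_neq0 => i _; exact: denq_neq0.
have /choice[nu nuE] : forall i, exists a : int, a%:~R = N%:~R * q i 0.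
  move=> i; exists ((\prod_(i' | i' != i) denq (q i' 0)) * numq (q i 0)).
  rewrite /N [in RHS](bigD1 i) //= !intrM -{3}[q i 0]divq_num_den.
  by field; rewrite intr_eq0 denq_neq0.
have nuP (d : 'rV[int]_n) : ((d *m \col_i nu i) 0 0)%:~R = N%:~R * (map_mx intr d *m cokermx B) 0 j'.
  rewrite !mxE rmorph_sum mulr_sumr; apply: eq_bigr => i _.
  by rewrite !mxE rmorphM /= nuE /q !mxE; ring.
exists (\col_i nu i); split=> [d ld|].
  have Kd : K (map_mx intr d) by exists 1, d; split=> //; rewrite scale1r.
  have /eqP dB : map_mx intr d *m cokermx B == 0 by rewrite -submxE subB.
  by apply/eqP; rewrite -(intr_eq0 rat) nuP dB mxE mulr0.
by rewrite -(intr_eq0 rat) nuP mulf_neq0// intr_eq0.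
Qed.

End RationalFunctional.

Section SymmetricWords.
Variables (A : eqType) (B : Type) (phi : seq A -> B) (L : pred A) (m : nat).
Hypothesis swap : forall p x y q, all L (p ++ x :: y :: q) -> size (p ++ x :: y :: q) = m ->
  phi (p ++ x :: y :: q) = phi (p ++ y :: x :: q).

(** The length is fixed at m because exchanging two letters costs a bracket, that is, a word of
    length m - 1, which the applications eliminate by induction. *)
Lemma swap_move p x s q : all L (p ++ x :: s ++ q) -> size (p ++ x :: s ++ q) = m ->
  phi (p ++ x :: s ++ q) = phi (p ++ s ++ x :: q).
Proof.
elim: s p => [|y s IH] p //= Ls sz; rewrite swap//.
rewrite -(cat_rcons y p (x :: s ++ q)) IH ?cat_rcons//.
  by move: Ls; rewrite !all_cat /=; case: (all L p) => //=; case: (L x); case: (L y).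
by move: sz; rewrite !size_cat /=.
Qed.

Lemma swap_perm p s t : perm_eq s t -> all L (p ++ s) -> size (p ++ s) = m ->
  phi (p ++ s) = phi (p ++ t).
Proof.
elim: s t p => [|x s IH] t p; first by rewrite perm_sym => /perm_nilP ->.
move=> xst; have xt : x \in t by rewrite -(perm_mem xst) mem_head.
case/splitPr: xt xst => t1 t2; rewrite perm_sym -[x :: t2]cat1s perm_catCA /= perm_cons perm_sym => st Ls sz.
rewrite -cat_rcons (IH _ _ st) ?cat_rcons// swap_move//; last first.
  by move: sz; rewrite !size_cat /= (perm_size st) size_cat.
by move: Ls; rewrite !all_cat /= (perm_all _ st) all_cat.
Qed.

End SymmetricWords.

(** * Traces on a Lie algebra of nilpotent matrices *)

Section NilpotentLieAlgebra.
Variables (k : closedFieldType) (k0 : [pchar k] =i pred0) (n : nat) (L : set 'M[k]_n).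
Hypothesis L_lin : forall c X Y, L X -> L Y -> L (c *: X + Y).
Hypothesis L_lie : forall X Y, L X -> L Y -> L (X *m Y - Y *m X).
Hypothesis L_nil : forall X, L X -> nilpotent_mx X.

Definition mxword (s : seq 'M[k]_n) : 'M[k]_n := foldr mulmx 1%:M s.

Lemma mxword_cat s t : mxword (s ++ t) = mxword s *m mxword t.
Proof. by elim: s => [|X s IH] /=; rewrite ?mul1mx// IH mulmxA. Qed.

Lemma mxword_nseq m X : mxword (nseq m X) = X ^+ m.
Proof. by elim: m => [|m IH] //=; rewrite IH exprS. Qed.

Let inL : pred 'M[k]_n := fun X => `[< L X >].

Let all_nseqL m X : L X -> all inL (nseq m X).
Proof. by move=> LX; rewrite all_nseq; apply/orP; right; exact/asboolP. Qed.

(* Words of length m in L have trace 0 as soon as shorter ones do: the trace is then symmetric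
   in the letters, and it vanishes on the powers of a letter. *)
Lemma polarization m p ys X : (0 < m)%N ->
  (forall s, (0 < size s < m)%N -> all inL s -> \tr (mxword s) = 0) ->
  (p + size ys = m)%N -> all inL ys -> L X -> \tr (mxword (nseq p X ++ ys)) = 0.
Proof.
move=> m0 IHm; pose phi s := \tr (mxword s).
have swap q x y s : all inL (q ++ x :: y :: s) -> size (q ++ x :: y :: s) = m ->
    phi (q ++ x :: y :: s) = phi (q ++ y :: x :: s).
  rewrite all_cat /= => /and4P[Lq /asboolP Lx /asboolP Ly Ls]; rewrite size_cat /= => sz.
  apply/eqP; rewrite -subr_eq0; apply/eqP; rewrite /phi -raddfB /=.
  have <- : \tr (mxword (q ++ (x *m y - y *m x) :: s)) = 0.
    apply: IHm; first by rewrite size_cat /=; lia.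
    by rewrite all_cat /= Lq Ls andbT; apply/asboolP; exact: L_lie.
  by rewrite !mxword_cat /= mulmxBl mulmxBr !mulmxA.
elim: ys p X => [|Z ys IH] p X; rewrite ?cats0 /=.
  rewrite addn0 => -> _ LX; rewrite mxword_nseq; apply: mxtrace_nilpotent.
  have [M XM] := L_nil LX; exists M.
  by rewrite -exprM mulnC exprM XM expr0n; case: (m) m0.
move=> sz /andP[/asboolP LZ Lys] LX.
have LXZ a : L (a *: Z + X) by exact: L_lin.
(* P is the trace of (aZ + X)^q followed by zs, as a polynomial in a; by symmetry in the letters,
   its derivative at 0 is q times the trace with one X replaced by Z. Since P vanishes identically
   by induction, so does that trace. *)
have key q zs : (q + size zs = m)%N -> all inL zs -> exists P : {poly k},
    (forall a, P.[a] = phi (nseq q (a *: Z + X) ++ zs)) /\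
    (deriv P).[0] = q%:R * phi (nseq q.-1 X ++ Z :: zs).
  elim: q zs => [|q IHq] zs szz Lzs.
    exists (phi zs)%:P; split=> [a|]; first by rewrite hornerC.
    by rewrite derivC horner0 mul0r.
  have [||P [PE dP]] := IHq (X :: zs); [by rewrite /=; lia|by rewrite /= Lzs andbT; apply/asboolP|].
  have [||Q [QE dQ]] := IHq (Z :: zs); [by rewrite /=; lia|by rewrite /= Lzs andbT; apply/asboolP|].
  exists (P + 'X * Q); split=> [a|].
    rewrite hornerD hornerM hornerX PE QE /=.
    have -> : phi ((a *: Z + X) :: nseq q (a *: Z + X) ++ zs) =
        phi (nseq q (a *: Z + X) ++ (a *: Z + X) :: zs).
      apply: (swap_move swap (p := [::]) (s := nseq q _)) => /=.
        by rewrite all_cat all_nseqL// Lzs !andbT; apply/asboolP.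
      by rewrite size_cat size_nseq.
    rewrite /phi !mxword_cat /= mulmxDl mulmxDr -scalemxAl -scalemxAr linearD linearZ /=.
    by rewrite addrC.
  rewrite derivD derivM derivX hornerD hornerD !hornerM hornerX hornerC mul0r mul1r addr0 dP QE.
  rewrite scale0r add0r; case: q {IHq P PE dP Q QE dQ} szz => [|q] szz /=.
    by rewrite mul0r add0r mul1r.
  have -> : phi (nseq q X ++ Z :: X :: zs) = phi (X :: nseq q X ++ Z :: zs).
    have Lw : all inL (nseq q X ++ [:: Z, X & zs]).
      by rewrite all_cat all_nseqL//= Lzs !andbT; apply/andP; split; apply/asboolP.
    have szw : size (nseq q X ++ [:: Z, X & zs]) = m by rewrite size_cat size_nseq /=; lia.
    rewrite swap//; symmetry; apply: (swap_move swap (p := [::]) (s := nseq q X)) => /=.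
      by rewrite all_cat all_nseqL//= Lzs !andbT; apply/andP; split; apply/asboolP.
    by rewrite size_cat size_nseq /=; lia.
  by rewrite -[q.+2]addn1 natrD mulrDl mul1r.
have [|P [PE dP]] := key p.+1 ys _ Lys; first by lia.
have P0 : P = 0.
  apply: (poly_vanish_eq0 k0) => a _; rewrite PE; apply: IH => //; first by lia.
move: dP; rewrite P0 linear0 horner0 => /esym/eqP; rewrite mulf_eq0 (natf_eq0 k0) => /eqP.
exact.
Qed.

(** Plays the role of Engel's theorem: only the traces are needed, and polarization yields them
    without a common flag. *)
Lemma trace_word s : s != [::] -> all inL s -> \tr (mxword s) = 0.
Proof.
have [m] := ubnP (size s); elim: m s => // m IH s sm s0 Ls.
case: s sm s0 Ls => [//|X s] sm _ Ls.
have := @polarization (size s).+1 0 (X :: s) X isT _ _ Ls; apply => //.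
  move=> t /andP[t0 ts] Lt; apply: IH => //; last by case: (t) t0.
  by move: sm ts; rewrite /=; lia.
by move: Ls => /= /andP[/asboolP].
Qed.

(** The associative algebra without unit generated by L. *)
Inductive wordspan : 'M[k]_n -> Prop :=
| wordspan_word s : s != [::] -> all inL s -> wordspan (mxword s)
| wordspan_lin c A B : wordspan A -> wordspan B -> wordspan (c *: A + B).

Lemma wordspan_trace A : wordspan A -> \tr A = 0.
Proof.
elim=> [s|c B C _ tB _ tC]; first exact: trace_word.
by rewrite linearD linearZ /= tB tC mulr0 addr0.
Qed.

Lemma wordspan0 : L !=set0 -> wordspan 0.
Proof.
move=> [X LX]; have W : wordspan X.
  by rewrite -[X]mulmx1; apply: (@wordspan_word [:: X]) => //=; rewrite andbT; apply/asboolP.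
by rewrite -(addNr X) -scaleN1r; exact: wordspan_lin.
Qed.

Lemma wordspanD A B : wordspan A -> wordspan B -> wordspan (A + B).
Proof. by move=> WA WB; rewrite -[A]scale1r; exact: wordspan_lin. Qed.

Lemma wordspanZ c A : L !=set0 -> wordspan A -> wordspan (c *: A).
Proof. by move=> L0 WA; rewrite -[_ *: _]addr0; apply: wordspan_lin => //; exact: wordspan0. Qed.

Lemma wordspanM A B : wordspan A -> wordspan B -> wordspan (A *m B).
Proof.
move=> WA WB; elim: WA => [s s0 Ls|c C D _ WC _ WD].
  elim: WB => [t t0 Lt|c C D _ WC _ WD].
    by rewrite -mxword_cat; apply: wordspan_word; [case: (s) s0|rewrite all_cat Ls].
  by rewrite mulmxDr -scalemxAr; exact: wordspan_lin.
by rewrite mulmxDl -scalemxAl; exact: wordspan_lin.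
Qed.

Lemma wordspan_mxexp X M : L X -> X ^+ M = 0 -> wordspan (mxexp M X - 1%:M).
Proof.
move=> LX; have L0 : L !=set0 by exists X.
case: M => [|M] XM.
  by rewrite (mxexp_expr0 XM (_ - _) 0); exact: wordspan0.
rewrite /mxexp big_ord_recl /= fact0 invr1 scale1r expr0 -[1%:M]/1 addrAC subrr add0r.
apply: (big_ind wordspan) => [||i _]; [exact: wordspan0|exact: wordspanD|].
apply: wordspanZ => //; rewrite -mxword_nseq; apply: wordspan_word; first by [].
exact: all_nseqL.
Qed.

(** An exponential is 1 plus an element of [wordspan]; such matrices are closed under products, and
    [wordspan] has trace zero. *)
Lemma expgen_trace g : L !=set0 -> expgen L g -> \tr g = n%:R.
Proof.
move=> L0 Eg; suff W : wordspan (g - 1%:M).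
  by have := wordspan_trace W; rewrite raddfB /= mxtrace1 => /eqP; rewrite subr_eq0 => /eqP.
elim: Eg => [|h X M _ IH LX XM]; first by rewrite subrr; exact: wordspan0.
have E := wordspan_mxexp LX XM.
have -> : h *m mxexp M X - 1%:M = (h - 1%:M) *m (mxexp M X - 1%:M) + (h - 1%:M) + (mxexp M X - 1%:M).
  by rewrite mulmxBr mulmx1 subrK mulmxBl mul1mx addrA subrK.
by apply: wordspanD => //; apply: wordspanD => //; exact: wordspanM.
Qed.

End NilpotentLieAlgebra.

Section DiagonalMisc.
Variables (k : fieldType) (n : nat) (P : 'M[k]_n) (Pu : P \in unitmx).

Lemma diagconj_lin c (u v : 'I_n -> k) :
  c *: diagconj P u + diagconj P v = diagconj P (fun i => c * u i + v i).
Proof.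
apply: (conj_diagconj Pu); rewrite mulmxDr mulmxDl -scalemxAr -scalemxAl !diagconjK//.
by apply/matrixP => i j; rewrite !mxE !mulrb; case: eqP; rewrite ?mulr0 ?addr0.
Qed.

Lemma diagconj0 : diagconj P (fun=> 0) = 0.
Proof.
symmetry; apply: (conj_diagconj Pu); rewrite mulmx0 mul0mx.
by apply/matrixP => i j; rewrite diagzE mxE if_same.
Qed.

Lemma diagconj_sum (I : Type) (s : seq I) (c : I -> k) (u : I -> 'I_n -> k) :
  \sum_(e <- s) c e *: diagconj P (u e) = diagconj P (fun i => \sum_(e <- s) c e * u e i).
Proof.
elim: s => [|e s IH].
  by rewrite big_nil -diagconj0; congr diagconj; apply/funext => i; rewrite big_nil.
rewrite big_cons IH diagconj_lin; congr diagconj; apply/funext => i.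
by rewrite big_cons.
Qed.

Lemma mxtrace_diagconj l : \tr (diagconj P l) = \sum_i l i.
Proof.
rewrite /diagconj mxtrace_mulC mulmxA mulmxV// mul1mx mxtrace_diag.
by apply: eq_bigr => i _; rewrite mxE.
Qed.

Lemma comm_mx_diagconj X l : comm_mx X (diagconj P l) <->
  forall i j, l i != l j -> (P *m X *m invmx P) i j = 0.
Proof.
have E (D : 'M[k]_n) : comm_mx X D <-> (P *m X *m invmx P) *m (P *m D *m invmx P) =
    (P *m D *m invmx P) *m (P *m X *m invmx P).
  rewrite /comm_mx; split=> [XD|].
    by rewrite !mulmxA !mulmxKV// -[P *m X *m _]mulmxA XD !mulmxA.
  rewrite !mulmxA !mulmxKV// => /(congr1 (fun M => invmx P *m M *m P)).
  by rewrite !mulmxA !mulmxKV// !mulVmx// !mul1mx.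
rewrite E diagconjK//; move: (P *m X *m invmx P) => M; split=> [XD i j lij|X0].
  have /matrixP/(_ i j) := XD; rewrite mul_diag_mx mul_mx_diag !mxE => /eqP.
  by rewrite mulrC -subr_eq0 -mulrBl mulf_eq0 subr_eq0 eq_sym (negPf lij) => /eqP.
apply/matrixP => i j; rewrite mul_diag_mx mul_mx_diag !mxE mulrC.
by have [->//|lij] := eqVneq (l i) (l j); rewrite X0// !mulr0.
Qed.

End DiagonalMisc.

(** * Replicas of an element of the Lie algebra *)

Section Replicas.
Variables (k : closedFieldType) (k0 : [pchar k] =i pred0) (n : nat) (G : set 'M[k]_n).
Hypothesis GG : algebraic_group G.
Variables (X P : 'M[k]_n) (l : 'I_n -> k).
Hypothesis (XG : lie_algebra G X) (Pu : P \in unitmx).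
Hypothesis Xl : forall c, exists N, (X - (l c)%:M) ^+ N *m col c (invmx P) = 0.

(** The parts of p belonging to one eigenvalue of X vanish together at 1, so a factor depending only
    on that eigenvalue may be inserted. With g d = a^(d nu) this yields replicas in the group, with
    g d the pairing of [th] and d those in the Lie algebra. *)
Lemma weights_vanish p (s : seq ('rV[int]_n * {mpoly k[n * n]})) (g : 'rV[int]_n -> k) :
  (forall d d', pairz l d = pairz l d' -> g d = g d') -> vanishing G p ->
  (forall x, x \in s -> torus_weight P X l x.1 x.2) -> p = \sum_(x <- s) x.2 ->
  \sum_(x <- s) g x.1 * mxeval x.2 1%:M = 0.
Proof.
move=> gl Ip Hs ps.
apply: (@sum_by_value_gen _ _ _ s (fun x => pairz l x.1) (fun x => mxeval x.2 1%:M) (fun x => g x.1)).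
  by move=> x y; exact: gl.
move=> mu; apply: (@weight_parts_vanish _ _ P X l (vanishing G) _ _ 1%:M s) => //.
- by move=> c q q'; exact: vanishing_lin.
- by move=> q; exact: vanishing_mxder.
- by move=> q Iq; apply: Iq; exact: group_1.
- by rewrite -ps.
Qed.

Lemma replica_group (nu : 'cV[int]_n) : (forall d, pairz l d = 0 -> (d *m nu) 0 0 = 0) ->
  forall a, a != 0 -> G (diagconj P (fun i => a ^ nu i 0)).
Proof.
move=> Hnu a an.
have zn : nonvanishing (fun i : 'I_n => a ^ nu i 0) by move=> i; exact: expfz_neq0.
apply: (mem_zariski_closure GG); first exact: diagconj_unit.
move=> p Ip; have [s [Hs ps]] := torus_weight_decomposition Pu Xl p.
rewrite ps mxeval_sum -[RHS](weights_vanish (g := fun d => a ^ (d *m nu) 0 0) _ Ip Hs ps).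
  rewrite big_seq [RHS]big_seq; apply: eq_bigr => x xs.
  have [H _ _] := Hs x xs; by rewrite -[diagconj _ _]mul1mx H// monz_exp.
move=> d d' dd; congr (_ ^ _); apply/eqP; rewrite -subr_eq0.
have := Hnu (d - d'); rewrite mulmxBl !mxE => -> //.
by rewrite -scaleN1r pairzD pairzZ dd mulN1r subrr.
Qed.

Lemma replica_lie_gen (th : 'I_n -> k) : (forall d, pairz l d = 0 -> pairz th d = 0) ->
  lie_algebra G (diagconj P th).
Proof.
move=> Hth; apply/lie_algebraE => p Ip.
have [s [Hs ps]] := torus_weight_decomposition Pu Xl p.
rewrite ps mxder_sum mxeval_sum -[RHS](weights_vanish (g := pairz th) _ Ip Hs ps).
  rewrite big_seq [RHS]big_seq; apply: eq_bigr => x xs.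
  by have [_ H _] := Hs x xs; rewrite H mxevalZ.
move=> d d' dd; apply/eqP; rewrite -subr_eq0.
have := Hth (d - d'); rewrite -!scaleN1r !pairzD !pairzZ dd !mulN1r => -> //.
by rewrite subrr.
Qed.

Lemma semisimple_part_lie : lie_algebra G (diagconj P l).
Proof. exact: replica_lie_gen. Qed.

Lemma replica_lie (nu : 'cV[int]_n) : (forall d, pairz l d = 0 -> (d *m nu) 0 0 = 0) ->
  lie_algebra G (diagconj P (fun i => (nu i 0)%:~R)).
Proof.
move=> Hnu; apply: replica_lie_gen => d /Hnu d0.
have -> : pairz (fun i => (nu i 0)%:~R : k) d = ((d *m nu) 0 0)%:~R; last by rewrite d0.
by rewrite mxE rmorph_sum; apply: eq_bigr => i _; rewrite /= intrM mulrC.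
Qed.

End Replicas.

(** On the c-th eigencolumn of the semisimple part S, the matrix X - l_c acts as the nilpotent X -
    S, whose powers preserve the eigenspace since S commutes with them. *)
Lemma generalized_eigencolumns (k : fieldType) n (X P : 'M[k]_n) l : P \in unitmx ->
  comm_mx (diagconj P l) X -> nilpotent_mx (X - diagconj P l) ->
  forall c, exists N, (X - (l c)%:M) ^+ N *m col c (invmx P) = 0.
Proof.
move=> Pu SX [M XM] c; exists M.
set S := diagconj P l in SX XM.
have Sc : S *m col c (invmx P) = l c *: col c (invmx P) by exact: diagconj_col.
have SN : comm_mx S (X - S) by rewrite /comm_mx mulmxBr mulmxBl SX.
suff -> : forall i, (X - (l c)%:M) ^+ i *m col c (invmx P) = (X - S) ^+ i *m col c (invmx P).
  by rewrite XM mul0mx.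
elim=> [//|i IH]; rewrite !exprS -[_ * _ ^+ i]/(_ *m _) -[(X - S) * _]/(_ *m _) -!mulmxA IH.
have E : S *m ((X - S) ^+ i *m col c (invmx P)) = l c *: ((X - S) ^+ i *m col c (invmx P)).
  rewrite mulmxA (_ : S *m (X - S) ^+ i = (X - S) ^+ i *m S).
    by rewrite -mulmxA Sc scalemxAr.
  exact: (commrX i SN).
by rewrite !mulmxBl E mul_scalar_mx.
Qed.

(** A form of Cartan's criterion. If some l_i is not 0, an integer functional nu zero on the
    relations has nu_i non-zero, and its replica H is in Lie(G). H commutes with the nilpotent part
    of X, so 0 = tr(XH) is the sum of the l_j nu_j: nu is itself a relation. Hence the sum of the
    squares nu_j^2 vanishes, a contradiction. *)
Lemma lie_radical_nilpotent (k : closedFieldType) (k0 : [pchar k] =i pred0) n (G : set 'M[k]_n) X :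
  algebraic_group G -> lie_algebra G X -> (forall Y, lie_algebra G Y -> \tr (X *m Y) = 0) ->
  nilpotent_mx X.
Proof.
move=> GG LX XR.
have [S [dS nS cS]] := jordan_chevalley X.
have [P [l [Pu SE]]] := diagonalizable_diagconj dS.
have SX : comm_mx (diagconj P l) X by rewrite -SE; apply: cS; exact: comm_mx_refl.
rewrite SE in nS.
have Xl := generalized_eigencolumns Pu SX nS.
suff l0 i : l i = 0.
  have S0 : S = 0 by rewrite SE -(diagconj0 Pu); congr diagconj; apply/funext => i.
  by move: nS; rewrite -SE S0 subr0.
apply/eqP; apply: contrapT => /negP li.
have [|nu [Hnu nui]] := @exists_integer_functional _ k0 _ l (delta_mx 0 i).
  rewrite /pairz (bigD1 i) //= big1 => [|j ji]; first by rewrite mxE !eqxx mulr1 addr0.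
  by rewrite mxE (negPf ji) andbF mulr0.
have LH := replica_lie GG LX Pu Xl Hnu.
have nuD : forall i j, l i = l j -> nu i 0 = nu j 0.
  move=> a b ab; have := Hnu (delta_mx 0 a - delta_mx 0 b).
  rewrite mulmxBl -!rowE !mxE => H; apply/eqP; rewrite -subr_eq0 H//.
  rewrite -scaleN1r pairzD pairzZ mulN1r.
  have pd c : pairz l (delta_mx 0 c) = l c.
    rewrite /pairz (bigD1 c) //= big1 => [|j ji]; first by rewrite mxE !eqxx mulr1 addr0.
    by rewrite mxE (negPf ji) andbF mulr0.
  by rewrite !pd ab subrr.
have trN : \tr ((X - diagconj P l) *m diagconj P (fun i => (nu i 0)%:~R)) = 0.
  apply: mxtrace_nilpotent; apply: nilpotentM_comm => //.
  apply/(comm_mx_diagconj Pu) => a b nab.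
  have /(comm_mx_diagconj Pu) : comm_mx (X - diagconj P l) (diagconj P l).
    by rewrite /comm_mx mulmxBr mulmxBl SX.
  by apply; apply: contraNneq nab => /nuD ->.
have tr0 := XR _ LH.
have : pairz l nu^T = 0.
  rewrite -[RHS]tr0 -[X in \tr (X *m _)](subrK (diagconj P l)) mulmxDl raddfD /= trN add0r.
  rewrite diagconjM// mxtrace_diagconj//; apply: eq_bigr => c _; by rewrite mxE.
move/Hnu; rewrite mxE => /eqP; rewrite psumr_eq0 => [|c _]; last by rewrite mxE -expr2 sqr_ge0.
move=> /allP/(_ i (mem_index_enum _)) /=; rewrite mxE mulf_eq0 orbb => /eqP nu0.
by move: nui; rewrite -rowE !mxE nu0 eqxx.
Qed.

Definition framed (k : fieldType) n r (E : seq 'rV[int]_r) (A : 'rV[int]_r -> 'M[k]_n)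
    (P : 'M[k]_n) (w : 'I_n -> 'rV[int]_r) : Prop :=
  [/\ P \in unitmx, forall i, w i \in E &
      forall e, e \in E -> A e = diagconj P (fun i => (w i == e)%:R)].

Lemma expz_nat_eq1 (k : fieldType) (k0 : [pchar k] =i pred0) (j : int) :
  (2%:R : k) ^ j = 1 -> j = 0.
Proof.
have nat_case (m : nat) : (2%:R : k) ^+ m = 1 -> m = 0%N.
  move/eqP; rewrite -natrX -subr_eq0 -(natrB _ (expn_gt0 2 m)) natf_eq0// subn_eq0.
  by case: m => // m; rewrite expnS; have := expn_gt0 2 m; lia.
case: j => m; first by move/nat_case => ->.
rewrite NegzE -exprnN => /(congr1 (@GRing.inv k)); rewrite invrK invr1 => /nat_case //.
Qed.

Section FramedTorus.
Variables (k : closedFieldType) (k0 : [pchar k] =i pred0) (n r : nat) (T : set 'M[k]_n).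
Variables (E : seq 'rV[int]_r) (A : 'rV[int]_r -> 'M[k]_n) (fr : torus_frame T E A).

Lemma frame_sum P w (th : 'rV[int]_r -> k) : framed E A P w ->
  \sum_(e <- E) th e *: A e = diagconj P (fun i => th (w i)).
Proof.
move=> [Pu wE AE]; have [uE _ _ _] := fr.
rewrite big_seq (eq_bigr (fun e => th e *: diagconj P (fun i => (w i == e)%:R))) => [|e eE]; last first.
  by rewrite AE.
rewrite -big_seq diagconj_sum//; congr diagconj; apply/funext => i.
rewrite (bigD1_seq (w i)) //= eqxx mulr1 big1 ?addr0// => e; rewrite eq_sym => /negPf ->.
exact: mulr0.
Qed.

Lemma framed_torusE P w : framed E A P w ->
  T = [set diagconj P (fun i => monz z (w i)) | z in @nonvanishing k r].
Proof.
move=> fw; have [_ -> _ _] := fr; apply/seteqP.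
by split=> _ [z zn <-]; exists z => //; rewrite (frame_sum (fun e => monz z e) fw).
Qed.

Lemma framed_exists S : diagonalizable S -> (forall e, e \in E -> comm_mx S (A e)) ->
  exists P l w, framed E A P w /\ S = diagconj P l.
Proof.
move=> dS cS; have [P [l [w [Pu SE wE AE]]]] := torus_codiagonalization fr dS cS.
by exists P, l, w.
Qed.

Lemma frame_comm X : (forall t, T t -> comm_mx X t) -> forall e, e \in E -> comm_mx X (A e).
Proof. exact: torus_frame_comm. Qed.

Variables (G : set 'M[k]_n) (GG : algebraic_group G) (Tm : maximal_torus G T).

(* Otherwise some one-parameter group of replicas of X would enlarge the torus T. *)
Lemma weight_relation P w X l : framed E A P w -> lie_algebra G X ->
  (forall c, exists N, (X - (l c)%:M) ^+ N *m col c (invmx P) = 0) ->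
  forall m : 'rV[int]_n, m *m (\matrix_i w i) = 0 -> pairz l m = 0.
Proof.
move=> fw XG Xl m mW; apply: contrapT => /eqP lm.
have [Pu wE AE] := fw; have TE := framed_torusE fw.
have [nu [Hnu num]] := exists_integer_functional k0 lm.
have GN := replica_group GG XG Pu Xl Hnu.
pose N := row_mx (\matrix_i w i) nu.
have NE u i : mact N u i = monz (fun a => u (lshift 1 a)) (w i) * u (rshift r 0) ^ nu i 0.
  rewrite /mact /monz big_split_ord /= big_ord1; congr (_ * _); last by rewrite mxE row_mxEr.
  by apply: eq_bigr => a _; rewrite mxE row_mxEl mxE.
have TT : T `<=` exponent_torus P N.
  move=> t; rewrite TE => -[z zn <-].
  pose u (a : 'I_(r + 1)) := match split a with inl b => z b | inr _ => 1 end.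
  exists u => [a|]; first by rewrite /u; case: (split a) => // _; exact: oner_neq0.
  congr diagconj; apply/funext => i; rewrite NE.
  have -> : u (rshift r 0) = 1 by rewrite /u (unsplitK (inr 0)).
  rewrite exp1rz mulr1; congr (monz _ _); apply/funext => a.
  by rewrite /u (unsplitK (inl a)).
have [torT TG maxT] := Tm.
have TN : exponent_torus P N = T.
  apply: maxT => //; first exact: exponent_torus_torus.
  move=> _ [u un <-]; rewrite (_ : diagconj P _ =
      diagconj P (fun i => monz (fun a => u (lshift 1 a)) (w i)) *m
      diagconj P (fun i => u (rshift r 0) ^ nu i 0)).
    apply: (group_mul GG); last exact: GN.
    by apply: TG; rewrite TE; exists (fun a => u (lshift 1 a)) => // a.
  by rewrite diagconjM//; congr diagconj; apply/funext => i; rewrite NE.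
(* The element 2 has infinite order in k, so the single point a = 2 of the one-parameter group
   detects a non-zero exponent. *)
have two0 : (2%:R : k) != 0 by rewrite natf_eq0.
have : T (diagconj P (fun i => (2%:R : k) ^ nu i 0)).
  rewrite -TN; exists (fun a => match split a with inl b => 1 | inr _ => 2%:R end) => [a|].
    by case: (split a) => // _; exact: oner_neq0.
  congr diagconj; apply/funext => i; rewrite NE (unsplitK (inr 0)) /monz big1 ?mul1r// => a _.
  by rewrite (unsplitK (inl a)) exp1rz.
rewrite TE => -[z zn /(diagconj_inj Pu) zE].
have : (2%:R : k) ^ (m *m nu) 0 0 = 1.
  rewrite -monz_exp//.
  have -> : (fun i => (2%:R : k) ^ nu i 0) = mact (\matrix_i w i) z.
    by rewrite -zE; apply/funext => i; rewrite /mact rowK.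
  rewrite -[RHS](monz0 z) -mW; have := mact_mulmx m (\matrix_i w i) zn.
  by move=> /(congr1 (fun f => f 0)); rewrite /mact !row_id => ->.
by move/(expz_nat_eq1 k0)/eqP; rewrite (negPf num).
Qed.

(** The semisimple part is diagonalized together with T. When two coordinates have the same weight,
    their difference is a relation between weights, so [weight_relation] equates their eigenvalues:
    the semisimple part is scalar on each weight space. *)
Lemma zero_weight_semisimple_part X : lie_algebra G X -> (forall t, T t -> comm_mx X t) ->
  exists th : 'rV[int]_r -> k, nilpotent_mx (X - \sum_(e <- E) th e *: A e) /\
    lie_algebra G (\sum_(e <- E) th e *: A e).
Proof.
move=> XG cX; have [S [dS nS cS]] := jordan_chevalley X.
have [|P [l [w [fw SE]]]] := framed_exists dS.
  by move=> e eE; apply: cS; exact: frame_comm.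
have [Pu wE AE] := fw.
rewrite SE in nS.
have SX : comm_mx (diagconj P l) X by rewrite -SE; apply: cS; exact: comm_mx_refl.
have Xl := generalized_eigencolumns Pu SX nS.
have lw i j : w i = w j -> l i = l j.
  move=> wij; have := weight_relation fw XG Xl (m := delta_mx 0 i - delta_mx 0 j).
  rewrite mulmxBl -!rowE !rowK wij subrr => /(_ erefl) H.
  have pd c : pairz l (delta_mx 0 c) = l c.
    rewrite /pairz (bigD1 c) //= big1 => [|a ac]; first by rewrite mxE !eqxx mulr1 addr0.
    by rewrite mxE (negPf ac) andbF mulr0.
  by move: H; rewrite -scaleN1r pairzD pairzZ mulN1r !pd => /eqP; rewrite subr_eq0 => /eqP.
have /choice[th Hth] : forall e, exists a, forall i, w i = e -> l i = a.
  move=> e; have [[i <-]|no] := pselect (exists i, w i = e); first by exists (l i) => j; exact: lw.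
  by exists 0 => i we; case: no; exists i.
have thE : \sum_(e <- E) th e *: A e = diagconj P l.
  by rewrite (frame_sum th fw); congr diagconj; apply/funext => i; rewrite -(Hth (w i) i).
by exists th; rewrite thE; split=> //; exact: semisimple_part_lie XG Pu Xl.
Qed.

End FramedTorus.

(** * The grading defined by a cocharacter *)

Section Grading.
Variables (k : fieldType) (k0 : [pchar k] =i pred0) (n : nat) (P : 'M[k]_n) (Pu : P \in unitmx).
Variable hh : 'I_n -> int.
Implicit Types (X Y M : 'M[k]_n) (pi rho : pred int).

Definition conjP X := P *m X *m invmx P.
Definition unconjP M := invmx P *m M *m P.

Lemma unconjPK M : conjP (unconjP M) = M.
Proof. by rewrite /conjP /unconjP !mulmxA mulmxV// mul1mx mulmxK. Qed.
Lemma conjPK X : unconjP (conjP X) = X.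
Proof. by rewrite /conjP /unconjP !mulmxA mulVmx// mul1mx mulmxKV. Qed.
Lemma conjPM X Y : conjP (X *m Y) = conjP X *m conjP Y.
Proof. by rewrite /conjP !mulmxA mulmxKV. Qed.
Lemma conjPD X Y : conjP (X + Y) = conjP X + conjP Y.
Proof. by rewrite /conjP mulmxDr mulmxDl. Qed.
Lemma conjPZ c X : conjP (c *: X) = c *: conjP X.
Proof. by rewrite /conjP -scalemxAr -scalemxAl. Qed.
Lemma conjP1 : conjP 1%:M = 1%:M.
Proof. by rewrite /conjP mulmx1 mulmxV. Qed.
Lemma conjP_diagconj z : conjP (diagconj P z) = diagz z.
Proof. exact: diagconjK. Qed.
Lemma conjP_inj : injective conjP.
Proof. exact: can_inj conjPK. Qed.

Definition graded pi X := forall i j, ~~ pi (hh i - hh j) -> conjP X i j = 0.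

Definition gpart pi X := unconjP (\matrix_(i, j) if pi (hh i - hh j) then conjP X i j else 0).

Lemma graded_gpart pi X : graded pi (gpart pi X).
Proof. by move=> i j /negPf h; rewrite unconjPK mxE h. Qed.

Lemma gradedM pi rho (sig : pred int) X Y : (forall a b, pi a -> rho b -> sig (a + b)) ->
  graded pi X -> graded rho Y -> graded sig (X *m Y).
Proof.
move=> H gX gY i j nij; rewrite conjPM mxE; apply: big1 => a _.
case p : (pi (hh i - hh a)); last by rewrite gX ?p// mul0r.
case q : (rho (hh a - hh j)); last by rewrite gY ?q// mulr0.
by have := H _ _ p q; rewrite addrA subrK (negPf nij).
Qed.

Lemma gradedD pi X Y : graded pi X -> graded pi Y -> graded pi (X + Y).
Proof. by move=> gX gY i j h; rewrite conjPD mxE gX// gY// addr0. Qed.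

Lemma gradedZ pi c X : graded pi X -> graded pi (c *: X).
Proof. by move=> gX i j h; rewrite conjPZ mxE gX// mulr0. Qed.

Lemma graded_trace pi X : ~~ pi 0 -> graded pi X -> \tr X = 0.
Proof.
move=> p0 gX; have -> : \tr X = \tr (conjP X).
  by rewrite /conjP mxtrace_mulC mulmxA mulVmx// mul1mx.
by apply: big1 => i _; rewrite gX// subrr.
Qed.

Lemma graded_nilpotent d X : d != 0 -> graded (pred1 d) X -> nilpotent_mx X.
Proof.
move=> dn gX; pose B := (\sum_i `|hh i|)%N.
have hB i : (`|hh i| <= B)%N by rewrite /B (bigD1 i) //= leq_addr.
have gXm m : graded (pred1 (m%:Z * d)) (X ^+ m).
  elim: m => [|m IH].
    move=> i j; rewrite expr0 conjP1 mul0r /= mxE; case: (i =P j) => [->|//].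
    by rewrite subrr eqxx.
  rewrite exprS; apply: gradedM gX IH => a b /eqP -> /eqP ->; apply/eqP.
  by rewrite -addn1 PoszD; ring.
exists (2 * B).+1; apply: conjP_inj; apply/matrixP => i j.
rewrite gXm /=; first by rewrite /conjP mulmx0 mul0mx mxE.
apply/eqP => E; have := hB i; have := hB j.
have : (`|hh i - hh j| = (2 * B).+1 * `|d|)%N by rewrite E abszM.
by move: dn; rewrite -absz_gt0; nia.
Qed.

Lemma gpart_parts X : X = gpart (fun d => d < 0) X + (gpart (pred1 0) X + gpart (fun d => 0 < d) X).
Proof.
apply: conjP_inj; rewrite !conjPD !unconjPK; apply/matrixP => i j; rewrite !mxE.
by rewrite /=; case: (ltgtP (hh i - hh j) 0) => _; rewrite !(addr0, add0r).
Qed.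

(** Conjugation by the one-parameter group multiplies the part of degree d by a^d. A linear equation
    of Lie(G) evaluated on the conjugates of X is a Laurent polynomial in a that vanishes
    identically, hence holds degree by degree. *)
Lemma gpart_lie (G : set 'M[k]_n) pi X : algebraic_group G ->
  (forall a, a != 0 -> G (diagconj P (fun i => a ^ hh i))) ->
  lie_algebra G X -> lie_algebra G (gpart pi X).
Proof.
move=> GG Ga LX; apply/lie_algebraE => p Ip.
pose ell Y := mxeval (mxder Y p) 1%:M.
have ell_sum (I : eqType) (s : seq I) (c : I -> k) (Y : I -> 'M[k]_n) :
    ell (\sum_(x <- s) c x *: Y x) = \sum_(x <- s) c x * ell (Y x).
  elim: s => [|x s IH]; last by rewrite !big_cons -IH /ell mxder_scaleD mxevalD mxevalZ.
  rewrite !big_nil /ell; have := mxder_scaleD 1 0 0 p; rewrite !scale1r addr0.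
  by rewrite -{1}[mxder 0 p]addr0 => /addrI <-; rewrite mxeval0.
have ellE M : ell (unconjP M) = \sum_x M x.1 x.2 * ell (unconjP (delta_mx x.1 x.2)).
  rewrite -ell_sum {1}[M]matrix_sum_delta /unconjP; congr ell.
  rewrite pair_big mulmx_sumr mulmx_suml; apply: eq_bigr => -[i j] _ /=.
  by rewrite -scalemxAr -scalemxAl.
pose c x := conjP X x.1 x.2 * ell (unconjP (delta_mx x.1 x.2)).
have H a : a != 0 -> \sum_x c x * a ^ (hh x.1 - hh x.2) = 0.
  move=> an; have an' i : a ^ hh i != 0 by exact: expfz_neq0.
  have := lie_conj GG (Ga a an) LX.
  set Y := _ *m _ *m _; move/lie_algebraE/(_ p Ip); rewrite -[mxeval _ _]/(ell Y).
  have -> : Y = unconjP (\matrix_(i, j) (conjP X i j * a ^ (hh i - hh j))).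
    apply: conjP_inj; rewrite unconjPK /Y diagconjV// conjPM [conjP (_ *m X)]conjPM !conjP_diagconj.
    apply/matrixP => i j; rewrite /diagz mul_diag_mx mul_mx_diag !mxE expfzDr// -invr_expz; ring.
  rewrite ellE => E; rewrite -[RHS]E; apply: eq_bigr => x _; rewrite mxE /c; ring.
have E := sum_by_value (fun d => (pi d)%:R) (laurent1_indep k0 H).
rewrite -[mxeval _ _]/(ell _) ellE -[RHS]E; apply: eq_bigr => x _.
by rewrite mxE /c; case: (pi _); rewrite ?mul1r ?mul0r.
Qed.

End Grading.

(** * The zero weight space of Lie(G) *)

Section Centralizer.
Variables (k : closedFieldType) (k0 : [pchar k] =i pred0) (n : nat) (G T : set 'M[k]_n).
Hypotheses (Gs : simple_algebraic_group G) (Tm : maximal_torus G T).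
Hypothesis root_ex : exists alpha, group_root G T alpha.
Variables (r : nat) (E : seq 'rV[int]_r) (A : 'rV[int]_r -> 'M[k]_n) (fr : torus_frame T E A).
Variables (P : 'M[k]_n) (w : 'I_n -> 'rV[int]_r) (fw : framed E A P w).
Variable h : 'cV[int]_r.
Hypothesis sep : forall i j, w i != w j -> ((w i - w j) *m h) 0 0 != 0.

Let GG : algebraic_group G. Proof. by case: Gs. Qed.
Let TG : T `<=` G. Proof. by case: Tm. Qed.
Let Pu : P \in unitmx. Proof. by case: fw. Qed.
Let TE := framed_torusE fr fw.
Let hh i : int := (w i *m h) 0 0.

Lemma hh_eq i j : (hh i == hh j) = (w i == w j).
Proof.
apply/eqP/eqP => [E1|E1]; last by rewrite /hh E1.
apply/eqP; apply: contrapT => /negP/sep.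
by rewrite mulmxBl mxE [X in _ + X]mxE -/(hh i) -/(hh j) E1 subrr eqxx.
Qed.

Lemma cocharacter a : a != 0 -> T (diagconj P (fun i => a ^ hh i)).
Proof.
move=> an; rewrite TE; exists (fun b => a ^ h b 0) => [b|]; first exact: expfz_neq0.
by congr diagconj; apply/funext => i; rewrite monz_exp.
Qed.

Let two0 : (2%:R : k) != 0. Proof. by rewrite natf_eq0. Qed.

Lemma centralizes_graded X : (forall t, T t -> comm_mx X t) -> graded P hh (pred1 0) X.
Proof.
move=> cX i j /= hij.
have /(comm_mx_diagconj Pu) := cX _ (cocharacter two0); apply.
apply: contra hij => /eqP E1; apply/eqP/(expz_nat_eq1 k0).
by rewrite expfzDr// E1 -expfzDr// subrr expr0z.
Qed.

Lemma graded_centralizes X : graded P hh (pred1 0) X -> forall t, T t -> comm_mx X t.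
Proof.
move=> gX t; rewrite TE => -[z zn <-]; apply/(comm_mx_diagconj Pu) => i j zij.
by apply: gX; rewrite /= subr_eq0 hh_eq; apply: contra zij => /eqP ->.
Qed.

(** A root vector only joins weights that differ by the root, so it is homogeneous of degree
    non-zero for [hh], and nilpotent for that reason. *)
Lemma exists_nilpotent_root : exists X, [/\ lie_algebra G X, nilpotent_mx X, X <> 0 &
  exists i j, hh i != hh j].
Proof.
have [alpha [[_ an0 _] a1 [X Xn0 [LX aX]]]] := root_ex.
have aE t : T t -> conjP P t *m conjP P X = alpha t *: (conjP P X *m conjP P t).
  move=> Tt; rewrite -!(conjPM Pu) -conjPZ; congr conjP.
  have tu := group_unit GG (TG Tt).
  by rewrite scalemxAl -aX// mulmxKV.
have entry z i j : nonvanishing z -> conjP P X i j != 0 ->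
    alpha (diagconj P (fun i => monz z (w i))) * monz z (w j) = monz z (w i).
  move=> zn Xij; have /(aE _)/matrixP/(_ i j) : T (diagconj P (fun i => monz z (w i))).
    by rewrite TE; exists z.
  rewrite conjP_diagconj//; move: (conjP P X) Xij => M Mij.
  rewrite /diagz mul_diag_mx mul_mx_diag !mxE => E1.
  by apply: (mulfI Mij); rewrite [RHS]mulrC E1; ring.
have [i [j Xij]] : exists i j, conjP P X i j != 0.
  apply: contrapT => H; apply: Xn0; apply: (conjP_inj Pu); apply/matrixP => i j.
  rewrite /conjP mulmx0 mul0mx [RHS]mxE; apply: contrapT => /eqP Xij; apply: H.
  by exists i, j.
have hij : hh i != hh j.
  apply/negP; rewrite hh_eq => /eqP wij; apply: a1 => t; rewrite TE => -[z zn <-].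
  have := entry z i j zn Xij; rewrite wij => E1.
  by apply: (mulIf (monz_neq0 (w j) zn)); rewrite E1 mul1r.
exists X; split=> //; last by exists i, j.
apply: (@graded_nilpotent _ _ P Pu hh (hh i - hh j)); first by rewrite subr_eq0.
move=> a b /= hab; apply: contrapT => /eqP Xab; move: hab; apply/negP; rewrite negbK.
have zn : nonvanishing (fun b : 'I_r => (2%:R : k) ^ h b 0) by move=> c; exact: expfz_neq0.
have := entry _ _ _ zn Xab; have := entry _ _ _ zn Xij; rewrite !monz_exp// -/(hh _) -!/(hh _).
set al := alpha _ => E1 E2; rewrite -subr_eq0; apply/eqP/(expz_nat_eq1 k0).
have al2 c d : al * 2%:R ^ hh d = 2%:R ^ hh c -> al = 2%:R ^ (hh c - hh d).
  by move=> E3; rewrite expfzDr// -E3 -mulrA -expfzDr// subrr expr0z mulr1.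
by rewrite expfzDr// -(al2 _ _ E2) (al2 _ _ E1) -expfzDr// subrr expr0z.
Qed.

Definition lie_radical : set 'M[k]_n :=
  [set X | lie_algebra G X /\ forall Y, lie_algebra G Y -> \tr (X *m Y) = 0].

Lemma lie_radical_lin c X Y : lie_radical X -> lie_radical Y -> lie_radical (c *: X + Y).
Proof.
move=> [LX RX] [LY RY]; split=> [|Z LZ]; first exact: lie_lin.
by rewrite mulmxDl -scalemxAl linearD linearZ /= RX// RY// mulr0 addr0.
Qed.

Lemma lie_radical_bracket X Y : lie_radical X -> lie_radical Y -> lie_radical (X *m Y - Y *m X).
Proof.
move=> [LX RX] [LY RY]; split=> [|Z LZ]; first exact: lie_bracket.
have := RX _ (lie_bracket GG LY LZ); rewrite mulmxBl mulmxBr !raddfB /= !mulmxA.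
by rewrite -[Y *m X *m Z]mulmxA [\tr (Y *m _)]mxtrace_mulC.
Qed.

Lemma lie_radical_conj g X : G g -> lie_radical X -> lie_radical (g *m X *m invmx g).
Proof.
move=> Gg [LX RX]; split=> [|Y LY]; first exact: lie_conj.
have gu := group_unit GG Gg.
have := RX _ (lie_conj GG (group_inv GG Gg) LY); rewrite invmxK => <-.
by rewrite -mulmxA mxtrace_mulC !mulmxA -[X in \tr X = _]mulmxA mxtrace_mulC !mulmxA.
Qed.

(** Otherwise the trace would be constantly n on G. On the cocharacter this says that the sum of the
    a^(hh i) equals n for all a, so every [hh i] is 0, although a root vector requires two distinct
    heights. *)
Lemma lie_radical_0 X : lie_radical X -> nilpotent_mx X -> X = 0.
Proof.
move=> RX nX; apply: contrapT => Xn0.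
have nilR Y : lie_radical Y -> nilpotent_mx Y by case=> LY; exact: lie_radical_nilpotent.
have [t tE] : polyfun (fun g : 'M[k]_n => \tr g - n%:R).
  apply: polyfunD; last exact: polyfun_const.
  by apply: polyfun_sum => i; exact: polyfun_entry.
have It : vanishing (expgen lie_radical) t.
  move=> g Eg; rewrite -tE (expgen_trace k0 lie_radical_lin lie_radical_bracket nilR _ Eg) ?subrr//.
  by exists X.
have R0 : lie_radical 0.
  by have := lie_radical_lin (-1) RX RX; rewrite scaleN1r addNr.
have RZ c Y : lie_radical Y -> lie_radical (c *: Y).
  by move=> RY; have := lie_radical_lin c RY R0; rewrite addr0.
have trG : vanishing G t.
  apply: (expgen_dense k0 GG Gs _ RZ lie_radical_conj _ It); first by move=> Y [].
  by exists X.
have trT (a : k) : a != 0 -> \sum_i (a ^ hh i) = n%:R.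
  move=> an; have := trG _ (TG (cocharacter an)); rewrite -tE mxtrace_diagconj// => /eqP.
  by rewrite subr_eq0 => /eqP.
(* The family encodes the Laurent polynomial sum of a^(hh i) minus n, [None] being the constant
   term. *)
pose d (x : option 'I_n) : int := if x is Some i then hh i else 0.
pose c (x : option 'I_n) : k := if x is Some i then 1 else - n%:R.
pose s := None :: [seq Some i | i <- index_enum 'I_n].
have H a : a != 0 -> \sum_(x <- s) c x * a ^ d x = 0.
  move=> an; rewrite big_cons big_map /= expr0z mulr1.
  by under eq_bigr do rewrite mul1r; rewrite trT ?addNr.
have hh0 i : hh i = 0.
  apply: contrapT => hi; have := laurent1_indep k0 H (hh i).
  rewrite big_cons big_map /= eq_sym (introF eqP hi) sumr_const => /eqP; rewrite natf_eq0//.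
  by move=> /eqP/card0_eq/(_ i); rewrite -[LHS]/(hh i == hh i) eqxx.
have [_ [_ _ _ [i [j]]]] := exists_nilpotent_root.
by rewrite !hh0 eqxx.
Qed.

Lemma nilpotent_mul_weight X e : graded P hh (pred1 0) X -> nilpotent_mx X -> e \in E ->
  \tr (X *m A e) = 0.
Proof.
move=> gX nX eE; apply: mxtrace_nilpotent; apply: nilpotentM_comm => //.
exact: (frame_comm k0 fr (graded_centralizes gX)).
Qed.

(** The coefficients of the semisimple parts of Y and X + Y on the A_e are read off from traces
    against A_e, to which the nilpotent X contributes nothing; so both have the same semisimple part
    S. With Z = Y - S, the matrices X, Z and X + Z are nilpotent, and tr((X + Z)^2) = 0 gives 2
    tr(XZ) = 0, while tr(XS) = 0. *)
Lemma zero_weight_nilpotent_pairing X Y : lie_algebra G X -> lie_algebra G Y ->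
  graded P hh (pred1 0) X -> graded P hh (pred1 0) Y -> nilpotent_mx X -> \tr (X *m Y) = 0.
Proof.
move=> LX LY gX gY nX.
have gXY : graded P hh (pred1 0) (X + Y) by exact: gradedD.
have LXY : lie_algebra G (X + Y) by rewrite -[X]scale1r; exact: lie_lin.
have [th [nY _]] := zero_weight_semisimple_part k0 fr GG Tm LY (graded_centralizes gY).
have [th' [nXY _]] := zero_weight_semisimple_part k0 fr GG Tm LXY (graded_centralizes gXY).
have [_ wE AE] := fw.
have thE i : th' (w i) = th (w i).
  have wiE := wE i.
  have trA : \tr (A (w i)) != 0.
    rewrite AE// mxtrace_diagconj// -natr_sum natf_eq0// -lt0n.
    by rewrite (bigD1 i) //= eqxx.
  have trS (th0 : 'rV[int]_r -> k) : \tr ((\sum_(e <- E) th0 e *: A e) *m A (w i)) = th0 (w i) * \tr (A (w i)).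
    rewrite (frame_sum fr th0 fw) AE// diagconjM// !mxtrace_diagconj// mulr_sumr.
    by apply: eq_bigr => j _; case: eqP => [->|_]; rewrite ?mulr0.
  have cS (th0 : 'rV[int]_r -> k) : graded P hh (pred1 0) (\sum_(e <- E) th0 e *: A e).
    rewrite (frame_sum fr th0 fw) => a b /= hab; rewrite conjP_diagconj// diagzE.
    by case: eqP => // ab; move: hab; rewrite ab subrr eqxx.
  have gB Z (th0 : 'rV[int]_r -> k) : graded P hh (pred1 0) Z ->
      graded P hh (pred1 0) (Z - \sum_(e <- E) th0 e *: A e).
    by move=> gZ; apply: gradedD => //; rewrite -scaleN1r; exact: gradedZ.
  have := nilpotent_mul_weight (gB _ _ gY) nY wiE.
  have := nilpotent_mul_weight (gB _ _ gXY) nXY wiE.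
  have := nilpotent_mul_weight gX nX wiE.
  rewrite !mulmxBl mulmxDl !raddfB raddfD /= !trS => -> /eqP.
  rewrite add0r subr_eq0 => /eqP E1 /eqP; rewrite subr_eq0 => /eqP E2.
  by apply: (mulIf trA); rewrite -E1 -E2.
have SE : \sum_(e <- E) th' e *: A e = \sum_(e <- E) th e *: A e.
  rewrite !(frame_sum fr _ fw); congr diagconj; apply/funext => i; exact: thE.
rewrite SE -addrA in nXY.
set S := \sum_(e <- E) _ in nY nXY.
have [Z ZE] : exists Z, Z = Y - S by eexists.
rewrite -ZE in nY nXY.
have trS : \tr (X *m S) = 0.
  rewrite mulmx_sumr raddf_sum big_seq; apply: big1 => e eE /=.
  by rewrite -scalemxAr linearZ /= nilpotent_mul_weight// mulr0.
have sq (Z' : 'M[k]_n) : nilpotent_mx Z' -> \tr (Z' *m Z') = 0.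
  by move=> nZ; apply: mxtrace_nilpotent; apply: nilpotentM_comm => //; exact: comm_mx_refl.
have := sq _ nXY; rewrite mulmxDl !mulmxDr !raddfD /= sq// sq// addr0 add0r.
rewrite [\tr (Z *m X)]mxtrace_mulC -mulr2n => /eqP; rewrite -mulr_natl mulf_eq0 (negPf two0) /=.
by rewrite ZE mulmxBr raddfB /= trS subr0 => /eqP.
Qed.

Let Gcochar a : a != 0 -> G (diagconj P (fun i => a ^ hh i)).
Proof. by move=> an; apply: TG; exact: cocharacter. Qed.

(** Only the degree-zero part of Y contributes to tr(XY), so the previous pairing puts X in the
    radical. *)
Lemma zero_weight_nilpotent X : lie_algebra G X -> graded P hh (pred1 0) X -> nilpotent_mx X -> X = 0.
Proof.
move=> LX gX nX; apply: lie_radical_0 => //; split=> // Y LY.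
rewrite (gpart_parts Pu hh Y) !mulmxDr !raddfD /=.
have tr_part (pi : pred int) : ~~ pi 0 -> \tr (X *m gpart P hh pi Y) = 0.
  move=> pi0; apply: (graded_trace Pu pi0).
  apply: (@gradedM _ _ _ Pu hh (pred1 0) pi) => //; last exact: graded_gpart.
  by move=> a b /eqP -> /=; rewrite add0r.
rewrite (tr_part (fun d => d < 0)) ?ltxx// (tr_part (fun d => 0 < d)) ?ltxx// add0r addr0; apply: zero_weight_nilpotent_pairing => //.
  exact: gpart_lie.
exact: graded_gpart.
Qed.

Lemma zero_weight_diagonal X : lie_algebra G X -> graded P hh (pred1 0) X ->
  exists th : 'rV[int]_r -> k, X = diagconj P (fun i => th (w i)).
Proof.
move=> LX gX.
have [th [nS LS]] := zero_weight_semisimple_part k0 fr GG Tm LX (graded_centralizes gX).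
exists th; rewrite -(frame_sum fr th fw); apply/eqP; rewrite -subr_eq0; apply/eqP.
apply: zero_weight_nilpotent => //.
  by rewrite -scaleN1r addrC; exact: lie_lin.
apply: gradedD => //; rewrite -scaleN1r; apply: gradedZ.
rewrite (frame_sum fr th fw) => a b /= hab; rewrite conjP_diagconj// diagzE.
by case: eqP => // ab; move: hab; rewrite ab subrr eqxx.
Qed.

Lemma zero_weight_relation l : lie_algebra G (diagconj P l) ->
  forall m : 'rV[int]_n, m *m (\matrix_i w i) = 0 -> pairz l m = 0.
Proof.
move=> Ll; apply: (weight_relation k0 fr GG Tm fw Ll).
apply: generalized_eigencolumns => //.
by rewrite subrr; exact: nilpotent0.
Qed.

End Centralizer.

(** * The big cell *)

Lemma unipotent_unit (k : fieldType) n (N : 'M[k]_n) : nilpotent_mx N -> 1%:M + N \in unitmx.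
Proof.
move=> [M NM]; have XM : (- N) ^+ M = 0 by rewrite -scaleN1r exprZmx NM scaler0.
have /mulmx1_unit[] // : (1%:M + N) *m (\sum_(i < M) (- N) ^+ i) = 1%:M.
rewrite (_ : 1%:M + N = - (- N - 1)); last by rewrite opprB opprK.
by rewrite -[_ *m _]/(_ * _) mulNr -subrX1 XM sub0r opprK.
Qed.

Lemma mxder_line (k : fieldType) (k0 : [pchar k] =i pred0) n q (g Y : 'M[k]_n) :
  (forall b, mxeval q (g *m (1%:M + b *: Y)) = 0) -> mxeval (mxder Y q) g = 0.
Proof.
move=> H; pose C : 'M[{poly k}]_n := map_mx polyC g + 'X *: map_mx polyC (g *m Y).
have Cb b : map_mx (horner^~ b) C = g *m (1%:M + b *: Y).
  rewrite mulmxDr mulmx1 -scalemxAr /C; move: (g *m Y) => M; apply/matrixP => i j.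
  by rewrite !mxE hornerD hornerM hornerX !hornerC.
have C0 : map_mx (horner^~ 0) C = g by rewrite Cb scale0r addr0 mulmx1.
have dC : map_mx (horner^~ 0) (map_mx (@deriv k) C) = map_mx (horner^~ 0) C *m Y.
  rewrite C0 /C; move: (g *m Y) => M; apply/matrixP => i j.
  by rewrite !mxE derivD derivC add0r derivM derivX derivC mulr0 addr0 mul1r hornerC.
have := deriv_mxcurve0 q dC; rewrite C0 => <-.
have -> : mxcurve C q = 0.
  by apply: (poly_vanish_eq0 k0) => b _; rewrite horner_mxcurve Cb.
by rewrite linear0 horner0.
Qed.

Section Density.
Variables (k : closedFieldType) (k0 : [pchar k] =i pred0) (n : nat) (G T : set 'M[k]_n).
Hypotheses (Gs : simple_algebraic_group G) (Tm : maximal_torus G T).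
Hypothesis root_ex : exists alpha, group_root G T alpha.
Variables (r : nat) (E : seq 'rV[int]_r) (A : 'rV[int]_r -> 'M[k]_n) (fr : torus_frame T E A).
Variables (P : 'M[k]_n) (w : 'I_n -> 'rV[int]_r) (fw : framed E A P w).
Variable h : 'cV[int]_r.
Hypothesis sep : forall i j, w i != w j -> ((w i - w j) *m h) 0 0 != 0.

Let GG : algebraic_group G. Proof. by case: Gs. Qed.
Let TG : T `<=` G. Proof. by case: Tm. Qed.
Let TT : algebraic_group T. Proof. by case: Tm => -[]. Qed.
Let Pu : P \in unitmx. Proof. by case: fw. Qed.
Let TE := framed_torusE fr fw.
Let hh i : int := (w i *m h) 0 0.
Let W : 'M[int]_(n, r) := \matrix_i w i.

(** Only diagonal weights matter, hence the choice X = 0. Weights d with the same d W restrict to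
    the same character of T, and distinct characters are independent, so each group of terms
    vanishes at g. *)
Lemma torus_parts p g : (forall t, T t -> mxeval p (g *m t) = 0) ->
  exists s : seq ('rV[int]_n * {mpoly k[n * n]}),
  [/\ forall x, x \in s -> torus_weight P 0 (fun=> 0) x.1 x.2, p = \sum_(x <- s) x.2 &
      forall e0, \sum_(x <- s | x.1 *m W == e0) mxeval x.2 g = 0].
Proof.
move=> H; have X0 (c : 'I_n) : exists N, (0 - (0 : k)%:M) ^+ N *m col c (invmx P) = 0.
  by exists 1%N; rewrite raddf0 subr0 expr1 mul0mx.
have [s [Hs ps]] := torus_weight_decomposition Pu (X := 0) (l := fun=> 0) X0 p.
exists s; split=> //; apply: (laurent_indep k0) => z zn.
have Tz : T (diagconj P (mact W z)).
  by rewrite TE; exists z => //; congr diagconj; apply/funext => i; rewrite /mact rowK.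
rewrite -[RHS](H _ Tz) ps mxeval_sum big_seq [RHS]big_seq; apply: eq_bigr => x xs.
have [Hx _ _] := Hs x xs; rewrite Hx; last exact: mact_nonvanishing.
rewrite mulrC; congr (_ * _).
by have := mact_mulmx x.1 W zn => /(congr1 (fun f => f 0)); rewrite /mact !row_id.
Qed.

Lemma torus_mxder p g l : (forall m : 'rV[int]_n, m *m W = 0 -> pairz l m = 0) ->
  (forall t, T t -> mxeval p (g *m t) = 0) -> mxeval (mxder (diagconj P l) p) g = 0.
Proof.
move=> Hl H; have [s [Hs ps Ws]] := torus_parts H.
rewrite ps mxder_sum mxeval_sum.
rewrite -[RHS](@sum_by_value_gen _ _ _ s (fun x => x.1 *m W) (fun x => mxeval x.2 g)
  (fun x => pairz l x.1) _ Ws).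
  rewrite big_seq [RHS]big_seq; apply: eq_bigr => x xs.
  by have [_ Hx _] := Hs x xs; rewrite Hx mxevalZ.
move=> x y xy; apply/eqP; rewrite -subr_eq0; apply/eqP.
rewrite -(Hl (x.1 - y.1)); last by rewrite mulmxBl xy subrr.
by rewrite -scaleN1r pairzD pairzZ mulN1r.
Qed.

(** The point x gives equal values to all weights with the same restriction to T, so an equation of
    T at x is a combination of the group sums of [torus_parts], which are zero. *)
Lemma torus_relations x : nonvanishing x -> (forall m : 'rV[int]_n, m *m W = 0 -> monz x m = 1) ->
  T (diagconj P x).
Proof.
move=> xn Hx; apply: (mem_zariski_closure TT); first exact: diagconj_unit.
move=> p Ip; have [|s [Hs ps Ws]] := @torus_parts p 1%:M.
  by move=> t Tt; rewrite mul1mx Ip.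
rewrite ps mxeval_sum -[RHS](@sum_by_value_gen _ _ _ s (fun x => x.1 *m W)
  (fun x => mxeval x.2 1%:M) (fun y => monz x y.1) _ Ws).
  rewrite big_seq [RHS]big_seq; apply: eq_bigr => y ys.
  by have [Hy _ _] := Hs y ys; rewrite -[diagconj _ _]mul1mx Hy.
move=> a b ab; have E1 : monz x (a.1 - b.1) = 1 by apply: Hx; rewrite mulmxBl ab subrr.
by have := monzD (a.1 - b.1) b.1 xn; rewrite subrK E1 mul1r.
Qed.

Definition upper u := graded P hh (fun d => 0 < d) (u - 1%:M).
Definition lower u := graded P hh (fun d => d < 0) (u - 1%:M).

Definition wordder (s : seq 'M[k]_n) p := foldr (@mxder k n) p s.

Lemma wordder_cat s t p : wordder (s ++ t) p = wordder s (wordder t p).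
Proof. by rewrite /wordder foldr_cat. Qed.

Lemma wordderB s p q : wordder s (p - q) = wordder s p - wordder s q.
Proof. by elim: s => //= X s ->; rewrite -scaleN1r mxderD mxderZ scaleN1r. Qed.

Lemma upper_line (pi : pred int) (u Y : 'M[k]_n) b : (forall a c : int, pi a -> pi c -> pi (a + c)) ->
  graded P hh pi Y -> graded P hh pi (u - 1%:M) -> graded P hh pi (u *m (1%:M + b *: Y) - 1%:M).
Proof.
move=> pi2 gY gu.
have -> : u *m (1%:M + b *: Y) - 1%:M = (u - 1%:M) + b *: ((u - 1%:M) *m Y + Y).
  rewrite mulmxBl mul1mx subrK mulmxDr mulmx1 -scalemxAr addrAC //.
apply: gradedD => //; apply: gradedZ; apply: gradedD => //.
exact: (gradedM Pu pi2).
Qed.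

Let graded1 (pi : pred int) : graded P hh pi (1%:M - 1%:M).
Proof. by move=> i j _; rewrite subrr /conjP mulmx0 mul0mx mxE. Qed.

Variable p0 : {mpoly k[n * n]}.
Hypothesis p0_cell : forall l t u, lower l -> T t -> upper u -> mxeval p0 (l *m t *m u) = 0.

Let phi s := mxeval (wordder s p0) 1%:M.
Let inL : pred 'M[k]_n := fun X => `[< lie_algebra G X >].

(** Derivations are applied from the right end of the word: those of c move the factor u, then with
    u = 1 those of b move t, and with t = 1 those of a move l. Each set LTU, LT, L is stable under
    the motions of its own stage. *)
Lemma sorted_word_vanish a b c :
  (forall X, X \in a -> lie_algebra G X /\ graded P hh (fun d => d < 0) X) ->
  (forall X, X \in b -> lie_algebra G X /\ graded P hh (pred1 0) X) ->
  (forall X, X \in c -> lie_algebra G X /\ graded P hh (fun d => 0 < d) X) ->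
  phi (a ++ b ++ c) = 0.
Proof.
move=> Ha Hb Hc; rewrite /phi !wordder_cat.
have H1 : forall l t u, lower l -> T t -> upper u -> mxeval (wordder c p0) (l *m t *m u) = 0.
  elim: c Hc => [//|Y c IH] Hc l t u Hl Tt Hu /=; apply: (mxder_line k0) => e.
  have [_ gY] := Hc _ (mem_head _ _).
  rewrite -(mulmxA (l *m t)); apply: IH => //; first by move=> X Xc; apply: Hc; rewrite inE Xc orbT.
  by apply: (@upper_line (fun d => 0 < d)) => // x y; exact: addr_gt0.
have H2 : forall l t, lower l -> T t -> mxeval (wordder b (wordder c p0)) (l *m t) = 0.
  elim: b Hb => [|Y b IH] Hb l t Hl Tt /=.
    by rewrite -[_ *m t]mulmx1; apply: H1 => //; exact: graded1.
  have [LY gY] := Hb _ (mem_head _ _).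
  have [th YE] := zero_weight_diagonal k0 Gs Tm root_ex fr fw sep LY gY.
  rewrite YE; apply: torus_mxder => [|t' Tt'].
    by apply: (zero_weight_relation k0 Gs Tm fr fw); rewrite -YE.
  rewrite -mulmxA; apply: IH => //; first by move=> X Xc; apply: Hb; rewrite inE Xc orbT.
  exact: (group_mul TT).
have H3 : forall l, lower l -> mxeval (wordder a (wordder b (wordder c p0))) l = 0.
  elim: a Ha => [|Y a IH] Ha l Hl /=.
    by rewrite -[l]mulmx1; apply: H2 => //; exact: (group_1 TT).
  have [_ gY] := Ha _ (mem_head _ _).
  apply: (mxder_line k0) => e; apply: IH; first by move=> X Xc; apply: Ha; rewrite inE Xc orbT.
  apply: (@upper_line (fun d => d < 0)) => // x y x0 y0; by rewrite -oppr_gt0 opprD addr_gt0 // oppr_gt0.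
exact/H3/graded1.
Qed.

Let Gcochar a : a != 0 -> G (diagconj P (fun i => a ^ hh i)).
Proof. by move=> an; apply: TG; exact: (cocharacter fr fw). Qed.

(** The sorting argument of Poincare-Birkhoff-Witt: modulo shorter words the letters commute, so
    each is split into its parts of negative, zero and positive degree, and these are moved to their
    blocks. *)
Lemma word_vanish s : all inL s -> phi s = 0.
Proof.
have [m] := ubnP (size s); elim: m s => // m IHm s; rewrite ltnS leq_eqVlt => /predU1P[sz|]; last exact: IHm.
have swap q x y s' : all inL (q ++ x :: y :: s') -> size (q ++ x :: y :: s') = m ->
    phi (q ++ x :: y :: s') = phi (q ++ y :: x :: s').
  rewrite all_cat /= => /and4P[Lq /asboolP Lx /asboolP Ly Ls]; rewrite size_cat /= => szq.
  apply/eqP; rewrite -subr_eq0 /phi; apply/eqP.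
  have E0 : phi (q ++ (x *m y - y *m x) :: s') = 0.
    apply: IHm; first by rewrite size_cat /=; lia.
    by rewrite all_cat /= Lq Ls andbT; apply/asboolP; exact: lie_bracket.
  rewrite -[RHS]E0 /phi !wordder_cat /= mxder_lie wordderB mxevalD mxevalN //.
(* Here s holds the letters still to be sorted; a, b and c collect the homogeneous parts already
   placed. *)
suff claim : forall s a b c, all inL s ->
  (forall X, X \in a -> lie_algebra G X /\ graded P hh (fun d => d < 0) X) ->
  (forall X, X \in b -> lie_algebra G X /\ graded P hh (pred1 0) X) ->
  (forall X, X \in c -> lie_algebra G X /\ graded P hh (fun d => 0 < d) X) ->
  size (s ++ a ++ b ++ c) = m -> phi (s ++ a ++ b ++ c) = 0.
  by move=> Ls; rewrite -[s]cats0; apply: (claim s [::] [::] [::]); rewrite ?cats0.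
elim=> [|X s' IH] a b c; first by move=> _ Ha Hb Hc _; rewrite cat0s (sorted_word_vanish Ha Hb Hc).
move=> /=/andP[/asboolP LX Ls] Ha Hb Hc szs.
have part_lie pi : lie_algebra G (gpart P hh pi X) by exact: gpart_lie.
have inLa (Q : 'M[k]_n -> Prop) t : (forall Y, Y \in t -> lie_algebra G Y /\ Q Y) -> all inL t.
  by move=> Ht; apply/allP => Y Yt; apply/asboolP; case: (Ht Y Yt).
have Lrest : all inL (s' ++ a ++ b ++ c) by rewrite !all_cat Ls (inLa _ _ Ha) (inLa _ _ Hb) (inLa _ _ Hc).
have move_to Y t t' : lie_algebra G Y -> s' ++ a ++ b ++ c = t ++ t' ->
    phi (Y :: s' ++ a ++ b ++ c) = phi (t ++ Y :: t').
  move=> LY tt; apply: (swap_perm swap (p := [::]) (s := Y :: s' ++ a ++ b ++ c)) => //=.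
  - by rewrite tt -[Y :: t']cat1s -[Y :: _]cat1s perm_sym perm_catCA.
  - by rewrite Lrest andbT; apply/asboolP.
have mem_cons_case (Q : 'M[k]_n -> Prop) Y t : Q Y -> (forall Z, Z \in t -> Q Z) ->
    forall Z, Z \in Y :: t -> Q Z.
  by move=> QY Qt Z; rewrite inE => /predU1P[->|/Qt].
have -> : phi ((X :: s') ++ a ++ b ++ c) = phi (gpart P hh (fun d => d < 0) X :: s' ++ a ++ b ++ c) +
    (phi (gpart P hh (pred1 0) X :: s' ++ a ++ b ++ c) +
     phi (gpart P hh (fun d => 0 < d) X :: s' ++ a ++ b ++ c)).
  rewrite /phi /= -!mxevalD; congr mxeval; rewrite {1}[X](gpart_parts Pu hh).
  have md Y Z q : mxder (Y + Z) q = mxder Y q + mxder Z q.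
    by rewrite -{1}[Y]scale1r mxder_scaleD scale1r.
  by rewrite !md.
rewrite (move_to _ s' (a ++ b ++ c))//.
rewrite (move_to _ (s' ++ a) (b ++ c) _ (catA _ _ _))//.
have cE : s' ++ a ++ b ++ c = (s' ++ a ++ b) ++ c by rewrite -!catA.
rewrite (move_to _ (s' ++ a ++ b) c _ cE)//.
have -> : s' ++ gpart P hh (fun d : int => d < 0) X :: a ++ b ++ c =
    s' ++ (gpart P hh (fun d : int => d < 0) X :: a) ++ b ++ c by [].
have -> : (s' ++ a) ++ gpart P hh (pred1 0) X :: b ++ c =
    s' ++ a ++ (gpart P hh (pred1 0) X :: b) ++ c by rewrite -catA.
have -> : (s' ++ a ++ b) ++ gpart P hh (fun d : int => 0 < d) X :: c =
    s' ++ a ++ b ++ (gpart P hh (fun d : int => 0 < d) X :: c) by rewrite -!catA.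
rewrite !IH ?addr0 //; try by move: szs; rewrite /= ?size_cat /= ?size_cat /=; lia.
- apply: mem_cons_case => //; split=> //; exact: graded_gpart.
- apply: mem_cons_case => //; split=> //; exact: graded_gpart.
- apply: mem_cons_case => //; split=> //; exact: graded_gpart.
Qed.

(* Density of the big cell: p0 is an arbitrary polynomial vanishing on it. *)
Lemma big_cell_dense : vanishing G p0.
Proof.
(* The polynomials all of whose iterated derivatives along Lie(G) vanish at 1: a space stable under
   [mxder], to which [mxexp_vanish] applies. *)
pose I q := forall s, all inL s -> mxeval (wordder s q) 1%:M = 0.
have IX X q : lie_algebra G X -> I q -> I (mxder X q).
  move=> LX Iq s Ls; rewrite -[mxder X q]/(wordder [:: X] q) -wordder_cat; apply: Iq.
  by rewrite all_cat Ls /= andbT; apply/asboolP.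
have Ig g : expgen (lie_algebra G) g -> forall q, I q -> mxeval q g = 0.
  elim=> [q Iq|g' X M _ IH LX XM q Iq]; first exact: (Iq [::]).
  rewrite -[X]scale1r; apply: (mxexp_vanish k0 (I := I)) => //.
  by move=> q'; exact: IX.
apply: (expgen_dense k0 GG Gs (A := lie_algebra G)) => //.
- by move=> c X; exact: lie_Z.
- by move=> g X; exact: lie_conj.
- have [X [LX nX Xn0 _]] := exists_nilpotent_root k0 Gs Tm root_ex fr fw sep.
  by exists X.
- by move=> g /Ig; apply=> s; exact: word_vanish.
Qed.

End Density.

(** * Cramer's rule on triangular decompositions *)

Section Compression.
Variables (k : fieldType) (n : nat) (P : 'M[k]_n) (Pu : P \in unitmx) (hh : 'I_n -> int).

(* pi g pi + (1 - pi) for the projector pi onto the coordinates of height at least c *)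
Definition compress (c : int) (g : 'M[k]_n) : 'M[k]_n :=
  \matrix_(a, b) if (c <= hh a) && (c <= hh b) then conjP P g a b else (a == b)%:R.

Lemma compressE c g a b : compress c g a b =
  if (c <= hh a) && (c <= hh b) then conjP P g a b else (a == b)%:R.
Proof. by rewrite [LHS]mxE. Qed.

Lemma compressM c x y : graded P hh (fun d => d <= 0) x \/ graded P hh (fun d => 0 <= d) y ->
  compress c (x *m y) = compress c x *m compress c y.
Proof.
move=> gxy; apply/matrixP => a b; rewrite compressE [RHS]mxE.
case ha : (c <= hh a) => /=.
  case hb : (c <= hh b) => /=.
    rewrite conjPM// mxE; apply: eq_bigr => e _; rewrite !compressE ha hb andbT /=.
    case he : (c <= hh e) => //; case: gxy => [gx|gy].
      rewrite (gx a e) ?mul0r; last by move: ha he; lia.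
      case: (a =P e) => [ae|_]; last by rewrite mul0r.
      by move: he; rewrite -ae ha.
    rewrite (gy e b) ?mulr0; last by move: hb he; lia.
    case: (e =P b) => [eb|_]; last by rewrite mulr0.
    by move: he; rewrite eb hb.
  rewrite (bigD1 b) //= !compressE hb eqxx andbF mulr1 big1 ?addr0// => e /negPf eb.
  by rewrite !compressE hb andbF eb mulr0.
rewrite (bigD1 a) //= !compressE ha eqxx mul1r big1 ?addr0// => e; rewrite eq_sym => /negPf ae.
by rewrite !compressE ha /= ae mul0r.
Qed.

Lemma compress1 c : compress c 1%:M = 1%:M.
Proof. by apply/matrixP => a b; rewrite compressE conjP1// !mxE if_same. Qed.

Lemma polyfun_compress c a b : polyfun (fun g : 'M[k]_n => compress c g a b).
Proof.
case ab : ((c <= hh a) && (c <= hh b)).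
  apply: (@eq_polyfun _ _ (fun g => conjP P g a b)) => [g|]; first by rewrite compressE ab.
  apply: polyfun_mulmx => [i j|i j]; last exact: polyfun_const.
  by apply: polyfun_mulmx => [i' j'|i' j']; [exact: polyfun_const|exact: polyfun_entry].
by apply: eq_polyfun (polyfun_const _ (a == b)%:R) => g; rewrite compressE ab.
Qed.

Lemma graded_neg_nilpotent X : graded P hh (fun d => d < 0) X -> nilpotent_mx X.
Proof.
move=> gX; pose B := (\sum_i `|hh i|)%N.
have hB i : (`|hh i| <= B)%N by rewrite /B (bigD1 i) //= leq_addr.
have gXm m : graded P hh (fun d => d <= - m%:Z) (X ^+ m).
  elim: m => [|m IH].
    move=> i j; rewrite expr0 conjP1// mxE; case: (i =P j) => [->|//].
    by rewrite subrr oppr0 lexx.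
  rewrite exprS; apply: (gradedM Pu _ gX IH) => a b /= ha hb; lia.
exists (2 * B).+1; apply: (conjP_inj Pu); apply/matrixP => i j.
rewrite gXm /=; first by rewrite /conjP mulmx0 mul0mx mxE.
have := hB i; have := hB j; lia.
Qed.

Lemma lower_unit l : graded P hh (fun d => d < 0) (l - 1%:M) -> l \in unitmx.
Proof.
move=> /graded_neg_nilpotent /unipotent_unit.
by rewrite addrC subrK.
Qed.

(* The last block of the adjugate of a compression only sees the diagonal part of an
   LTU decomposition. *)
Lemma compress_adj l tau u i j : graded P hh (fun d => d < 0) (l - 1%:M) ->
  graded P hh (fun d => 0 < d) (u - 1%:M) -> hh i = hh j ->
  let M := compress (hh i) (l *m diagconj P tau *m u) in
  tau i * (\adj M) i j = \det M *+ (i == j).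
Proof.
move=> gl gu hij M.
have entry x a b : conjP P x a b = conjP P (x - 1%:M) a b + (a == b)%:R.
  have -> : conjP P x = conjP P (x - 1%:M) + 1%:M by rewrite -(conjP1 Pu) -conjPD conjP1// subrK.
  by rewrite [LHS]mxE [X in _ + X = _]mxE.
have gt : graded P hh (fun d => 0 <= d) (diagconj P tau).
  move=> a b; rewrite conjP_diagconj// diagzE; case: eqP => [->|//].
  by rewrite subrr lexx.
have gu' : graded P hh (fun d => 0 <= d) u.
  move=> a b ab; rewrite entry gu; last by move: ab; lia.
  by rewrite add0r; case: (a =P b) ab => [->|//]; rewrite subrr lexx.
have gl' : graded P hh (fun d => d <= 0) l.
  move=> a b ab; rewrite entry gl; last by move: ab; lia.
  by rewrite add0r; case: (a =P b) ab => [->|//]; rewrite subrr lexx.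
pose L := compress (hh i) l; pose D := compress (hh i) (diagconj P tau); pose U := compress (hh i) u.
have ME : M = L *m (D *m U).
  by rewrite /M compressM; [rewrite compressM ?mulmxA//; left|right].
have Lu : L \in unitmx.
  have : L *m compress (hh i) (invmx l) = 1%:M.
    by rewrite -compressM; [rewrite mulmxV ?compress1//; exact: lower_unit|left].
  by case/mulmx1_unit.
(* Index j has the least height kept by the compression, so column j of L, and likewise row i of U,
   coincides with that of the identity. *)
have Lj : L *m delta_mx j 0 = delta_mx j 0 :> 'cV_n.
  apply/colP => a; rewrite -colE [LHS]mxE compressE [RHS]mxE eqxx andbT; case: ifP => // /andP[ia _].
  rewrite entry gl ?add0r//; move: ia; rewrite hij; lia.
have Ui : delta_mx 0 i *m U = delta_mx 0 i :> 'rV_n.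
  apply/rowP => a; rewrite -rowE [LHS]mxE compressE [RHS]mxE eqxx /= eq_sym; case: ifP => // /andP[_ ia].
  rewrite entry gu ?add0r ?[i == a]eq_sym//; move: ia; lia.
have Di : delta_mx 0 i *m D = tau i *: delta_mx 0 i :> 'rV_n.
  apply/rowP => a; rewrite -rowE [LHS]mxE compressE [RHS]mxE [X in _ = _ * X]mxE eqxx /=.
  case: ifP => [_|]; last first.
    by rewrite lexx /=; case: (a =P i) => [->|_]; rewrite ?lexx// eq_sym; case: eqP => [->|]; rewrite ?lexx ?mulr0.
  rewrite conjP_diagconj// diagzE; case: (i =P a) => [<-|/eqP ia]; first by rewrite eqxx mulr1.
  by rewrite eq_sym (negPf ia) mulr0.
have E : L *m (D *m U *m (\adj M *m delta_mx j 0)) = L *m (\det M *: delta_mx j 0 : 'cV_n).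
  rewrite -scalemxAr Lj !mulmxA -(mulmxA L) -ME mul_mx_adj mul_scalar_mx //.
have {}E := can_inj (mulKmx Lu) E.
have := congr1 (fun v : 'cV_n => (delta_mx 0 i *m v : 'M_1) 0 0) E.
have ent (B : 'M[k]_n) : (delta_mx 0 i *m B *m delta_mx j 0 : 'M_1) 0 0 = B i j.
  by rewrite -rowE -colE [LHS]mxE [LHS]mxE.
rewrite !mulmxA Di -!scalemxAl Ui -[X in X -> _]/(_ = _) [X in X = _]mxE ent => ->.
by rewrite -scalemxAr -rowE !mxE eqxx andbT mulr_natr.
Qed.

End Compression.

Section CentralizerOfTorus.
Variables (k : closedFieldType) (k0 : [pchar k] =i pred0) (n : nat) (G T : set 'M[k]_n).
Hypotheses (Gs : simple_algebraic_group G) (Tm : maximal_torus G T).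
Hypothesis root_ex : exists alpha, group_root G T alpha.

(** On the cell, Cramer's rule for the compressions recovers the torus factor: z^(w_i) times the
    adjugate entry (i, j) is the determinant times delta_ij, within a block of equal height.
    Polynomial consequences free of z extend to y by density. Since y commutes with T, its
    compressions compute y^-1, which is therefore diagonal and satisfies the relations between the
    weights. *)
Lemma maximal_torus_self_centralizing y : G y -> (forall t, T t -> comm_mx y t) -> T y.
Proof.
have GG : algebraic_group G by case: Gs.
have [torT TG _] := Tm; have [TT _] := torT.
have [r [E [A fr]]] := torus_frame_exists k0 torT.
have [||P [l [w [fw _]]]] := framed_exists fr (S := 0); first exact: diagonalizable0.
  by move=> e _; rewrite /comm_mx mul0mx mulmx0.
have [Pu _ _] := fw.
pose ds := [seq d <- [seq w x.1 - w x.2 | x <- index_enum ('I_n * 'I_n)%type] | d != 0].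
have [h Hh] := @exists_separating r ds
  (fun d => fun ds => proj1 (andP (etrans (esym (mem_filter _ _ _)) ds))).
have sep i j : w i != w j -> ((w i - w j) *m h) 0 0 != 0.
  move=> wij; apply: Hh; rewrite mem_filter subr_eq0 wij.
  by apply/mapP; exists (i, j) => //; exact: mem_index_enum.
pose hh i : int := (w i *m h) 0 0.
have heq i j : (hh i == hh j) = (w i == w j) := hh_eq sep i j.
move=> Gy cy; have yu := group_unit GG Gy.
have dense F : polyfun F ->
    (forall l t u, lower P w h l -> T t -> upper P w h u -> F (l *m t *m u) = 0) -> F y = 0.
  move=> [p pE] Hp; rewrite pE.
  apply: (big_cell_dense k0 Gs Tm root_ex fr fw sep (p0 := p)) => // l' t u Hl Tt Hu.
  by rewrite -pE Hp.
have cmpF := polyfun_compress P hh.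
have cell l' t u : lower P w h l' -> T t -> upper P w h u ->
    exists2 z, nonvanishing z & forall i j, hh i = hh j ->
      monz z (w i) * (\adj (compress P hh (hh i) (l' *m t *m u))) i j =
      \det (compress P hh (hh i) (l' *m t *m u)) *+ (i == j).
  move=> Hl; rewrite (framed_torusE fr fw) => -[z zn <-] Hu; exists z => // a b hab.
  exact: (@compress_adj _ _ _ Pu hh l' (fun i => monz z (w i))).
have yinv : graded P hh (pred1 0) (invmx y).
  apply: (centralizes_graded k0 fr fw (h := h)) => t Tt.
  have ct := cy t Tt; rewrite /comm_mx -[RHS]mul1mx -(mulVmx yu) -!mulmxA; congr (_ *m _).
  by rewrite [y *m (t *m _)]mulmxA ct -mulmxA mulmxV// mulmx1.
pose x i := conjP P (invmx y) i i.
have adjy i j : hh i = hh j ->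
    (\adj (compress P hh (hh i) y)) i j = \det (compress P hh (hh i) y) * conjP P (invmx y) i j.
  move=> hij; set M := compress _ _ _ y.
  have MM : M *m compress P hh (hh i) (invmx y) = 1%:M.
    rewrite -compressM//; last by right=> a b /= ab; apply: yinv; apply: contra ab => /eqP ->.
    by rewrite mulmxV// compress1.
  rewrite -[\adj M]mulmx1 -MM mulmxA mul_adj_mx mul_scalar_mx [LHS]mxE compressE -hij lexx.
  by [].
have dety i : \det (compress P hh (hh i) y) != 0.
  have MM : compress P hh (hh i) y *m compress P hh (hh i) (invmx y) = 1%:M.
    rewrite -compressM//; last by right=> a b /= ab; apply: yinv; apply: contra ab => /eqP ->.
    by rewrite mulmxV// compress1.
  by have [+ _] := mulmx1_unit MM; rewrite unitmxE unitfE.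
(* Entries between different heights vanish because y centralizes T; within a block, the
   off-diagonal adjugate entries vanish on the cell, hence at y. *)
have yE : conjP P (invmx y) = diagz x.
  apply/matrixP => i j; rewrite diagzE; case: (i =P j) => [->//|/eqP ij].
  have [hij|hij] := eqVneq (hh i) (hh j); last by apply: yinv; rewrite /= subr_eq0.
  apply: (mulfI (dety i)); rewrite -adjy// mulr0.
  apply: (dense (fun g => (\adj (compress P hh (hh i) g)) i j)).
    by apply: polyfun_adj => a b; exact: cmpF.
  move=> l' t u Hl Tt Hu; have [z zn H] := cell l' t u Hl Tt Hu.
  have /eqP := H i j hij; rewrite (negPf ij) mulr0n mulf_eq0 (negPf (monz_neq0 _ zn)).
  by move/eqP.
have xn : nonvanishing x.
  by apply/diagz_unit; rewrite -yE !unitmx_mul unitmx_inv unitmx_inv Pu yu.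
suff : T (invmx y) by move/(group_inv TT); rewrite invmxK.
rewrite -(conjPK Pu (invmx y)) yE; apply: (torus_relations k0 Tm fr fw) => // m mW.
apply/(monz_eq1 _ xn).
pose d i g := \det (compress P hh (hh i) g); pose a i g := (\adj (compress P hh (hh i) g)) i i.
have ady i : a i y = d i y * x i by exact: adjy.
(* Denominator-free form of the relation prod (d_i / a_i)^(m_i) = 1. On the cell d_i = z^(w_i) a_i,
   so it comes down to m W = 0, even where some a_i vanishes. *)
have F0 : \prod_i (d i y ^+ pos_part (m 0 i) * a i y ^+ neg_part (m 0 i)) -
    \prod_i (d i y ^+ neg_part (m 0 i) * a i y ^+ pos_part (m 0 i)) = 0.
  apply: (dense (fun g => \prod_i (d i g ^+ pos_part (m 0 i) * a i g ^+ neg_part (m 0 i)) -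
    \prod_i (d i g ^+ neg_part (m 0 i) * a i g ^+ pos_part (m 0 i)))).
    have pd i : polyfun (d i) by apply: polyfun_det => b c; exact: cmpF.
    have pa i : polyfun (a i) by apply: polyfun_adj => b c; exact: cmpF.
    by apply: polyfunD; [|apply: polyfunN]; apply: polyfun_prod => i; apply: polyfunM;
      apply: polyfunX.
  move=> l' t u Hl Tt Hu.
  have [z zn H] : exists2 z, nonvanishing z & forall i, monz z (w i) * a i (l' *m t *m u) = d i (l' *m t *m u).
    have [z zn H] := cell l' t u Hl Tt Hu.
    by exists z => // i; rewrite [LHS]H// eqxx.
  apply/eqP; rewrite subr_eq0; apply/eqP.
  under eq_bigr do rewrite -H exprMn -mulrA -exprD addnC.
  under [RHS]eq_bigr do rewrite -H exprMn -mulrA -exprD.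
  rewrite !big_split /=; congr (_ * _).
  apply/monz_eq1; first by move=> i; exact: monz_neq0.
  have := mact_mulmx m (\matrix_i w i) zn => /(congr1 (fun f => f 0)).
  rewrite /mact !row_id mW monz0 => ->; congr (monz _ _); apply/funext => i.
  by rewrite rowK.
move/eqP: F0; rewrite subr_eq0 => /eqP.
under eq_bigr do rewrite ady exprMn mulrA -exprD.
under [RHS]eq_bigr do rewrite ady exprMn mulrA -exprD addnC.
rewrite !big_split /= => /mulfI H; symmetry; apply: H.
by apply/prodf_neq0 => i _; rewrite expf_neq0// dety.
Qed.

End CentralizerOfTorus.

(** * The root system *)

Section F4Vectors.
Import F4Roots.

Definition vcoord (v : vec) (i : 'I_4) : BinNums.Z :=
  let: (x0, x1, x2, x3) := v in nth x3 [:: x0; x1; x2] i.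
Definition mkvec (z : 'I_4 -> BinNums.Z) : vec :=
  (z (@Ordinal 4 0 isT), z (@Ordinal 4 1 isT), z (@Ordinal 4 2 isT), z (@Ordinal 4 3 isT)).
(** The division by 2 undoes the doubling of coordinates made for the integer computations. *)
Definition toR (v : vec) : 'rV[rat]_4 := \row_i ((int_of_Z (vcoord v i))%:~R / 2%:R).

Lemma ord4_case (Q : 'I_4 -> Prop) : Q (@Ordinal 4 0 isT) -> Q (@Ordinal 4 1 isT) ->
  Q (@Ordinal 4 2 isT) -> Q (@Ordinal 4 3 isT) -> forall i, Q i.
Proof.
move=> Q0 Q1 Q2 Q3 [[|[|[|[|i]]]] Hi] //.
- by rewrite (bool_irrelevance Hi isT).
- by rewrite (bool_irrelevance Hi isT).
- by rewrite (bool_irrelevance Hi isT).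
- by rewrite (bool_irrelevance Hi isT).
Qed.

Lemma vcoord_mkvec z i : vcoord (mkvec z) i = z i.
Proof. by move: i; apply: ord4_case. Qed.

Lemma toRD v w : toR (vadd v w) = toR v + toR w.
Proof.
apply/rowP => i; rewrite !mxE -mulrDl -intrD -rmorphD; congr ((int_of_Z _)%:~R / _).
move: v w i => [[[? ?] ?] ?] [[[? ?] ?] ?]; exact: ord4_case.
Qed.

Lemma toRZ z v : toR (vscale z v) = (int_of_Z z)%:~R *: toR v.
Proof.
apply/rowP => i; rewrite !mxE mulrA -intrM -rmorphM; congr ((int_of_Z _)%:~R / _).
move: v i => [[[? ?] ?] ?]; exact: ord4_case.
Qed.

Lemma toRB v w : toR (vsub v w) = toR v - toR w.
Proof. by rewrite toRD toRZ scaleN1r. Qed.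

Lemma toR_inj : injective toR.
Proof.
move=> v w /rowP E.
have E' i : vcoord v i = vcoord w i.
  have := E i; rewrite !mxE => /(mulIf _) H; apply: (can_inj int_of_ZK).
  by apply/(@intr_inj rat)/H; rewrite invr_eq0.
have := E' (@Ordinal 4 0 isT); have := E' (@Ordinal 4 1 isT).
have := E' (@Ordinal 4 2 isT); have := E' (@Ordinal 4 3 isT).
by case: v w {E E'} => [[[? ?] ?] ?] [[[? ?] ?] ?] /= -> -> -> ->.
Qed.

Definition sgnZ (b : bool) (z : BinNums.Z) : BinNums.Z := if b then BinInt.Z.opp z else z.
Definition short_vec (b : bool) (i : 'I_4) : vec :=
  mkvec (fun j => if j == i then sgnZ b 2 else 0).
Definition long_vec (b c : bool) (i j : 'I_4) : vec := vadd (short_vec b i) (short_vec c j).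
Definition half_vec (b : 'I_4 -> bool) : vec := mkvec (fun j => sgnZ (b j) 1).

Lemma toR_short b i : toR (short_vec b i) = (-1) ^+ b *: delta_mx 0 i.
Proof.
apply/rowP => j; rewrite !mxE vcoord_mkvec eqxx /=; case: eqP => _; last by rewrite mulr0 mul0r.
by case: b.
Qed.

Lemma toR_half b : toR (half_vec b) = \row_i ((-1) ^+ b i / 2%:R).
Proof.
by apply/rowP => j; rewrite !mxE vcoord_mkvec; case: (b j).
Qed.

Lemma F4_root_toR v : F4_root_system v <-> exists2 x, List.In x roots & v = toR x.
Proof.
split.
- case=> [[|]|].
  + move=> [b [i ->]]; exists (short_vec b i); last by rewrite toR_short.
    by apply/isrootP; case: b; move: i; apply: ord4_case.
  + move=> [b [c [i [j [ij ->]]]]]; exists (long_vec b c i j); last by rewrite toRD !toR_short.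
    apply/isrootP; move: i j ij; apply: ord4_case => //; apply: ord4_case => //; case: b; case: c => //.
  + move=> [b ->]; exists (half_vec b); last by rewrite toR_half.
    apply/isrootP; rewrite /half_vec /mkvec.
    by case: (b _); case: (b _); case: (b _); case: (b _).
- move=> [x xr ->].
  pose ords := [:: @Ordinal 4 0 isT; @Ordinal 4 1 isT; @Ordinal 4 2 isT; @Ordinal 4 3 isT].
  pose bools := [:: true; false].
  pose bfun (s : seq bool) (i : 'I_4) := nth false s i.
  pose P x := has (fun b => has (fun i => veqb x (short_vec b i)) ords) bools ||
    (has (fun b => has (fun c => has (fun i => has (fun j =>
       (i != j) && veqb x (long_vec b c i j)) ords) ords) bools) bools ||
    has (fun a => has (fun b => has (fun c => has (fun d =>
       veqb x (half_vec (bfun [:: a; b; c; d]))) bools) bools) bools) bools).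
  have allP : List.forallb P roots = true by vm_compute.
  have := proj1 (List.forallb_forall _ _) allP x xr; rewrite /P => /or3P[].
  + move=> /hasP[b _ /hasP[i _ /veqbP ->]]; left; left; exists b, i; exact: toR_short.
  + move=> /hasP[b _ /hasP[c _ /hasP[i _ /hasP[j _ /andP[ij /veqbP ->]]]]].
    by left; right; exists b, c, i, j; rewrite toRD !toR_short.
  + move=> /hasP[a _ /hasP[b _ /hasP[c _ /hasP[d _ /veqbP ->]]]].
    by right; exists (bfun [:: a; b; c; d]); rewrite toR_half.
Qed.

End F4Vectors.

(** * Characters and the Weyl group *)

Section Characters.
Variables (k : fieldType) (n : nat) (T : set 'M[k]_n) (TG : algebraic_group T).
Implicit Types (chi psi : 'M[k]_n -> k) (s t g : 'M[k]_n).

Let Tu : forall t, T t -> t \in unitmx.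
Proof. by move=> t /(group_unit TG). Qed.

Lemma character1 chi : character T chi -> chi 1%:M = 1.
Proof.
move=> [_ chi0 chiM]; have T1 := group_1 TG.
by apply: (mulfI (chi0 _ T1)); rewrite -chiM// mulmx1 mulr1.
Qed.

Lemma characterV chi t : character T chi -> T t -> chi (invmx t) = (chi t)^-1.
Proof.
move=> Cchi Tt; have [_ chi0 chiM] := Cchi.
by apply: (mulfI (chi0 _ Tt)); rewrite -chiM ?mulmxV ?Tu ?mulfV ?chi0 ?character1//; apply: group_inv.
Qed.

Lemma group_exp t m : T t -> T (t ^+ m).
Proof.
move=> Tt; elim: m => [|m IH]; first exact: (group_1 TG).
by rewrite exprS; exact: (group_mul TG).
Qed.

Lemma character_exp chi t m : character T chi -> T t -> chi (t ^+ m) = chi t ^+ m.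
Proof.
move=> C Tt; elim: m => [|m IH]; first exact: character1.
by rewrite !exprS -IH; case: C => _ _ M; apply: M => //; exact: group_exp.
Qed.

Lemma regular_subst chi (A : 'M[k]_n -> 'M[k]_n) : (forall i j, polyfun (fun t => A t i j)) ->
  (forall t, T t -> \det (A t) = \det t) -> (forall t, T t -> T (A t)) ->
  regular_on T chi -> regular_on T (fun t => chi (A t)).
Proof.
move=> PA dA TA [p [m pE]]; have [q qE] : polyfun (fun t => mxeval p (A t)).
  by apply: polyfun_comp => //; exists p.
by exists q, m => t Tt; rewrite pE ?dA ?qE//; apply: TA.
Qed.

Lemma regular_subst_inv chi : regular_on T chi -> regular_on T (fun t => chi (invmx t)).
Proof.
move=> [p [m pE]]; have [q [N qE]] := mxeval_invmx p.
have [d dE] := polyfun_det (@polyfun_entry k n).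
apply: (eq_regular (f := fun t => mxeval q t / \det t ^+ N * mxeval (d ^+ m) t)) => [t Tt|].
  have dt : \det t != 0 by rewrite -unitfE -unitmxE Tu.
  rewrite (pE _ (group_inv TG Tt)) qE ?Tu// mxevalX -dE det_inv exprVn invrK.
  by rewrite [_ * mxeval p _]mulrC mulfK ?expf_neq0.
apply: regularM; [by exists q, N|].
by exists (d ^+ m), 0%N => t _; rewrite expr0 divr1.
Qed.

Lemma character_const1 : character T (fun=> 1).
Proof. by split=> *; [exact: regular_const|rewrite oner_eq0|rewrite mulr1]. Qed.

Lemma characterM chi psi : character T chi -> character T psi -> character T (fun t => chi t * psi t).
Proof.
move=> [R1 N1 M1] [R2 N2 M2]; split=> [|t Tt|s t Ts Tt]; first exact: regularM.
- by rewrite mulf_neq0 ?N1 ?N2.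
- by rewrite M1// M2// mulrACA.
Qed.

Lemma characterX chi (z : int) : character T chi -> character T (fun t => chi t ^ z).
Proof.
move=> C; have [R N M] := C; split=> [|t Tt|s t Ts Tt].
- apply: (@regular_exprz _ _ _ chi (fun t => chi (invmx t))) => // [t Tt|].
    by rewrite characterV.
  exact: regular_subst_inv.
- by rewrite expfz_neq0 ?N.
- by rewrite M// expfzMl.
Qed.

Lemma character_prod (I : Type) (r : seq I) (chi : I -> 'M[k]_n -> k) :
  (forall i, character T (chi i)) -> character T (fun t => \prod_(i <- r) chi i t).
Proof.
move=> C; split=> [|t Tt|s t Ts Tt].
- by apply: regular_prod => // i; case: (C i).
- by apply: (big_ind (fun x : k => x != 0)) => [|x y x0 y0|i _]; [exact: oner_neq0|exact: mulf_neq0|case: (C i) => _ /(_ _ Tt)].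
- by rewrite -big_split; apply: eq_bigr => i _; case: (C i) => _ _ /(_ _ _ Ts Tt).
Qed.

Definition conj_by (g t : 'M[k]_n) : 'M[k]_n := invmx g *m t *m g.

Lemma conj_byM g t s : g \in unitmx -> conj_by g (t *m s) = conj_by g t *m conj_by g s.
Proof. by move=> gu; rewrite /conj_by -!mulmxA (mulmxA g) mulmxV// mul1mx. Qed.

Lemma invmxM g h : g \in unitmx -> h \in unitmx -> invmx (g *m h) = invmx h *m invmx g.
Proof.
move=> gu hu; have ghu : g *m h \in unitmx by rewrite unitmx_mul gu.
by apply: (can_inj (mulKmx ghu)); rewrite mulmxV// mulmxA mulmxK// mulmxV.
Qed.

Lemma conj_by_comp g h t : g \in unitmx -> h \in unitmx ->
  conj_by (g *m h) t = conj_by h (conj_by g t).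
Proof. by move=> gu hu; rewrite /conj_by invmxM// !mulmxA. Qed.

End Characters.

Section Twists.
Variables (k : fieldType) (n : nat) (G T : set 'M[k]_n).
Hypotheses (GG : algebraic_group G) (TT : torus T) (TG : T `<=` G).
Implicit Types (chi psi : 'M[k]_n -> k) (s t g : 'M[k]_n).

Let Ta : algebraic_group T.
Proof. by case: TT. Qed.

Lemma torus_separates s t : T s -> T t -> (forall chi, character T chi -> chi s = chi t) -> s = t.
Proof.
move=> Ts Tt H; case: TT => _ [r [phi [psi [[phiT phiM phiR] _ psiK _]]]].
rewrite -[s]psiK// -[t]psiK//; congr psi.
have D u : T u -> exists2 z, nonvanishing z & phi u = diagz z by move=> /phiT/diagonal_groupP.
have [z zn zE] := D s Ts; have [w wn wE] := D t Tt; rewrite zE wE; apply/matrixP => i j.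
rewrite !diagzE; case: eqP => // _.
have : (fun t => phi t i i) s = (fun t => phi t i i) t.
  apply: (H (fun t => phi t i i)); split=> [|u Tu|u v Tu Tv]; first exact: phiR.
    by have [x xn ->] := D u Tu; rewrite diagzE eqxx.
  have [x xn xE] := D u Tu; have [y yn yE] := D v Tv.
  by rewrite phiM// xE yE diagzM !diagzE eqxx.
by rewrite /= zE wE !diagzE eqxx.
Qed.

Lemma torus_comm s t : T s -> T t -> s *m t = t *m s.
Proof.
move=> Ts Tt; apply: torus_separates => [||chi [_ _ chiM]]; try exact: group_mul.
by rewrite !chiM// mulrC.
Qed.

Lemma normalizer_unit g : normalizer G T g -> g \in unitmx.
Proof. by case=> /(group_unit GG). Qed.

Lemma normalizer_conj g t : normalizer G T g -> T t -> T (conj_by g t).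
Proof.
move=> Ng; have gu := normalizer_unit Ng; case: Ng => _ gT.
rewrite -{1}gT => -[s Ts <-]; rewrite /conj_by -!mulmxA mulVmx// mulmx1 mulmxA mulVmx//.
by rewrite mul1mx.
Qed.

Lemma conj_by_inv g t : g \in unitmx -> conj_by g (g *m t *m invmx g) = t.
Proof. by move=> gu; rewrite /conj_by !mulmxA mulVmx// mul1mx -mulmxA mulVmx// mulmx1. Qed.

Lemma conj_by_comm h t : h \in unitmx -> conj_by h t = t -> comm_mx h t.
Proof. by move=> hu E; rewrite /comm_mx -{1}E /conj_by !mulmxA mulmxV// mul1mx. Qed.

Lemma comm_conj_by h t : h \in unitmx -> comm_mx h t -> conj_by h t = t.
Proof. by move=> hu E; rewrite /conj_by -mulmxA -E mulKmx. Qed.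

Lemma normalizer_conj_surj g s : normalizer G T g -> T s -> exists2 t, T t & conj_by g t = s.
Proof.
move=> Ng Ts; exists (g *m s *m invmx g); last by rewrite conj_by_inv// normalizer_unit.
by case: Ng => _ <-; exists s.
Qed.

Lemma normalizer_mul g h : normalizer G T g -> normalizer G T h -> normalizer G T (g *m h).
Proof.
move=> Ng Nh; have gu := normalizer_unit Ng; have hu := normalizer_unit Nh.
split; first by apply: group_mul => //; [case: Ng|case: Nh].
rewrite invmxM//; apply/seteqP; split=> [_ [t Tt <-]|t Tt].
  case: Ng => _ <-; exists (h *m t *m invmx h); last by rewrite !mulmxA.
  by case: Nh => _ <-; exists t.
exists (conj_by (g *m h) t); last first.
  by rewrite /conj_by invmxM// !mulmxA !(mulmxK hu) !mulmxK// mulmxV// mul1mx.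
by rewrite conj_by_comp//; do 2! apply: normalizer_conj => //.
Qed.

Lemma torus_normalizer t : T t -> normalizer G T t.
Proof.
move=> Tt; have tu := group_unit Ta Tt; split; first exact: TG.
apply/seteqP; split=> [_ [s Ts <-]|s Ts].
  exact: (group_mul Ta (group_mul Ta Tt Ts) (group_inv Ta Tt)).
by exists s => //; rewrite (torus_comm Tt Ts) mulmxK.
Qed.

Lemma conj_by_torus s t : T s -> T t -> conj_by s t = t.
Proof.
by move=> Ts Tt; rewrite /conj_by -mulmxA (torus_comm Tt Ts) mulmxA mulVmx ?mul1mx// (group_unit Ta Ts).
Qed.

Lemma polyfun_conj_by g i j : polyfun (fun t => conj_by g t i j).
Proof.
rewrite /conj_by; apply: polyfun_mulmx; last by move=> ? ?; exact: polyfun_const.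
by apply: polyfun_mulmx => ? ?; [exact: polyfun_const|exact: polyfun_entry].
Qed.

Lemma character_twist g chi : normalizer G T g -> character T chi -> character T (chi \o conj_by g).
Proof.
move=> Ng [R N M]; have gu := normalizer_unit Ng; split=> [|t Tt|s t Ts Tt].
- apply: regular_subst => //; [exact: polyfun_conj_by| |by move=> t; exact: normalizer_conj].
  move=> t Tt; rewrite /conj_by !det_mulmx det_inv mulrAC mulVf ?mul1r//.
  by rewrite -unitfE -unitmxE.
- by apply: N; apply: normalizer_conj.
- by rewrite /= conj_byM// M//; apply: normalizer_conj.
Qed.

Lemma root_twist g alpha : normalizer G T g -> group_root G T alpha ->
  group_root G T (alpha \o conj_by g).
Proof.
move=> Ng [C NE [X X0 [LX HX]]]; have gu := normalizer_unit Ng; split.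
- exact: character_twist.
- by move=> E; apply: NE => s Ts; have [t Tt <-] := normalizer_conj_surj Ng Ts; exact: E.
exists (g *m X *m invmx g).
  move=> E; apply: X0; rewrite -(conj_by_inv X gu) E /conj_by mulmx0 mul0mx//.
split; first by apply: lie_conj => //; case: Ng.
move=> t Tt; have := HX _ (normalizer_conj Ng Tt); rewrite /comp => E.
have tu := group_unit Ta Tt.
rewrite [RHS]scalemxAl scalemxAr -E /conj_by !invmxM ?unitmx_mul ?unitmx_inv ?gu ?tu//.
by rewrite invmxK !mulmxA mulmxV// mul1mx mulmxK.
Qed.

End Twists.

Section CharacterCoordinates.
Variables (k : fieldType) (n : nat) (T : set 'M[k]_n) (Ta : algebraic_group T) (V : lmodType rat).
Variables (f : ('M[k]_n -> k) -> V).
Hypotheses (fM : forall chi psi, character T chi -> character T psi ->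
  f (fun t => chi t * psi t) = f chi + f psi).
Hypotheses (fE : forall chi psi, character T chi -> character T psi ->
  f chi = f psi <-> eq_character T chi psi).

Lemma coord_const1 : f (fun=> 1) = 0.
Proof.
have C := character_const1 T; apply: (addrI (f (fun=> 1))); rewrite addr0 -fM//.
by apply/fE => //; [exact: characterM|move=> t _ /=; rewrite mulr1].
Qed.

Lemma coordX chi (z : int) : character T chi -> f (fun t => chi t ^ z) = z%:~R *: f chi.
Proof.
move=> C; have CX m := characterX Ta m C.
have H (m : nat) : f (fun t => chi t ^ (m%:Z : int)) = m%:R *: f chi.
  elim: m => [|m IH]; first by rewrite scale0r -coord_const1.
  rewrite -[m.+1%:R]natr1 scalerDl scale1r -IH -fM//; apply/fE => //; first exact: characterM.
  by move=> t _; rewrite /= -!exprnP exprSr.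
case: z => m; first exact: H.
rewrite NegzE mulrNz scaleNr -(H m.+1); apply/eqP; rewrite -addr_eq0 -fM//; apply/eqP.
rewrite -coord_const1; apply/fE => //; [exact: characterM|exact: character_const1|].
by move=> t Tt; case: C => _ N _; rewrite -expfzDr ?N// addNr.
Qed.

Lemma coord_prod (I : Type) (r : seq I) (chi : I -> 'M[k]_n -> k) :
  (forall i, character T (chi i)) -> f (fun t => \prod_(i <- r) chi i t) = \sum_(i <- r) f (chi i).
Proof.
move=> C; elim: r => [|i r IH].
  rewrite big_nil -coord_const1; apply/fE => [||t _]; rewrite ?big_nil//; last exact: character_const1.
  exact: character_prod.
rewrite big_cons -IH -fM//; last exact: character_prod.
apply/fE => [||t _]; rewrite ?big_cons//; first exact: character_prod.
by apply: characterM => //; exact: character_prod.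
Qed.

Lemma coord_monomial (I : finType) (chi : I -> 'M[k]_n -> k) (z : I -> int) :
  (forall i, character T (chi i)) ->
  f (fun t => \prod_i chi i t ^ z i) = \sum_i (z i)%:~R *: f (chi i).
Proof.
move=> C; rewrite (coord_prod _ (chi := fun i t => chi i t ^ z i)); last by move=> i; exact: characterX.
by apply: eq_bigr => i _; rewrite coordX.
Qed.

Lemma coord_eq0 chi : character T chi -> f chi = 0 <-> eq_character T chi (fun=> 1).
Proof. by move=> C; rewrite -coord_const1; apply: fE => //; exact: character_const1. Qed.

End CharacterCoordinates.

Lemma clear_denominators m (u : 'I_m -> rat) : exists N : int, exists z : 'I_m -> int,
  N != 0 /\ forall j, u j * N%:~R = (z j)%:~R.
Proof.
exists (\prod_j denq (u j)), (fun j => numq (u j) * \prod_(i | i != j) denq (u i)).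
split=> [|j]; first by apply/prodf_neq0 => j _; exact: denq_neq0.
rewrite (bigD1 j)//= !intrM -{1}(divq_num_den (u j)) mulrA divfK// intr_eq0.
exact: denq_neq0.
Qed.

Section SimpleRoots.
Import F4Roots.
Variables (k : fieldType) (n : nat) (G T : set 'M[k]_n).
Hypotheses (Ta : algebraic_group T).
Variables (f : ('M[k]_n -> k) -> 'rV[rat]_4).
Hypotheses (fM : forall chi psi, character T chi -> character T psi ->
  f (fun t => chi t * psi t) = f chi + f psi).
Hypotheses (fE : forall chi psi, character T chi -> character T psi ->
  f chi = f psi <-> eq_character T chi psi).
Hypotheses (fR : [set f alpha | alpha in group_root G T] = F4_root_system).

Lemma root_vector beta : group_root G T beta -> exists2 x, List.In x roots & f beta = toR x.
Proof. by move=> Rb; apply/F4_root_toR; rewrite -fR; exists beta. Qed.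

Lemma vector_root x : List.In x roots -> exists2 beta, group_root G T beta & f beta = toR x.
Proof.
move=> Rx; have : F4_root_system (toR x) by apply/F4_root_toR; exists x.
by rewrite -fR => -[beta Rb <-]; exists beta.
Qed.

Lemma toR_root x beta : group_root G T beta -> f beta = toR x -> List.In x roots.
Proof. by move=> /root_vector[y Ry ->] /toR_inj <-. Qed.

Section System.
Variables (r : nat) (alpha : 'I_r -> 'M[k]_n -> k) (SR : simple_roots G T alpha).

Let Ca i : character T (alpha i).
Proof. by case: SR => /(_ i)[]. Qed.

Lemma simple_roots_indep (z : 'I_r -> int) : \sum_i (z i)%:~R *: f (alpha i) = 0 ->
  forall i, z i = 0.
Proof.
rewrite -(coord_monomial Ta fM fE)// => E0; case: SR => _ + _; apply.
have CP : character T (fun t => \prod_i alpha i t ^ z i).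
  by apply: character_prod => i; exact: characterX.
exact: (proj1 (coord_eq0 fM fE CP)).
Qed.

Lemma simple_roots_indep2 (z w : 'I_r -> int) :
  \sum_i (z i)%:~R *: f (alpha i) = \sum_i (w i)%:~R *: f (alpha i) -> forall i, z i = w i.
Proof.
move=> E i; apply/eqP; rewrite -subr_eq0; apply/eqP; move: i.
apply: simple_roots_indep; rewrite -[RHS](subrr (\sum_i (w i)%:~R *: f (alpha i))) -{1}E -sumrB.
by apply: eq_bigr => i _; rewrite -scalerBl intrB.
Qed.

Lemma root_simple_combination beta : group_root G T beta -> exists z : 'I_r -> int,
  f beta = \sum_i (z i)%:~R *: f (alpha i) /\ ((forall i, 0 <= z i) \/ (forall i, z i <= 0)).
Proof.
move=> Rb; case: (Rb) => Cb _ _; case: SR => _ _ /(_ _ Rb)[m [E|E]].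
- exists (fun i => (m i)%:Z); split; last by left.
  rewrite -(coord_monomial Ta fM fE)//; apply/fE => //.
  by apply: character_prod => i; exact: characterX.
- exists (fun i => - (m i)%:Z); split; last by right=> i; rewrite oppr_le0.
  rewrite -(coord_monomial Ta fM fE)//; apply/fE => //; last by move=> t Tt; rewrite (E t Tt) /=; apply: eq_bigr => i _; rewrite exprnN.
  by apply: character_prod => i; exact: characterX.
Qed.

Definition simple_mx : 'M[rat]_(r, 4) := \matrix_i f (alpha i).

Lemma mul_simple_mx (u : 'rV[rat]_r) : u *m simple_mx = \sum_i u 0 i *: f (alpha i).
Proof. by rewrite mulmx_sum_row; apply: eq_bigr => i _; rewrite rowK. Qed.

Lemma simple_mx_free : row_free simple_mx.
Proof.
rewrite -kermx_eq0; apply/rowV0P => u /sub_kermxP; rewrite mul_simple_mx => E.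
have [N [z [N0 zE]]] := clear_denominators (u 0).
have z0 : forall i, z i = 0.
  apply: simple_roots_indep; rewrite -[RHS](scaler0 _ N%:~R) -[X in _ = _ *: X]E scaler_sumr.
  by apply: eq_bigr => i _; rewrite scalerA -zE mulrC.
apply/rowP => i; have := zE i; rewrite z0 mxE => /eqP.
by rewrite mulf_eq0 intr_eq0 (negbTE N0) orbF => /eqP.
Qed.

Lemma simple_mx_full : row_full simple_mx.
Proof.
rewrite -sub1mx; apply/row_subP => i.
have : F4_root_system (row i 1%:M).
  by left; left; exists false, i; rewrite expr0 scale1r rowE mulmx1.
rewrite -fR => -[beta Rb <-]; have [z [-> _]] := root_simple_combination Rb.
apply: summx_sub => j _; apply: scalemx_sub; have := row_sub j simple_mx.
by rewrite rowK.
Qed.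

(** Integral independence becomes rational after clearing denominators, and the roots e_i show that
    the simple roots span Q^4. *)
Lemma simple_roots_rank : r = 4%N.
Proof. by rewrite -(eqP simple_mx_free); apply/eqP; exact: simple_mx_full. Qed.

Lemma simple_roots_span v : exists N : int, exists z : 'I_r -> int,
  N != 0 /\ N%:~R *: v = \sum_i (z i)%:~R *: f (alpha i).
Proof.
have /submxP[u ->] : (v <= simple_mx)%MS by apply: submx_full; exact: simple_mx_full.
have [N [z [N0 zE]]] := clear_denominators (u 0); exists N, z; split=> //.
by rewrite mul_simple_mx scaler_sumr; apply: eq_bigr => i _; rewrite scalerA -zE mulrC.
Qed.

Lemma sum_delta (c : int) j : \sum_i ((if i == j then c else 0)%:~R : rat) *: f (alpha i) = c%:~R *: f (alpha j).
Proof.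
rewrite (bigD1 j)//= eqxx big1 ?addr0// => i /negbTE ->; exact: scale0r.
Qed.

(** A root equal to the difference of two simple roots would have coefficients 1 and -1, of opposite
    signs; equal or opposite simple roots would be dependent. *)
Lemma simple_roots_obtuse i j x y : i != j -> f (alpha i) = toR x -> f (alpha j) = toR y -> obtuse x y.
Proof.
move=> ij xE yE; have comb2 (c d : int) : c%:~R *: toR x + d%:~R *: toR y =
    \sum_l ((if l == i then c else 0) + (if l == j then d else 0))%:~R *: f (alpha l).
  rewrite -xE -yE -!sum_delta -big_split; apply: eq_bigr => l _.
  by rewrite intrD scalerDl.
split=> [xyR|].
  have [beta Rb] := vector_root xyR; rewrite toRB => bE.
  have [z [zE sz]] := root_simple_combination Rb.
  have zij l : z l = (if l == i then 1 else 0) + (if l == j then -1 else 0).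
    by move: l; apply: simple_roots_indep2; rewrite -comb2 -zE bE scale1r mulrNz scaleN1r.
  have := zij i; have := zij j; rewrite !eqxx (negbTE ij) eq_sym (negbTE ij) => zj zi.
  by case: sz => sz; [have := sz j; rewrite zj|have := sz i; rewrite zi].
split=> E.
  have : \sum_l ((if l == i then 1 else 0) + (if l == j then -1 else 0))%:~R *: f (alpha l) = 0.
    by rewrite -comb2 E mulrNz scale1r scaleN1r subrr.
  by move=> /simple_roots_indep/(_ i); rewrite eqxx (negbTE ij).
have : \sum_l ((if l == i then 1 else 0) + (if l == j then 1 else 0))%:~R *: f (alpha l) = 0.
  rewrite -comb2 !scale1r -toRD E; apply/rowP => -[l Hl]; rewrite !mxE /=.
  by case: l Hl => [|[|[|[|l]]]] Hl; rewrite ?mul0r.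
by move=> /simple_roots_indep/(_ i); rewrite eqxx (negbTE ij).
Qed.

End System.
End SimpleRoots.

Section RootReflections.
Import F4Roots.
Variables (k : fieldType) (n : nat) (G T : set 'M[k]_n).
Hypotheses (GG : algebraic_group G) (TT : torus T) (TG : T `<=` G).
Variables (f : ('M[k]_n -> k) -> 'rV[rat]_4).
Hypotheses (fM : forall chi psi, character T chi -> character T psi ->
  f (fun t => chi t * psi t) = f chi + f psi).
Hypotheses (fE : forall chi psi, character T chi -> character T psi ->
  f chi = f psi <-> eq_character T chi psi).
Hypotheses (fR : [set f alpha | alpha in group_root G T] = F4_root_system).

Let Ta : algebraic_group T.
Proof. by case: TT. Qed.

Lemma weyl_group_normalizer w g : weyl_group G T w -> w g -> normalizer G T g.
Proof.
move=> [h Nh ->] [t Tt <-]; apply: (normalizer_mul GG) => //.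
exact: (torus_normalizer TT TG).
Qed.

(** The [pairing] of [root_reflection] is just some integer function. Conjugation by g permutes the
    roots and the pairing of alpha with itself is 2, so a root y + z x goes to y - (p + z) x; the
    reversal of root strings then forces p to be the Cartan integer. *)
Lemma coord_reflection alpha beta w g x y : root_reflection G T alpha w -> w g ->
  group_root G T alpha -> group_root G T beta -> f alpha = toR x -> f beta = toR y ->
  f (beta \o conj_by g) = toR (vsub y (vscale (cartan x y) x)).
Proof.
move=> [Ww [p [p2 wE]]] wg Ra Rb aE bE; have Ng := weyl_group_normalizer Ww wg.
have Ca : character T alpha by case: Ra.
have fw chi : character T chi -> f (chi \o conj_by g) = f chi - (p chi)%:~R *: f alpha.
  move=> C; rewrite -scaleNr -mulrNz -(coordX Ta fM fE)// -fM//; last exact: characterX.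
  apply/fE; [exact: (character_twist GG Ng) |by apply: characterM => //; exact: characterX|].
  by move=> t Tt; rewrite /= /conj_by (wE _ C _ _ wg Tt).
have Cb : character T beta by case: Rb.
have Rx := toR_root fR Ra aE; have Ry := toR_root fR Rb bE.
rewrite fw// bE aE -{1}[p beta]Z_of_intK -toRZ -toRB; congr (toR (vsub _ (vscale _ _))).
apply: reflection_cartan => // z /(vector_root fR)[gam Rg gE].
have Cg : character T gam by case: Rg.
have := root_twist GG TT Ng Rg; move/(toR_root fR); apply.
have -> : f (gam \o conj_by g) = f (fun t => (beta \o conj_by g) t * ((alpha \o conj_by g) t) ^ (int_of_Z z)).
  have Cbz : character T (fun t => beta t * alpha t ^ int_of_Z z).
    by apply: characterM => //; exact: characterX.
  apply/fE; first exact: (character_twist GG Ng).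
    apply: (characterM (psi := fun t => (alpha \o conj_by g) t ^ int_of_Z z)); first exact: (character_twist GG Ng).
    by apply: characterX => //; exact: (character_twist GG Ng).
  move=> t Tt /=; have /fE : f gam = f (fun t => beta t * alpha t ^ int_of_Z z).
    rewrite (fM Cb (characterX Ta _ Ca)) (coordX Ta fM fE)// gE aE bE toRD toRZ//.
  by move=> /(_ Cg Cbz); apply; exact: (normalizer_conj GG Ng).
rewrite (fM (psi := fun t => (alpha \o conj_by g) t ^ int_of_Z z)); first last.
- by apply: characterX => //; exact: (character_twist GG Ng).
- exact: (character_twist GG Ng).
rewrite (coordX Ta fM fE); last exact: (character_twist GG Ng).
have -> : BinInt.Z.add (Z_of_int (p beta)) z = Z_of_int (p beta + int_of_Z z).
  by rewrite rmorphD /= int_of_ZK.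
rewrite !fw// p2 bE aE toRB toRZ Z_of_intK; set a := toR x; set b := toR y.
by apply/rowP => l; rewrite intrD !(mxE, mulrnDl) /=; ring.
Qed.

End RootReflections.

Section CoxeterTwist.
Import F4Roots.
Variables (k : fieldType) (n : nat) (G T : set 'M[k]_n).
Hypotheses (GG : algebraic_group G) (TT : torus T) (TG : T `<=` G).
Variables (f : ('M[k]_n -> k) -> 'rV[rat]_4).
Hypotheses (fM : forall chi psi, character T chi -> character T psi ->
  f (fun t => chi t * psi t) = f chi + f psi).
Hypotheses (fE : forall chi psi, character T chi -> character T psi ->
  f chi = f psi <-> eq_character T chi psi).
Hypotheses (fR : [set f alpha | alpha in group_root G T] = F4_root_system).

Let Ta : algebraic_group T.
Proof. by case: TT. Qed.

Lemma coord_twist (I : finType) (beta : I -> 'M[k]_n -> k) (z : I -> int) chi g :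
  normalizer G T g -> (forall i, character T (beta i)) -> character T chi ->
  f chi = \sum_i (z i)%:~R *: f (beta i) ->
  f (chi \o conj_by g) = \sum_i (z i)%:~R *: f (beta i \o conj_by g).
Proof.
move=> Ng Cb C; rewrite -(coord_monomial Ta fM fE)//.
have CP : character T (fun t => \prod_i beta i t ^ z i).
  by apply: character_prod => i; exact: characterX.
move/(fE C CP) => E; rewrite -(coord_monomial Ta fM fE (chi := fun i => beta i \o conj_by g)).
  apply/fE; [exact: (character_twist GG Ng)|exact: (character_twist GG Ng CP)|].
  by move=> t Tt; apply: E; exact: (normalizer_conj GG Ng).
by move=> i; exact: (character_twist GG Ng).
Qed.

Let o0 : 'I_4 := @Ordinal 4 0 isT.
Let o1 : 'I_4 := @Ordinal 4 1 isT.
Let o2 : 'I_4 := @Ordinal 4 2 isT.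
Let o3 : 'I_4 := @Ordinal 4 3 isT.

Lemma big_ord4 (R : Type) (idx : R) (op : R -> R -> R) (F : 'I_4 -> R) :
  \big[op/idx]_(i < 4) F i = op (F o0) (op (F o1) (op (F o2) (op (F o3) idx))).
Proof.
rewrite !big_ord_recl big_ord0; congr (op (F _) (op (F _) (op (F _) (op (F _) _)))); exact: val_inj.
Qed.

Definition comb4 (c : vec) (v : 'I_4 -> vec) := comb c (v o0) (v o1) (v o2) (v o3).

Lemma toR_comb c v : toR (comb4 c v) = \sum_i (int_of_Z (vcoord c i))%:~R *: toR (v i).
Proof. by case: c => [[[c0 c1] c2] c3]; rewrite big_ord4 /comb4 /comb !toRD !toRZ addr0. Qed.

Variables (alpha : 'I_4 -> 'M[k]_n -> k) (SR : simple_roots G T alpha).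
Variables (s : 'I_4 -> set 'M[k]_n) (sR : forall i, root_reflection G T (alpha i) (s i)).
Variables (a : 'I_4 -> vec) (aE : forall i, f (alpha i) = toR (a i)).

Let Ra i : group_root G T (alpha i).
Proof. by case: SR. Qed.
Let Ca i : character T (alpha i).
Proof. by case: (Ra i). Qed.

Definition cartan_row (x : vec) : vec :=
  (cartan x (a o0), cartan x (a o1), cartan x (a o2), cartan x (a o3)).

Let W := cox (cartan_row (a o0)) (cartan_row (a o1)) (cartan_row (a o2)) (cartan_row (a o3)).

Lemma coord_simple_reflection i c chi g : s i g -> character T chi -> f chi = toR (comb4 c a) ->
  f (chi \o conj_by g) = toR (comb4 c (fun j => vsub (a j) (vscale (cartan (a i) (a j)) (a i)))).
Proof.
move=> sg C; rewrite !toR_comb; under eq_bigr do rewrite -aE.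
have Ng : normalizer G T g by case: (sR i) => Ws _; exact: (weyl_group_normalizer GG TT TG Ws).
move/(coord_twist Ng Ca C) => ->; apply: eq_bigr => j _; congr (_ *: _).
exact: (coord_reflection GG TT TG fM fE fR (sR i)).
Qed.

Lemma coxeter_coset g : (\big[@setmulmx k n/T]_(i < 4) s i) g -> normalizer G T g /\
  forall c chi, character T chi -> f chi = toR (comb4 c a) -> f (chi \o conj_by g) = toR (comb4 (W c) a).
Proof.
have Ns i h : s i h -> normalizer G T h.
  by move=> sh; case: (sR i) => Ws _; exact: (weyl_group_normalizer GG TT TG Ws).
(* The iterated product of cosets ends with the neutral coset T, hence the extra factor t, which
   acts trivially on T. *)
rewrite big_ord4 => -[g0 s0 [_ [g1 s1 [_ [g2 s2 [_ [g3 s3 [t Tt <-]] <-]] <-]] <-]].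
have Nt := torus_normalizer TT TG Tt.
have N3 := normalizer_mul GG (Ns _ _ s3) Nt; have N2 := normalizer_mul GG (Ns _ _ s2) N3.
have N1 := normalizer_mul GG (Ns _ _ s1) N2; have N0 := normalizer_mul GG (Ns _ _ s0) N1.
split=> // c chi C E.
have twistM g' h' (psi : 'M[k]_n -> k) : normalizer G T g' -> normalizer G T h' ->
    psi \o conj_by (g' *m h') = (psi \o conj_by h') \o conj_by g'.
  by move=> Ng' Nh'; apply: funext => x /=; rewrite conj_by_comp ?(normalizer_unit GG Ng') ?(normalizer_unit GG Nh').
rewrite (twistM _ _ _ (Ns _ _ s0) N1) (twistM _ _ _ (Ns _ _ s1) N2) (twistM _ _ _ (Ns _ _ s2) N3) (twistM _ _ _ (Ns _ _ s3) Nt).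
have C3 := character_twist GG Nt C.
have E3 : f (chi \o conj_by t) = toR (comb4 c a).
  by rewrite -E; apply/fE => // u Tu /=; rewrite (conj_by_torus TT).
have := coord_simple_reflection s3 C3 E3; rewrite /comb4 comb_refl3 => E2.
have C2 := character_twist GG (Ns _ _ s3) C3.
have := coord_simple_reflection s2 C2 E2; rewrite /comb4 comb_refl2 => E1.
have C1 := character_twist GG (Ns _ _ s2) C2.
have := coord_simple_reflection s1 C1 E1; rewrite /comb4 comb_refl1 => E0.
have C0 := character_twist GG (Ns _ _ s1) C1.
by have := coord_simple_reflection s0 C0 E0; rewrite /comb4 comb_refl0.
Qed.

End CoxeterTwist.

Section ConjugationPowers.
Variables (k : fieldType) (n : nat) (G T : set 'M[k]_n).
Hypotheses (GG : algebraic_group G) (TT : torus T) (TG : T `<=` G).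

Lemma normalizer_exp g j : normalizer G T g -> normalizer G T (g ^+ j).
Proof.
move=> Ng; elim: j => [|j IH]; last by rewrite exprS; exact: (normalizer_mul GG).
by apply: (torus_normalizer TT TG); case: TT => Ta _; exact: (group_1 Ta).
Qed.

Lemma conj_by_expS g j t : normalizer G T g -> conj_by (g ^+ j.+1) t = conj_by g (conj_by (g ^+ j) t).
Proof.
move=> Ng; rewrite exprSr conj_by_comp//.
  exact: (normalizer_unit GG (normalizer_exp j Ng)).
exact: (normalizer_unit GG Ng).
Qed.

End ConjugationPowers.

Section CoxeterRelation.
Import F4Roots.
Variables (k : fieldType) (n : nat) (G T : set 'M[k]_n).
Hypotheses (GG : algebraic_group G) (TT : torus T) (TG : T `<=` G) (G_F4 : has_type_F4 G T).

Let Ta : algebraic_group T.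
Proof. by case: TT. Qed.

Lemma F4_root_exists : exists alpha, group_root G T alpha.
Proof.
case: G_F4 => f [_ _ fR]; have : F4_root_system (delta_mx 0 0).
  by left; left; exists false, 0; rewrite expr0 scale1r.
by rewrite -fR => -[alpha Ra _]; exists alpha.
Qed.

(** X(T) embeds in a rational vector space, so a root, being nontrivial, has no trivial sixth
    power. *)
Lemma torus_exponent6 : ~ forall t, T t -> t ^+ 6 = 1%:M.
Proof.
move=> H; have [alpha Ra] := F4_root_exists; case: (Ra) => Ca NE _; apply: NE.
case: G_F4 => f [fM fE _]; apply/(coord_eq0 fM fE) => //.
have : f (fun t => alpha t ^ 6) = 0.
  rewrite (coord_eq0 fM fE (characterX Ta 6 Ca)) => t Tt.
  by rewrite -(character1 Ta Ca) -(H t Tt) (character_exp Ta _ Ca).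
rewrite (coordX Ta fM fE)// => /eqP; rewrite scaler_eq0 => /orP[|/eqP//].
by [].
Qed.

Lemma coxeter_torus_relation c : coxeter_element G T c -> forall g, c g ->
  normalizer G T g /\ forall t, T t -> conj_by (g ^+ 4) t *m t = conj_by (g ^+ 2) t.
Proof.
move=> [r [alpha [s [SR sR ->]]]] g; case: G_F4 => f [fM fE fR].
have r4 := simple_roots_rank Ta fM fE fR SR; subst r => cg.
have Ra i : group_root G T (alpha i) by case: SR.
have Ca i : character T (alpha i) by case: (Ra i).
have /choice[a aP] : forall i, exists x, List.In x roots /\ f (alpha i) = toR x.
  by move=> i; have [x Rx xE] := root_vector fR (Ra i); exists x.
have aE i : f (alpha i) = toR (a i) by case: (aP i).
have aR i : List.In (a i) roots by case: (aP i).
have [Ng WE] := coxeter_coset GG TT TG fM fE fR SR sR aE cg; split=> // t Tt.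
have Nj j := normalizer_exp GG TT TG j Ng.
have Tj j u (Tu : T u) : T (conj_by (g ^+ j) u) by exact: (normalizer_conj GG (Nj j)).
have O i j x y : i != j -> x = a i -> y = a j -> obtuse x y.
  by move=> ij -> ->; exact: (simple_roots_obtuse Ta fM fE fR SR ij).
have gen y : List.In y roots -> exists m, y = comb4 m a.
  move=> /(vector_root fR)[beta Rb bE]; have [z [zE _]] := root_simple_combination Ta fM fE SR Rb.
  exists (mkvec (fun i => Z_of_int (z i))); apply: toR_inj; rewrite -bE zE toR_comb.
  by apply: eq_bigr => i _; rewrite vcoord_mkvec Z_of_intK aE.
have rel e : List.In e basis -> cox_relation (cartan_row a (a (@Ordinal 4 0 isT)))
    (cartan_row a (a (@Ordinal 4 1 isT))) (cartan_row a (a (@Ordinal 4 2 isT)))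
    (cartan_row a (a (@Ordinal 4 3 isT))) e.
  by move: e; apply: coxeter_relation; try exact: aR; try exact: (O _ _ _ _ _ erefl erefl); exact: gen.
set W := cox _ _ _ _ in rel WE.
have WJ j c' chi : character T chi -> f chi = toR (comb4 c' a) ->
    f (chi \o conj_by (g ^+ j)) = toR (comb4 (iter j W c') a).
  elim: j c' chi => [|j IH] c' chi C E.
    rewrite -E; apply/fE => //; first exact: (character_twist GG (Nj 0%N)).
    by move=> u Tu /=; rewrite (conj_by_torus TT)//; exact: (group_1 Ta).
  rewrite iterSr -(IH _ (chi \o conj_by g)).
  - by congr f; apply: funext => u /=; rewrite (conj_by_expS GG TT TG).
  - exact: (character_twist GG Ng).
  - exact: WE.
have rel_alpha i : f (alpha i \o conj_by (g ^+ 4)) + f (alpha i) = f (alpha i \o conj_by (g ^+ 2)).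
  have [e [eb ea]] : exists e, List.In e basis /\ comb4 e a = a i.
    by move: i; apply: ord4_case; apply: comb_basis => /=; tauto.
  rewrite !(WJ _ e) ?aE ?ea// -ea -toRD; congr toR.
  by rewrite /comb4 -comb_vadd; congr (comb _ _ _ _ _); exact: rel.
(* A character is a combination of simple roots only after multiplication by some N, which may be
   cancelled in Q^4. *)
have rel_chi chi : character T chi ->
    f (chi \o conj_by (g ^+ 4)) + f chi = f (chi \o conj_by (g ^+ 2)).
  move=> C; have [N [z [N0 zE]]] := simple_roots_span Ta fM fE fR SR (f chi).
  have N0' : (N%:~R : rat) != 0 by rewrite intr_eq0.
  have CN := characterX Ta N C; have fN := coordX Ta fM fE N C; rewrite zE in fN.
  have twN j : N%:~R *: f (chi \o conj_by (g ^+ j)) = \sum_i (z i)%:~R *: f (alpha i \o conj_by (g ^+ j)).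
    rewrite -(coord_twist GG TT fM fE (Nj j) Ca CN fN).
    by rewrite -(coordX Ta fM fE)//; exact: (character_twist GG (Nj j)).
  apply: (scalerI N0'); rewrite scalerDr !twN zE -big_split /=; apply: eq_bigr => i _.
  by rewrite -scalerDr rel_alpha.
apply: (torus_separates TT) => [||chi C]; [exact: (group_mul Ta (Tj _ _ Tt))|exact: Tj|].
have C4 := character_twist GG (Nj 4%N) C; have C2 := character_twist GG (Nj 2%N) C.
have E : f (fun t => (chi \o conj_by (g ^+ 4)) t * chi t) = f (chi \o conj_by (g ^+ 2)).
  by rewrite fM ?rel_chi.
have /= <- := proj1 (fE _ _ (characterM C4 C) C2) E t Tt.
by case: C => _ _ ->//; exact: Tj.
Qed.

End CoxeterRelation.

(** * Powers in a Coxeter coset *)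

Section CoxeterSequence.
Variables (k : fieldType) (x : nat -> k).
Hypotheses (x0 : forall j, x j != 0) (x_rel : forall j, x (4 + j)%N * x j = x (2 + j)%N).

Lemma sequence_step4 j : x (4 + j)%N = x (2 + j)%N / x j.
Proof. by rewrite -x_rel mulfK. Qed.

Lemma sequence_step6 j : x (6 + j)%N = (x j)^-1.
Proof.
rewrite (sequence_step4 (2 + j)) sequence_step4 mulrAC mulfV ?mul1r//.
Qed.

Lemma sequence_step12 j : x (12 + j)%N = x j.
Proof. by rewrite (sequence_step6 (6 + j)) sequence_step6 invrK. Qed.

Lemma sequence_mod12 j : x j = x (j %% 12)%N.
Proof.
rewrite {1}(divn_eq j 12); elim: (j %/ 12)%N => [|q IH]; first by rewrite mul0n.
by rewrite mulSn -addnA sequence_step12.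
Qed.

Lemma sequence_table j : x j = nth 0
  [:: x 0%N; x 1%N; x 2%N; x 3%N; x 2%N / x 0%N; x 3%N / x 1%N; (x 0%N)^-1; (x 1%N)^-1;
      (x 2%N)^-1; (x 3%N)^-1; x 0%N / x 2%N; x 1%N / x 3%N] (j %% 12)%N.
Proof.
have s4 := sequence_step4; have s6 := sequence_step6.
rewrite sequence_mod12; have := ltn_pmod j (isT : (0 < 12)%N).
move: (j %% 12)%N; do 12! (case => [_|] /=; first by rewrite ?s6 ?(s4 0%N) ?(s4 1%N) ?invf_div).
by [].
Qed.

(** The first six pairs are the orders of the theorem; the others complete the list of (r, 12) for
    all non-zero residues r, as needed for periodicity. *)
Lemma sequence_prod m d : ((m %% 12)%N, d) \in [:: (1, 12); (2, 6); (3, 4); (4, 3); (5, 12); (6, 2);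
    (2, 12); (3, 12); (4, 12); (6, 12); (7, 12); (8, 12); (9, 12); (10, 12); (11, 12)]%N ->
  \prod_(i < d) x (m * i)%N = 1.
Proof.
move=> H; under eq_bigr => i _ do rewrite sequence_mod12 -modnMml.
move: (m %% 12)%N H => r; rewrite !inE.
have n0 := x0 0; have n1 := x0 1; have n2 := x0 2; have n3 := x0 3.
do 14! (case/orP => [/eqP[-> ->]|]; first by rewrite !big_ord_recl big_ord0 /=
  !(sequence_table (_ %% _)) /=; field; rewrite ?n0 ?n1 ?n2 ?n3).
move=> /eqP[-> ->]; rewrite !big_ord_recl big_ord0 /= !(sequence_table (_ %% _)) /=.
by field; rewrite ?n0 ?n1 ?n2 ?n3.
Qed.

Lemma sequence_const1 : (forall j, x j = x 0%N) -> x 0%N = 1.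
Proof. by move=> E; apply: (mulfI (x0 0)); rewrite mulr1 -{1}(E 4) (x_rel 0) E. Qed.

(** Period 4 turns the recurrence into x_(j+2) = x_j^2, so x_0^4 = x_0 and x_0^3 = 1; period 6 makes
    x_0 its own inverse. The exponent 6 covers both cases. *)
Lemma sequence_period46 : (forall j, x (4 + j)%N = x j) \/ (forall j, x (6 + j)%N = x j) ->
  x 0%N ^+ 6 = 1.
Proof.
case=> E.
  have D j : x (2 + j)%N = x j ^+ 2 by rewrite -x_rel E expr2.
  apply: (mulfI (x0 0)); rewrite mulr1 -exprS.
  have E4 : x 0%N ^+ 4 = x 0%N by rewrite -[RHS]E (D 2%N) (D 0%N) -exprM.
  by rewrite (exprD _ 4 3) E4 -exprS E4.
have : x 0%N * x 0%N = 1 by rewrite -{1}(E 0) (sequence_step6 0) mulVf.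
by rewrite -expr2 => e2; rewrite (exprM _ 2 3) e2 expr1n.
Qed.

End CoxeterSequence.

Section CosetPowers.
Variables (k : fieldType) (n : nat) (G T : set 'M[k]_n).
Hypotheses (GG : algebraic_group G) (TT : torus T) (TG : T `<=` G).

Let Ta : algebraic_group T.
Proof. by case: TT. Qed.

Lemma coset_power h t d : normalizer G T h -> T t -> exists P, [/\ T P,
  (h *m t) ^+ d = h ^+ d *m P &
  forall chi, character T chi -> chi P = \prod_(i < d) chi (conj_by (h ^+ i) t)].
Proof.
move=> Nh Tt; have hu := normalizer_unit GG Nh; elim: d => [|d [P [TP PE Pchi]]].
  exists 1%:M; split=> [||chi C]; rewrite ?expr0 ?mulmx1 ?big_ord0 ?(character1 Ta C)//.
  exact: (group_1 Ta).
have TP' := normalizer_conj GG Nh TP; exists (conj_by h P *m t); split=> [||chi C].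
- exact: (group_mul Ta).
- rewrite exprSr PE exprSr; change (h ^+ d *m P *m (h *m t) = h ^+ d *m h *m (conj_by h P *m t)).
  by rewrite /conj_by !mulmxA mulmxK.
have -> : chi (conj_by h P *m t) = chi (conj_by h P) * chi t by case: C => _ _ ->.
have := Pchi _ (character_twist GG Nh C); rewrite /= => ->; rewrite big_ord_recl mulrC.
congr (_ * _); first by rewrite (conj_by_torus TT)//; exact: (group_1 Ta).
by apply: eq_bigr => i _; rewrite -(conj_by_expS GG TT TG).
Qed.

Lemma coset_exp_coset g m : normalizer G T g ->
  coset_exp T [set g *m t | t in T] m = [set g ^+ m *m t | t in T].
Proof.
move=> Ng; elim: m => [|m IH] /=.
  by apply/seteqP; split=> [t Tt|_ [t Tt <-]]; rewrite ?mul1mx//; exists t; rewrite ?mul1mx.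
rewrite -/(coset_exp T _ m) IH.
have Nm := normalizer_exp GG TT TG m Ng; have mu := normalizer_unit GG Nm.
have E s t : g *m s *m (g ^+ m *m t) = g ^+ m.+1 *m (conj_by (g ^+ m) s *m t).
  rewrite exprS; change (g * g ^+ m) with (g *m g ^+ m).
  by rewrite /conj_by -!mulmxA (mulmxA (g ^+ m)) mulmxV// mul1mx.
apply/seteqP; split=> [_ [_ [s Ts <-] [_ [t Tt <-] <-]]|_ [t Tt <-]].
  exists (conj_by (g ^+ m) s *m t); last by rewrite E.
  by apply: (group_mul Ta) => //; exact: (normalizer_conj GG).
exists (g *m 1%:M); first by exists 1%:M => //; exact: (group_1 Ta).
by exists (g ^+ m *m t); [exists t|rewrite mulmx1 exprS; exact: mulmxA].
Qed.

End CosetPowers.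

Section CoxeterCoset.
Variables (k : closedFieldType) (k0 : [pchar k] =i pred0) (n : nat) (G T : set 'M[k]_n).
Hypotheses (Gs : simple_algebraic_group G) (Tm : maximal_torus G T) (G_F4 : has_type_F4 G T).
Variables (g : 'M[k]_n) (Ng : normalizer G T g).
Hypothesis (g_rel : forall t, T t -> conj_by (g ^+ 4) t *m t = conj_by (g ^+ 2) t).

Let GG : algebraic_group G.
Proof. by case: Gs. Qed.
Let TT : torus T.
Proof. by case: Tm. Qed.
Let TG : T `<=` G.
Proof. by case: Tm. Qed.
Let Ta : algebraic_group T.
Proof. by case: TT. Qed.
Let Nj j : normalizer G T (g ^+ j).
Proof. exact: (normalizer_exp GG TT TG). Qed.
Let Tj j t : T t -> T (conj_by (g ^+ j) t).
Proof. exact: (normalizer_conj GG). Qed.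
Let conjD i j t : conj_by (g ^+ (i + j)) t = conj_by (g ^+ i) (conj_by (g ^+ j) t).
Proof.
rewrite addnC exprD conj_by_comp//; exact: (normalizer_unit GG (Nj _)).
Qed.

Section OrbitSequence.
Variables (chi : 'M[k]_n -> k) (C : character T chi) (t : 'M[k]_n) (Tt : T t).

Let x j := chi (conj_by (g ^+ j) t).

Lemma orbit_neq0 j : x j != 0.
Proof. by case: C => _ N _; apply: N; exact: Tj. Qed.

Lemma orbit_rel j : x (4 + j)%N * x j = x (2 + j)%N.
Proof.
rewrite /x !conjD -g_rel; last exact: Tj.
by case: C => _ _ ->//; do ?apply: Tj.
Qed.

Lemma orbit0 : x 0%N = chi t.
Proof. by rewrite /x (conj_by_torus TT)//; exact: (group_1 Ta). Qed.

End OrbitSequence.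

Lemma coxeter_exp12 : g ^+ 12 = 1%:M.
Proof.
have u12 := normalizer_unit GG (Nj 12).
have T12 : T (g ^+ 12).
  apply: (maximal_torus_self_centralizing k0 Gs Tm (F4_root_exists G_F4)); first by case: (Nj 12).
  move=> t Tt; apply: (conj_by_comm u12).
  apply: (torus_separates TT) => // [|chi C]; first exact: Tj.
  have := sequence_step12 (orbit_neq0 C Tt) (orbit_rel C Tt) 0; rewrite addn0 => ->.
  exact: orbit0.
apply: (torus_separates TT) => // [|chi C]; first exact: (group_1 Ta).
rewrite (character1 Ta C) -(orbit0 chi T12).
apply: (sequence_const1 (orbit_neq0 C T12) (orbit_rel C T12)) => j; congr chi.
have cj i : conj_by (g ^+ i) (g ^+ 12) = g ^+ 12.
  apply: (comm_conj_by (normalizer_unit GG (Nj i))).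
  by change (g ^+ i * g ^+ 12 = g ^+ 12 * g ^+ i); rewrite -!exprD addnC.
by rewrite !cj.
Qed.

Lemma coxeter_exp_torus j : T (g ^+ j) -> (12 %| j)%N.
Proof.
move=> Tgj; apply/negPn/negP => n12.
have [e [ge [q qE]]] : exists e, (e = 4 \/ e = 6)%N /\ exists q, (j * q = e %[mod 12])%N.
  have : (j %% 12 != 0)%N by [].
  have := ltn_pmod j (isT : (0 < 12)%N).
  have M q : (j * q = (j %% 12) * q %[mod 12])%N by rewrite modnMml.
  move: (j %% 12)%N M => r M lr r0.
  (* Indexed by r = j mod 12, this list and the next give e and q with r q = e mod 12: e is 6 for r
     = 3, 6, 9 and 4 otherwise. Entry 0 is a dummy. *)
  exists (nth 0 [:: 0; 4; 4; 6; 4; 4; 6; 4; 4; 6; 4; 4] r)%N.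
  split; first by case: r lr r0 {M} => [|[|[|[|[|[|[|[|[|[|[|[|r]]]]]]]]]]]] //=; tauto.
  exists (nth 0 [:: 0; 4; 2; 2; 1; 8; 1; 4; 2; 2; 4; 8] r)%N; rewrite M.
  by case: r lr r0 {M} => [|[|[|[|[|[|[|[|[|[|[|[|r]]]]]]]]]]]].
have Te : T (g ^+ e).
  have E m : g ^+ m = g ^+ (m %% 12).
    by rewrite {1}(divn_eq m 12) exprD mulnC exprM coxeter_exp12 expr1n mul1r.
  by rewrite E -qE -E exprM; exact: (group_exp Ta).
apply: (torus_exponent6 TT G_F4) => t Tt.
have Ce := conj_by_torus TT Te.
apply: (torus_separates TT) => [||chi C]; [exact: (group_exp Ta)|exact: (group_1 Ta)|].
rewrite (character_exp Ta _ C Tt) (character1 Ta C) -(orbit0 chi Tt).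
apply: (sequence_period46 (orbit_neq0 C Tt) (orbit_rel C Tt)).
by case: ge Ce => -> Ce; [left|right] => j'; rewrite conjD Ce//; exact: Tj.
Qed.

Lemma coset_torus m : [set g ^+ m *m t | t in T] = T -> (12 %| m)%N.
Proof.
move=> E; apply: coxeter_exp_torus; rewrite -E; exists 1%:M; last by rewrite mulmx1.
exact: (group_1 Ta).
Qed.

Lemma torus_coset m : (12 %| m)%N -> [set g ^+ m *m t | t in T] = T.
Proof.
move=> /dvdnP[q ->]; rewrite mulnC exprM coxeter_exp12 expr1n.
by apply/seteqP; split=> [_ [t Tt <-]|t Tt]; rewrite ?mul1mx//; exists t; rewrite ?mul1mx.
Qed.

Lemma coset_element_exp m d y : [set g ^+ m *m t | t in T] y ->
  ((m %% 12)%N, d) \in [:: (1, 12); (2, 6); (3, 4); (4, 3); (5, 12); (6, 2);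
    (2, 12); (3, 12); (4, 12); (6, 12); (7, 12); (8, 12); (9, 12); (10, 12); (11, 12)]%N ->
  y ^+ d = 1%:M.
Proof.
move=> [t Tt <-] md; have [P [TP -> Pchi]] := coset_power GG TT TG d (Nj m) Tt.
have -> : P = 1%:M.
  apply: (torus_separates TT) => [||chi C]; [exact: TP|exact: (group_1 Ta)|].
  rewrite Pchi// (character1 Ta C) -[RHS](sequence_prod (orbit_neq0 C Tt) (orbit_rel C Tt) md).
  by apply: eq_bigr => i _; rewrite exprM.
have /dvdnP[q E] : (12 %| m * d)%N.
  rewrite /dvdn -modnMml; move: md; rewrite !inE.
  by do 14! (case/orP => [/eqP[-> ->]|] //); move=> /eqP[-> ->].
by rewrite mulmx1 -exprM E mulnC exprM coxeter_exp12 expr1n.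
Qed.

(** In each pair d = 12 / gcd(m, 12). If y^j = 1 then g^(mj) lies in T, so 12 divides mj and d
    divides j. *)
Lemma coset_element_order m d y : [set g ^+ m *m t | t in T] y ->
  (m, d) \in [:: (1, 12); (2, 6); (3, 4); (4, 3); (5, 12); (6, 2)]%N -> has_order y d.
Proof.
move=> Cy md; split.
- by move: md; rewrite !inE; do 5! (case/orP => [/eqP[_ ->]|] //); move=> /eqP[_ ->].
- by apply: (coset_element_exp Cy); move: md; rewrite !inE; do 5! (case/orP => [/eqP[-> ->]|] //); move=> /eqP[-> ->].
move=> j jd yj; case: (Cy) => t Tt E; rewrite -E in yj.
have [P [TP PE _]] := coset_power GG TT TG j (Nj m) Tt; rewrite PE -exprM in yj.
have gu := normalizer_unit GG (Nj (m * j)).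
have : T (g ^+ (m * j)).
  have -> : g ^+ (m * j) = invmx P by rewrite -[RHS]mul1mx -yj mulmxK// (group_unit Ta).
  exact: (group_inv Ta).
move=> /coxeter_exp_torus; move: md jd; rewrite !inE; do 5! (case/orP => [/eqP[-> ->]|]; first by move: j {yj PE gu} => j; lia).
by move=> /eqP[-> ->]; move: j {yj PE gu} => j; lia.
Qed.

Lemma coset_periodic m : ~~ (12 %| m)%N -> periodic [set g ^+ m *m t | t in T].
Proof.
move=> m12 y Cy; have y12 : y ^+ 12 = 1%:M.
  apply: (coset_element_exp Cy); have := ltn_pmod m (isT : (0 < 12)%N).
  by move: m12; rewrite /dvdn; move: (m %% 12)%N; do 12! (case => //).
have ex : exists d, (0 < d)%N && (y ^+ d == 1%:M) by exists 12%N; rewrite y12 eqxx.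
exists (ex_minn ex); case: ex_minnP => d /andP[d0 /eqP yd] dmin; split=> // j /andP[j0 jd] yj.
by have := dmin j; rewrite j0 yj eqxx leqNgt jd => /(_ isT).
Qed.

End CoxeterCoset.

Theorem mainTheorem13 (k : closedFieldType) (k_char0 : [pchar k] =i pred0)
    (n : nat) (G T : set 'M[k]_n) (G_simple : simple_algebraic_group G)
    (T_max : maximal_torus G T) (G_F4 : has_type_F4 G T)
    (c : set 'M[k]_n) (c_W : weyl_group G T c) (c_cox : coxeter_element G T c) :
  has_coset_order T c 12 /\
  (forall m : nat, coset_exp T c m <> T -> periodic (coset_exp T c m)) /\
  (forall g, coset_exp T c 1 g -> has_order g 12) /\
  (forall g, coset_exp T c 2 g -> has_order g 6) /\
  (forall g, coset_exp T c 3 g -> has_order g 4) /\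
  (forall g, coset_exp T c 4 g -> has_order g 3) /\
  (forall g, coset_exp T c 5 g -> has_order g 12) /\
  (forall g, coset_exp T c 6 g -> has_order g 2).
Proof.
have GG : algebraic_group G by case: G_simple.
have TT : torus T by case: T_max.
have TG : T `<=` G by case: T_max.
have [Ta _] := TT.
have [g Ng cE] := c_W.
have cg : c g by rewrite cE; exists 1%:M; [exact: (group_1 Ta)|rewrite mulmx1].
have [_ g_rel] := coxeter_torus_relation GG TT TG G_F4 c_cox cg.
have expE m : coset_exp T c m = [set g ^+ m *m t | t in T] by rewrite cE (coset_exp_coset GG TT TG).
have ord := coset_element_order k_char0 G_simple T_max G_F4 Ng g_rel.
split.
  split=> // [|m m12]; first by rewrite expE (torus_coset k_char0 G_simple T_max G_F4 Ng g_rel).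
  rewrite expE => /(coset_torus k_char0 G_simple T_max G_F4 Ng g_rel); lia.
split.
  move=> m; rewrite expE => mT; apply: (coset_periodic k_char0 G_simple T_max G_F4 Ng g_rel).
  by apply/negP => /(torus_coset k_char0 G_simple T_max G_F4 Ng g_rel).
by do 5! (split; first by move=> y; rewrite expE => /ord; apply); move=> y; rewrite expE => /ord; apply.
Qed.
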